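(* The following identity holds: $$\begin{aligned}b_6(\lambda)=-\frac{i}{4\pi^2}\int_{\xi_1+\xi_2+\xi_3=\eta_1+\eta_2+\eta_3}&\frac{\lambda^6}{(2\lambda^2+\xi_1)(2\lambda^2+\xi_2)(2\lambda^2+\eta_2)(2\lambda^2+\eta_3)}\Big(\frac{1}{2\lambda^2+\eta_1}+\frac{1}{2\lambda^2+\xi_1+\xi_2-\eta_1}\Big)\\&\times\hat q(\xi_1)\hat q(\xi_2)\hat q(\xi_3)\hat q^*(\eta_1)\hat q^*(\eta_2)\hat q^*(\eta_3)\,d\xi_1d\xi_2d\eta_1d\eta_2d\eta_3 .\end{aligned}$$ Suppose that $q$ is a Schwartz function. Then one has the asymptotic series $$b_6(\lambda)\sim -i\sum_{j=4}^{\infty}H_{j6}\,\frac{\lambda^{4-2j}}{2^{j+1}},$$ where $$H_{j6}=\operatorname{Re}\Big(i^j\sum_{\alpha_1+\alpha_2+\alpha_3+\alpha_4+\alpha_5=j-4}(-1)^{\alpha_1+\alpha_2}\int_{\mathbb{R}}\Big[ q^{(\alpha_1)}q^{(\alpha_2)}q\,\overline{q^{(\alpha_3)}q^{(\alpha_4)}q^{(\alpha_5)}}+q^{(\alpha_1)}q^{(\alpha_2)}q^{*}\big(q\,\overline{q^{(\alpha_4)}q^{(\alpha_5)}}\big)^{(\alpha_3)}\Big]dx\Big).$$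
   Context: Here $\lambda\in\mathbb{C}$ with $\operatorname{Im}\lambda^2>0$, $q\in L^2(\mathbb{R})$ is the potential, and the asymptotic series is for $\lambda\to\infty$. $\hat q(\xi)=\frac1{\sqrt{2\pi}}\int_{\mathbb{R}}q(x)e^{-ix\xi}dx$; the star and the bar denote complex conjugation, $\hat q^*(\xi)=\overline{\hat q(\xi)}$; a superscript $(\alpha)$ is the $\alpha$-th derivative in $x$; the $\alpha_i$ are nonnegative integers. In the first formula $\xi_3=\eta_1+\eta_2+\eta_3-\xi_1-\xi_2$ and integration is over $(\xi_1,\xi_2,\eta_1,\eta_2,\eta_3)\in\mathbb{R}^5$. $b_6$ is the component of degree $6$ in $(q,q^* )$ of $\ln s_{11}(\lambda)$, where $s_{11}(\lambda)$ is the reciprocal of the transmission coefficient of the derivative nonlinear Schrödinger (Kaup–Newell) spectral problem, i.e. $b_6=s_6-s_2s_4+\tfrac13s_2^3$ with $$s_{2j}(\lambda)=(-1)^{j}\lambda^{2j}\int_{x_1<y_1<\cdots<x_j<y_j}\prod_{k=1}^{j}q(y_k)q^*(x_k)e^{2i\lambda^2(y_k-x_k)}dx_1dy_1\cdots dx_jdy_j .$$ Equivalently, $b_6=-4\lambda^6(I_1+3I_2)$, where $I_1,I_2$ are the integrals of $\prod_{k=1}^3q(y_k)q^*(x_k)e^{2i\lambda^2(y_k-x_k)}$ over $x_1<x_2<y_1<x_3<y_2<y_3$ and $x_1<x_2<x_3<y_1<y_2<y_3$ respectively.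
   Formalization: In the definition of H_{j6} the prefactor i^j is replaced by (-i)^j, since the printed sign is wrong for odd j (e.g. for q = e^{ikx}q_0 with q_0 real, even and Schwartz, H_{56} must be -5k H_{46}, while the printed formula gives +5k H_{46}). *)

(* Defs.v *)
From HB Require Import structures.
From mathcomp Require Import all_boot all_order all_algebra.
From mathcomp Require Import complex.
From mathcomp Require Import all_classical all_reals all_analysis.

Set Implicit Arguments.
Unset Strict Implicit.
Unset Printing Implicit Defensive.
Import Order.TTheory GRing.Theory Num.Theory.
Import numFieldNormedType.Exports.
Import mathcomp.real_closed.complex.

Local Open Scope classical_set_scope.
Local Open Scope ring_scope.
Local Open Scope complex_scope.

Definition iC {R : realType} : R[i] := 0 +i* 1.

Definition cexp (R : realType) (z : R[i]) : R[i] :=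
  (expR (Re z))%:C * (cos (Im z) +i* sin (Im z)).

Definition cmod (R : realType) (z : R[i]) : R := ComplexField.Normc.normc z.

Definition cmeasurable d (T : measurableType d) (R : realType)
    (f : T -> R[i]) : Prop :=
  measurable_fun setT (fun x => Re (f x)) /\
  measurable_fun setT (fun x => Im (f x)).

Definition cintegral d (T : measurableType d) (R : realType)
    (mu : {measure set T -> \bar R}) (D : set T) (f : T -> R[i]) : R[i] :=
  (\int[mu]_(x in D) Re (f x)) +i* (\int[mu]_(x in D) Im (f x)).

Definition cderiv (R : realType) (n : nat) (f : R -> R[i]) : R -> R[i] :=
  fun x => derive1n n (fun t => Re (f t)) x +i*
           derive1n n (fun t => Im (f t)) x.

Definition csmooth (R : realType) (f : R -> R[i]) : Prop :=
  forall (n : nat) (x : R),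
    derivable (derive1n n (fun t => Re (f t))) x 1 /\
    derivable (derive1n n (fun t => Im (f t))) x 1.

Definition schwartz (R : realType) (f : R -> R[i]) : Prop :=
  csmooth f /\
  forall m n : nat, exists C : R, forall x : R,
    `|x| ^+ m * cmod (cderiv n f x) <= C.

Section Lebesgue.
Context {R : realType}.
Implicit Types (q qhat : R -> R[i]) (lam : R[i]).
Local Open Scope ereal_scope.

Local Notation mu := (@lebesgue_measure R).

Definition square_integrable q : Prop :=
  cmeasurable q /\ \int[mu]_x ((cmod (q x)) ^+ 2)%:E < +oo.

Local Close Scope ereal_scope.

Definition fourier_on (D : set R) q (xi : R) : R[i] :=
  (Num.sqrt (2 * pi))^-1%:C *
  cintegral mu D (fun x => q x * cexp (- iC * (x * xi)%:C)).

(* qhat represents the Fourier (Plancherel) transform of q in L^2: it is the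
   L^2-limit of the Fourier integrals of the truncations of q to [-n, n].
   For q in L^1 /\ L^2 it is thus a.e. equal to [fourier_on setT q]. *)
Definition is_fourier_transform q qhat : Prop :=
  cmeasurable qhat /\
  (fun n : nat => (\int[mu]_xi
     ((cmod (qhat xi - fourier_on `[- n%:R, n%:R] q xi)) ^+ 2)%:E)%E)
    @ \oo --> 0%E.

Definition pair_kernel q lam (x y : R) : R[i] :=
  q y * conjc (q x) * cexp (2 * iC * lam ^+ 2 * (y - x)%:C).

Definition s2 q lam : R[i] :=
  (-1) ^+ 1 * lam ^+ 2 *
  cintegral (mu \x mu)%E
    [set z : R * R | let: (x1, y1) := z in x1 < y1]
    (fun z => let: (x1, y1) := z in pair_kernel q lam x1 y1).

Definition s4 q lam : R[i] :=
  (-1) ^+ 2 * lam ^+ 4 *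
  cintegral (mu \x mu \x mu \x mu)%E
    [set z : R * R * R * R | let: (x1, y1, x2, y2) := z in
      [/\ x1 < y1, y1 < x2 & x2 < y2]]
    (fun z => let: (x1, y1, x2, y2) := z in
      pair_kernel q lam x1 y1 * pair_kernel q lam x2 y2).

Definition s6 q lam : R[i] :=
  (-1) ^+ 3 * lam ^+ 6 *
  cintegral (mu \x mu \x mu \x mu \x mu \x mu)%E
    [set z : R * R * R * R * R * R |
      let: (x1, y1, x2, y2, x3, y3) := z in
      [/\ x1 < y1, y1 < x2, x2 < y2, y2 < x3 & x3 < y3]]
    (fun z => let: (x1, y1, x2, y2, x3, y3) := z in
      pair_kernel q lam x1 y1 * pair_kernel q lam x2 y2 *
      pair_kernel q lam x3 y3).

(* degree-6 part of ln (1 + s_2 + s_4 + s_6 + ...) *)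
Definition b6 q lam : R[i] :=
  s6 q lam - s2 q lam * s4 q lam + 3^-1 * s2 q lam ^+ 3.

(* The integral over the hyperplane xi1 + xi2 + xi3 = eta1 + eta2 + eta3,
   parametrised by (xi1, xi2, eta1, eta2, eta3) in R^5. *)
Definition b6_fourier qhat lam : R[i] :=
  - (iC / (4 * pi ^+ 2)%:C) *
  cintegral (mu \x mu \x mu \x mu \x mu)%E setT (fun z : R * R * R * R * R =>
    let: (xi1, xi2, eta1, eta2, eta3) := z in
    let xi3 := eta1 + eta2 + eta3 - xi1 - xi2 in
    lam ^+ 6 /
      ((2 * lam ^+ 2 + xi1%:C) * (2 * lam ^+ 2 + xi2%:C) *
       (2 * lam ^+ 2 + eta2%:C) * (2 * lam ^+ 2 + eta3%:C)) *
    ((2 * lam ^+ 2 + eta1%:C)^-1 +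
     (2 * lam ^+ 2 + (xi1 + xi2 - eta1)%:C)^-1) *
    (qhat xi1 * qhat xi2 * qhat xi3 *
     conjc (qhat eta1) * conjc (qhat eta2) * conjc (qhat eta3))).

(* The prefactor must be (-i)^j and not i^j, which has the wrong sign for odd j:
   replacing q by e^{ikx} q replaces 2 lambda^2 by 2 lambda^2 + k in
   b_6 / lambda^6, so for q real and even the modulated function has
   b_6 = - i lambda^6 (2 lambda^2 + k)^-5 H_4 + O(lambda^-8), whence
   H_5 = - 5 k H_4; the prefactor i^j gives H_5 = + 5 k H_4. *)
Definition H6 q (j : nat) : R :=
  Re ((- iC) ^+ j *
    \sum_(a1 < j.+1) \sum_(a2 < j.+1) \sum_(a3 < j.+1) \sum_(a4 < j.+1)
    \sum_(a5 < j.+1 | (a1 + a2 + a3 + a4 + a5 + 4 == j)%N)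
      (-1) ^+ (a1 + a2) *
      cintegral mu setT (fun x =>
        cderiv a1 q x * cderiv a2 q x * q x *
          conjc (cderiv a3 q x * cderiv a4 q x * cderiv a5 q x) +
        cderiv a1 q x * cderiv a2 q x * conjc (q x) *
          cderiv a3 (fun t => q t * conjc (cderiv a4 q t * cderiv a5 q t)) x)).

End Lebesgue.

(* Poincare asymptotic series f ~ \sum_(j >= j0) c_j phi_j, as |lambda| -> oo
   within D: every partial sum is accurate up to o(its last gauge function). *)
Definition asymptotic_series (R : realType) (D : set R[i])
    (f : R[i] -> R[i]) (j0 : nat) (c : nat -> R[i])
    (phi : nat -> R[i] -> R[i]) : Prop :=
  forall N : nat, (j0 <= N)%N -> forall eps : R, 0 < eps ->
  exists M : R, forall lam : R[i], D lam -> M < cmod lam ->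
    cmod (f lam - \sum_(j0 <= j < N.+1) c j * phi j lam)
      <= eps * cmod (phi N lam).

(* Main.v *)
Require Import Defs.
From HB Require Import structures.
From mathcomp Require Import all_boot all_order all_algebra.
From mathcomp Require Import complex ring lra zify.
From mathcomp Require Import all_classical all_reals all_analysis.
From mathcomp Require Import measurable_realfun.
Set Implicit Arguments.
Unset Strict Implicit.
Unset Printing Implicit Defensive.
Import Order.TTheory GRing.Theory Num.Theory.
Import numFieldNormedType.Exports.
Import mathcomp.real_closed.complex.
Local Open Scope classical_set_scope.
Local Open Scope ring_scope.
Local Open Scope complex_scope.

(** Put a = 2 lambda^2, P_a f(t) = int_{x<t} e^{ia(t-x)} f(x) dx, and let Q_a be the
    mirror image of P_a; write P = P_a q* and Q = Q_a q. The product rule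
    P_a f P_b g = P_{a+b}(f P_b g + g P_a f) and its mirror image collapse
    s_6 - s_2 s_4 + s_2^3/3, which yields b_6 = - lambda^6 (A + B) with
    A = int q P^3 Q^2 and B = int q* Q^2 P_a[q P^2].

    In L^2, P_a is a Fourier multiplier: sqrt(2 pi) P_a f(y) is i times the integral
    of f^(-eta) e^{-i eta y} / (a + eta), so that int g P_a f is i times the
    integral of f^(-eta) g^(eta) / (a + eta). The latter formula, applied to
    modulations of q and q*, computes the eta_1-integral in the claimed formula as an
    integral over y; the remaining four integrations then give A + B.

    For a Schwartz function q and k = i/a, integration by parts expands P_a f in
    k sum_m (- k)^m f^(m) and Q_a f in k sum_m k^m f^(m), with remainders that are
    uniform in Im a > 0. Hence A + B = k^5 c(k) + O(k^M) for a polynomial c whose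
    coefficients are the sums in H_j. These are real after multiplication by (- i)^j
    because c(k) is real up to O(k^M) for imaginary k: integrating by parts shows that
    the contribution of B is real, and that of A differs from its conjugate by the
    integral of a total derivative up to O(k^M). *)

(** Two regimes call for different estimates. At fixed lambda, q is merely in L2; the kernel e^{iat}
    on t > 0 enters through its L1 and L2 norms, so P and Q are bounded and all multiple integrals
    converge absolutely, with constants that blow up as Im a tends to 0. In the asymptotic statement
    lambda may approach the boundary of the domain, so the estimates use only the bound of the
    kernel by 1 and norms of expressions in q. The product rule reflects that P_a f solves u' = i a
    u + f. It includes a = 0, where P_0 is a plain primitive, so that the partial integrals of s_2
    and s_4 can be moved across P_a. In the Fourier formula xi_1, xi_2, eta_2, eta_3 each carry a
    resolvent and give integrable weights. The transforms at eta_1 and xi_3 are paired in L2, in the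
    variable eta_1 and uniformly in the others, so this integration is innermost. The two summands
    of the bracket produce A and B respectively. H_j is a real part, whereas the expansion yields a
    complex number, so the coefficients must be exactly real; a defect O(k^M) suffices because a
    polynomial of that size has no terms below degree M. *)

(** * Modulus, real and imaginary parts, and the complex exponential *)

Section ComplexBasics.
Variable R : realType.
Implicit Types z w : R[i].

Lemma cmod_def z : cmod z = Num.sqrt (Re z ^+ 2 + Im z ^+ 2).
Proof. by case: z. Qed.

Lemma cmod_ge0 z : 0 <= cmod z. Proof. by rewrite cmod_def sqrtr_ge0. Qed.

Lemma sqr_cmod z : cmod z ^+ 2 = Re z ^+ 2 + Im z ^+ 2.
Proof. by rewrite cmod_def sqr_sqrtr// addr_ge0// sqr_ge0. Qed.

Lemma cmodM z w : cmod (z * w) = cmod z * cmod w.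
Proof. exact: ComplexField.Normc.normcM. Qed.

Lemma cmodD z w : cmod (z + w) <= cmod z + cmod w.
Proof. exact: le_normcD. Qed.

Lemma cmodN z : cmod (- z) = cmod z. Proof. exact: normcN. Qed.

Lemma cmodB z w : cmod (z - w) <= cmod z + cmod w.
Proof. by rewrite -(cmodN w) cmodD. Qed.

Lemma cmodBC z w : cmod (z - w) = cmod (w - z).
Proof. by rewrite -cmodN opprB. Qed.

Lemma cmod0 : cmod (0 : R[i]) = 0. Proof. exact: ComplexField.Normc.normc0. Qed.

Lemma cmod_eq0 z : (cmod z == 0) = (z == 0).
Proof.
apply/eqP/eqP => [|->]; last exact: cmod0.
exact: ComplexField.Normc.eq0_normc.
Qed.

Lemma cmod_gt0 z : (0 < cmod z) = (z != 0).
Proof. by rewrite lt_neqAle cmod_ge0 andbT eq_sym cmod_eq0. Qed.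

Lemma cmodV z : cmod z^-1 = (cmod z)^-1.
Proof. exact: ComplexField.Normc.normcV. Qed.

Lemma cmod_real (x : R) : cmod x%:C = `|x|.
Proof. by rewrite cmod_def/= expr0n addr0 sqrtr_sqr. Qed.

Lemma cmod1 : cmod (1 : R[i]) = 1.
Proof. by rewrite -[1]/(1%:C) cmod_real normr1. Qed.

Lemma cmodX z n : cmod (z ^+ n) = cmod z ^+ n.
Proof. by elim: n => [|n IH]; rewrite ?cmod1// !exprS cmodM IH. Qed.

Lemma cmod_conjc z : cmod (conjc z) = cmod z.
Proof. by case: z => x y; rewrite !cmod_def/= sqrrN. Qed.

Lemma cmod_nat n : cmod (n%:R : R[i]) = n%:R.
Proof. by rewrite -(rmorph_nat (real_complex R)) cmod_real normr_nat. Qed.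

Lemma cmod_iC : cmod (iC : R[i]) = 1.
Proof. by rewrite cmod_def /= expr0n add0r expr1n sqrtr1. Qed.

Lemma cmod_bool (b : bool) : cmod (b%:R : R[i]) = b%:R.
Proof. exact: cmod_nat. Qed.

Lemma Re_le_cmod z : `|Re z| <= cmod z.
Proof.
rewrite -(@ler_pXn2r _ 2)// ?nnegrE ?cmod_ge0//.
by rewrite sqr_cmod real_normK ?num_real// lerDl sqr_ge0.
Qed.

Lemma Im_le_cmod z : `|Im z| <= cmod z.
Proof.
rewrite -(@ler_pXn2r _ 2)// ?nnegrE ?cmod_ge0//.
by rewrite sqr_cmod real_normK ?num_real// lerDr sqr_ge0.
Qed.

Lemma cmod_le_ReIm z : cmod z <= `|Re z| + `|Im z|.
Proof.
rewrite -(@ler_pXn2r _ 2)// ?nnegrE ?cmod_ge0 ?addr_ge0//.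
rewrite sqr_cmod sqrrD !real_normK ?num_real//.
by rewrite -addrA lerD2l lerDr mulrn_wge0// mulr_ge0.
Qed.

Lemma cmod_sum (I : Type) (r : seq I) (P : pred I) (F : I -> R[i]) :
  cmod (\sum_(i <- r | P i) F i) <= \sum_(i <- r | P i) cmod (F i).
Proof.
elim/big_ind2: _ => [|x1 x2 y1 y2 h1 h2|//]; first by rewrite cmod0.
exact: le_trans (cmodD _ _) (lerD h1 h2).
Qed.

Lemma iC_def : (iC : R[i]) = 'i%C. Proof. by []. Qed.

Lemma iC2 : (iC : R[i]) * iC = -1.
Proof. by rewrite -expr2 iC_def sqr_i. Qed.

Lemma iC_neq0 : (iC : R[i]) != 0.
Proof. by rewrite -cmod_eq0 cmod_iC oner_eq0. Qed.

Lemma conj_iC : conjc (iC : R[i]) = - iC.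
Proof. by apply/eqP; rewrite eq_complex/= oppr0 !eqxx. Qed.

Lemma ReM z w : Re (z * w) = Re z * Re w - Im z * Im w.
Proof. by case: z w => [a b] [c d]. Qed.
Lemma ImM z w : Im (z * w) = Re z * Im w + Im z * Re w.
Proof. by case: z w => [a b] [c d]. Qed.
Lemma ReD z w : Re (z + w) = Re z + Re w. Proof. by case: z w => [a b] [c d]. Qed.
Lemma ImD z w : Im (z + w) = Im z + Im w. Proof. by case: z w => [a b] [c d]. Qed.
Lemma ReN z : Re (- z) = - Re z. Proof. by case: z. Qed.
Lemma ImN z : Im (- z) = - Im z. Proof. by case: z. Qed.
Lemma Re_conjc z : Re (conjc z) = Re z. Proof. by case: z. Qed.
Lemma Im_conjc z : Im (conjc z) = - Im z. Proof. by case: z. Qed.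
Lemma ReMi z : Re (iC * z) = - Im z.
Proof. by rewrite ReM/= mul0r mul1r sub0r. Qed.
Lemma ImMi z : Im (iC * z) = Re z.
Proof. by rewrite ImM/= mul0r mul1r add0r. Qed.
Lemma ReMr z (x : R) : Re (z * x%:C) = Re z * x.
Proof. by rewrite ReM/= mulr0 subr0. Qed.
Lemma ImMr z (x : R) : Im (z * x%:C) = Im z * x.
Proof. by rewrite ImM/= mulr0 add0r. Qed.
Lemma complex_eqP z w : Re z = Re w -> Im z = Im w -> z = w.
Proof. by case: z w => [a b] [c d]/= -> ->. Qed.

Lemma conjcM z w : conjc (z * w) = conjc z * conjc w. Proof. exact: rmorphM. Qed.
Lemma conjcD z w : conjc (z + w) = conjc z + conjc w. Proof. exact: rmorphD. Qed.
Lemma conjcN z : conjc (- z) = - conjc z. Proof. exact: rmorphN. Qed.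
Lemma conjcX z n : conjc (z ^+ n) = conjc z ^+ n. Proof. exact: rmorphXn. Qed.
Lemma cexpE z : cexp z = (expR (Re z) * cos (Im z)) +i* (expR (Re z) * sin (Im z)).
Proof.
rewrite /cexp; apply/eqP; rewrite eq_complex/= !mul0r subr0 addr0; exact/andP.
Qed.

Lemma Re_cexp z : Re (cexp z) = expR (Re z) * cos (Im z).
Proof. by rewrite cexpE. Qed.
Lemma Im_cexp z : Im (cexp z) = expR (Re z) * sin (Im z).
Proof. by rewrite cexpE. Qed.

Lemma cexpD z w : cexp (z + w) = cexp z * cexp w.
Proof.
apply: complex_eqP.
  by rewrite Re_cexp [RHS]ReM !Re_cexp !Im_cexp ReD ImD expRD cosD; ring.
by rewrite Im_cexp [RHS]ImM !Re_cexp !Im_cexp ReD ImD expRD sinD; ring.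
Qed.

Lemma cexp0 : cexp (0 : R[i]) = 1.
Proof.
by apply: complex_eqP; rewrite ?Re_cexp ?Im_cexp/= expR0 ?cos0 ?sin0 ?mulr1 ?mulr0.
Qed.

Lemma cmod_cexp z : cmod (cexp z) = expR (Re z).
Proof.
rewrite cmod_def Re_cexp Im_cexp !exprMn -mulrDr cos2Dsin2 mulr1.
by rewrite sqrtr_sqr ger0_norm// expR_ge0.
Qed.

Lemma cexp_neq0 z : cexp z != 0.
Proof. by rewrite -cmod_eq0 cmod_cexp gt_eqF// expR_gt0. Qed.

Lemma conj_cexp z : conjc (cexp z) = cexp (conjc z).
Proof.
apply: complex_eqP.
  by rewrite Re_conjc !Re_cexp Re_conjc Im_conjc cosN.
by rewrite Im_conjc !Im_cexp Re_conjc Im_conjc sinN mulrN.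
Qed.

End ComplexBasics.

(** * Measurability of complex-valued functions *)

Section Measurability.
Context d (T : measurableType d) (R : realType).
Implicit Types f g : T -> R[i].

Lemma cmeas_cst (c : R[i]) : cmeasurable (fun _ : T => c).
Proof. by split; exact: measurable_cst. Qed.

Lemma cmeasD f g : cmeasurable f -> cmeasurable g ->
  cmeasurable (fun x => f x + g x).
Proof.
move=> [f1 f2] [g1 g2]; split.
  by under eq_fun do rewrite ReD; exact: measurable_funD.
by under eq_fun do rewrite ImD; exact: measurable_funD.
Qed.

Lemma cmeasN f : cmeasurable f -> cmeasurable (fun x => - f x).
Proof.
move=> [f1 f2]; split.
  by under eq_fun do rewrite ReN; exact: measurableT_comp.
by under eq_fun do rewrite ImN; exact: measurableT_comp.
Qed.

Lemma cmeasB f g : cmeasurable f -> cmeasurable g ->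
  cmeasurable (fun x => f x - g x).
Proof. by move=> mf mg; apply: cmeasD => //; exact: cmeasN. Qed.

Lemma cmeasM f g : cmeasurable f -> cmeasurable g ->
  cmeasurable (fun x => f x * g x).
Proof.
move=> [f1 f2] [g1 g2]; split.
  by under eq_fun do rewrite ReM; apply: measurable_funB; exact: measurable_funM.
by under eq_fun do rewrite ImM; apply: measurable_funD; exact: measurable_funM.
Qed.

Lemma cmeasX f n : cmeasurable f -> cmeasurable (fun x => f x ^+ n).
Proof.
move=> mf; elim: n => [|n IH].
  by under eq_fun do rewrite expr0; exact: cmeas_cst.
by under eq_fun do rewrite exprS; exact: cmeasM.
Qed.

Lemma cmeas_conj f : cmeasurable f -> cmeasurable (fun x => conjc (f x)).
Proof.
move=> [f1 f2]; split.
  by under eq_fun do rewrite Re_conjc.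
by under eq_fun do rewrite Im_conjc; exact: measurableT_comp.
Qed.

Lemma cmeas_real (f : T -> R) : measurable_fun setT f ->
  cmeasurable (fun x => (f x)%:C).
Proof. by move=> mf; split => //=; exact: measurable_cst. Qed.

Lemma cmeas_bool (b : T -> bool) : measurable_fun setT b ->
  cmeasurable (fun x => (b x)%:R : R[i]).
Proof.
move=> mb; have -> : (fun x => (b x)%:R : R[i]) =
    (fun x => ((if b x then 1 else 0) : R)%:C).
  by apply/funext => x; case: (b x).
by apply: cmeas_real; apply: measurable_fun_ifT => //; exact: measurable_cst.
Qed.

Lemma cmeas_cexp f : cmeasurable f -> cmeasurable (fun x => cexp (f x)).
Proof.
move=> [f1 f2]; split.
  under eq_fun do rewrite Re_cexp; apply: measurable_funM.
    exact: measurableT_comp.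
  exact: (measurableT_comp (continuous_measurable_fun (@continuous_cos R)) f2).
under eq_fun do rewrite Im_cexp; apply: measurable_funM.
  exact: measurableT_comp.
exact: (measurableT_comp (continuous_measurable_fun (@continuous_sin R)) f2).
Qed.

Lemma measurable_cmod f : cmeasurable f ->
  measurable_fun setT (fun x => cmod (f x)).
Proof.
move=> [f1 f2].
have -> : (fun x => cmod (f x)) = (fun x => (Re (f x) ^+ 2 + Im (f x) ^+ 2) `^ 2^-1).
  apply/funext => x; rewrite cmod_def powR12_sqrt//.
  by rewrite addr_ge0// sqr_ge0.
apply: (measurableT_comp (measurable_powR _)).
by apply: measurable_funD; exact: measurable_funX.
Qed.

(** Inversion is not continuous at 0, so measurability is read off from z^-1 = conj z |z|^-2. The
    identity persists at 0, where both sides are 0 by convention. *)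
Lemma cmeas_inv f : cmeasurable f -> cmeasurable (fun x => (f x)^-1).
Proof.
move=> mf.
have -> : (fun x => (f x)^-1) =
    (fun x => conjc (f x) * ((cmod (f x) ^+ 2) `^ (-1))%:C).
  apply/funext => x; have [->|fx0] := eqVneq (f x) 0.
    by rewrite invr0 conjc0 mul0r.
  rewrite powR_inv1 ?sqr_ge0// fmorphV/= sqr_cmod.
  have -> : (Re (f x) ^+ 2 + Im (f x) ^+ 2)%:C = f x * conjc (f x).
    apply: complex_eqP; first by rewrite ReM Re_conjc Im_conjc/=; ring.
    by rewrite ImM Re_conjc Im_conjc/=; ring.
  by rewrite invfM mulrCA mulrV ?mulr1// unitfE conjc_eq0.
apply: cmeasM; first exact: cmeas_conj.
apply: cmeas_real; apply: (measurableT_comp (measurable_powR _)).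
apply: measurable_funX; exact: measurable_cmod.
Qed.

End Measurability.

Lemma cmeas_comp d d' (T : measurableType d) (T' : measurableType d')
    (R : realType) (f : T' -> R[i]) (h : T -> T') :
  cmeasurable f -> measurable_fun setT h -> cmeasurable (fun x => f (h x)).
Proof.
move=> [f1 f2] mh; split.
  exact: (measurableT_comp f1 mh).
exact: (measurableT_comp f2 mh).
Qed.

(** * Complex-valued integrals *)

Definition cL1 d (T : measurableType d) (R : realType)
    (mu : {measure set T -> \bar R}) (f : T -> R[i]) : Prop :=
  cmeasurable f /\ (\int[mu]_x (cmod (f x))%:E < +oo)%E.

(** Locked, like [Nint] below, so that unification compares integrands instead of unfolding an
    integral into its real and imaginary parts. *)
HB.lock Definition cint d (T : measurableType d) (R : realType)
    (mu : {measure set T -> \bar R}) (f : T -> R[i]) : R[i] :=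
  cintegral mu setT f.

HB.lock Definition Nint d (T : measurableType d) (R : realType)
    (mu : {measure set T -> \bar R}) (f : T -> R[i]) : R :=
  \int[mu]_x cmod (f x).

Section Integral.
Context d (T : measurableType d) (R : realType).
Variable mu : {measure set T -> \bar R}.
Implicit Types f g : T -> R[i].

Lemma cL1_measurable f : cL1 mu f -> cmeasurable f. Proof. by case. Qed.

Lemma cL1_normal f : cL1 mu f ->
  mu.-integrable setT (EFin \o (fun x => cmod (f x))).
Proof.
move=> [mf fi]; apply/integrableP; split.
  by apply/measurable_EFinP; exact: measurable_cmod.
under eq_integral do rewrite /= ger0_norm ?cmod_ge0//.
exact: fi.
Qed.

Lemma cL1_ler f (g : T -> R) : cmeasurable f ->
  mu.-integrable setT (EFin \o g) -> (forall x, cmod (f x) <= g x) -> cL1 mu f.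
Proof.
move=> mf gi fg; split => //.
have /integrableP[_ h] : mu.-integrable setT (EFin \o (fun x => cmod (f x))).
  apply: (le_integrable measurableT _ _ gi).
    by apply/measurable_EFinP; exact: measurable_cmod.
  move=> x _ /=; rewrite lee_fin ger0_norm ?cmod_ge0//.
  exact: le_trans (fg x) (ler_norm _).
by move: h; under eq_integral do rewrite /= ger0_norm ?cmod_ge0//.
Qed.

Lemma cL1_le f g : cmeasurable f -> cL1 mu g ->
  (forall x, cmod (f x) <= cmod (g x)) -> cL1 mu f.
Proof. by move=> mf /cL1_normal; exact: cL1_ler. Qed.

Lemma cL1_Re f : cL1 mu f -> mu.-integrable setT (EFin \o (fun x => Re (f x))).
Proof.
move=> fi; apply: (le_integrable measurableT _ _ (cL1_normal fi)).
  by apply/measurable_EFinP; case: fi => -[].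
by move=> x _ /=; rewrite lee_fin [leRHS]ger0_norm ?cmod_ge0// Re_le_cmod.
Qed.

Lemma cL1_Im f : cL1 mu f -> mu.-integrable setT (EFin \o (fun x => Im (f x))).
Proof.
move=> fi; apply: (le_integrable measurableT _ _ (cL1_normal fi)).
  by apply/measurable_EFinP; case: fi => -[].
by move=> x _ /=; rewrite lee_fin [leRHS]ger0_norm ?cmod_ge0// Im_le_cmod.
Qed.

Lemma cL1_ReIm f : mu.-integrable setT (EFin \o (fun x => Re (f x))) ->
  mu.-integrable setT (EFin \o (fun x => Im (f x))) -> cL1 mu f.
Proof.
move=> h1 h2.
have m : cmeasurable f.
  by split; [case/integrableP : h1|case/integrableP : h2] => /measurable_EFinP.
have h := integrableD measurableT (integrable_norm h1) (integrable_norm h2).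
apply: (cL1_ler m (g := fun x => `|Re (f x)| + `|Im (f x)|)) => [|x].
  by apply: eq_integrable h.
exact: cmod_le_ReIm.
Qed.

Lemma cL1_cst0 : cL1 mu (fun _ => 0).
Proof.
split; first exact: cmeas_cst.
by under eq_integral do rewrite cmod0; rewrite integral0.
Qed.

Lemma cL1D f g : cL1 mu f -> cL1 mu g -> cL1 mu (fun x => f x + g x).
Proof.
move=> fi gi.
have h := integrableD measurableT (cL1_normal fi) (cL1_normal gi).
apply: (@cL1_ler _ (fun x => cmod (f x) + cmod (g x))).
- by apply: cmeasD; [case: fi|case: gi].
- by apply: eq_integrable h.
- by move=> x; exact: cmodD.
Qed.

Lemma cL1Z c f : cL1 mu f -> cL1 mu (fun x => c * f x).
Proof.
move=> fi.
have h := integrableZl measurableT (cmod c) (cL1_normal fi).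
apply: (@cL1_ler _ (fun x => cmod c * cmod (f x))).
- by apply: cmeasM; [exact: cmeas_cst|case: fi].
- by apply: eq_integrable h.
- by move=> x; rewrite cmodM.
Qed.

Lemma cL1Zr c f : cL1 mu f -> cL1 mu (fun x => f x * c).
Proof. by move=> /(cL1Z c); congr cL1; apply/funext => x; rewrite mulrC. Qed.

Lemma cL1N f : cL1 mu f -> cL1 mu (fun x => - f x).
Proof. by move=> /(cL1Z (-1)); congr cL1; apply/funext => x; rewrite mulN1r. Qed.

Lemma cL1B f g : cL1 mu f -> cL1 mu g -> cL1 mu (fun x => f x - g x).
Proof. by move=> fi gi; apply: cL1D => //; exact: cL1N. Qed.

Lemma cL1_conj f : cL1 mu f -> cL1 mu (fun x => conjc (f x)).
Proof.
move=> fi; apply: (cL1_le _ fi); first by apply: cmeas_conj; case: fi.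
by move=> x; rewrite cmod_conjc.
Qed.

Lemma cL1_cmod f : cL1 mu f -> cL1 mu (fun x => (cmod (f x))%:C).
Proof.
move=> fi; apply: (cL1_le _ fi).
  by apply: cmeas_real; apply: measurable_cmod; case: fi.
by move=> x; rewrite cmod_real ger0_norm ?cmod_ge0.
Qed.

Lemma cL1_sum (I : Type) (r : seq I) (P : pred I) (F : I -> T -> R[i]) :
  (forall i, P i -> cL1 mu (F i)) ->
  cL1 mu (fun x => \sum_(i <- r | P i) F i x).
Proof.
move=> mF; elim: r => [|i r IH].
  by under eq_fun do rewrite big_nil; exact: cL1_cst0.
under eq_fun do rewrite big_cons.
by case: (boolP (P i)) => // Pi; apply: cL1D => //; exact: mF.
Qed.

Lemma cL1Mbd f g (C : R) : cL1 mu f -> cmeasurable g ->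
  (forall x, cmod (g x) <= C) -> cL1 mu (fun x => f x * g x).
Proof.
move=> fi mg gC; apply: (cL1_le _ (cL1Z C%:C fi)).
  by apply: cmeasM => //; case: fi.
move=> x; rewrite !cmodM mulrC ler_wpM2r ?cmod_ge0// cmod_real.
exact: le_trans (gC x) (ler_norm _).
Qed.

Lemma cL1bdM f g (C : R) : cL1 mu f -> cmeasurable g ->
  (forall x, cmod (g x) <= C) -> cL1 mu (fun x => g x * f x).
Proof.
move=> fi mg gC; have := cL1Mbd fi mg gC.
by congr cL1; apply/funext => x; rewrite mulrC.
Qed.

Lemma cL1_bool f (b : T -> bool) : cL1 mu f -> measurable_fun setT b ->
  cL1 mu (fun x => (b x)%:R * f x).
Proof.
move=> fi mb; apply: (@cL1bdM _ _ 1) => //; first exact: cmeas_bool.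
by move=> x; rewrite cmod_bool; case: (b x).
Qed.

Lemma cint_ext f g : (forall x, f x = g x) -> cint mu f = cint mu g.
Proof. by move=> /funext ->. Qed.

Lemma cL1_ext f g : (forall x, f x = g x) -> cL1 mu f -> cL1 mu g.
Proof. by move=> /funext ->. Qed.

Lemma cintE f : cint mu f = cintegral mu setT f. Proof. by rewrite cint.unlock. Qed.
Lemma NintE f : Nint mu f = \int[mu]_x cmod (f x). Proof. by rewrite Nint.unlock. Qed.
Lemma Re_cint f : Re (cint mu f) = \int[mu]_x Re (f x). Proof. by rewrite cintE. Qed.
Lemma Im_cint f : Im (cint mu f) = \int[mu]_x Im (f x). Proof. by rewrite cintE. Qed.

Lemma cint0 : cint mu (fun _ => 0) = 0.
Proof. by apply: complex_eqP; rewrite ?Re_cint ?Im_cint /Rintegral integral0. Qed.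

Lemma cintD f g : cL1 mu f -> cL1 mu g ->
  cint mu (fun x => f x + g x) = cint mu f + cint mu g.
Proof.
move=> fi gi; apply: complex_eqP.
  rewrite ReD !Re_cint -RintegralD ?cL1_Re//; [|exact: cL1_Re..].
  by congr (Rintegral mu _ _); apply/funext => x; rewrite ReD.
rewrite ImD !Im_cint -RintegralD ?cL1_Im//; [|exact: cL1_Im..].
by congr (Rintegral mu _ _); apply/funext => x; rewrite ImD.
Qed.

Lemma cintZ c f : cL1 mu f -> cint mu (fun x => c * f x) = c * cint mu f.
Proof.
move=> fi; have h1 := cL1_Re fi; have h2 := cL1_Im fi.
have z1 r := @eq_integrable _ _ _ mu setT measurableT _
   (EFin \o (fun x => r * Re (f x))) (fun x _ => erefl) (integrableZl measurableT r h1).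
have z2 r := @eq_integrable _ _ _ mu setT measurableT _
   (EFin \o (fun x => r * Im (f x))) (fun x _ => erefl) (integrableZl measurableT r h2).
apply: complex_eqP.
  rewrite ReM !Re_cint Im_cint -!RintegralZl// -RintegralB//.
  by congr (Rintegral mu _ _); apply/funext => x; rewrite ReM.
rewrite ImM Re_cint !Im_cint -!RintegralZl// -RintegralD//.
by congr (Rintegral mu _ _); apply/funext => x; rewrite ImM.
Qed.

Lemma cintZr c f : cL1 mu f -> cint mu (fun x => f x * c) = cint mu f * c.
Proof.
move=> fi; rewrite mulrC -cintZ//.
by apply: cint_ext => x; rewrite mulrC.
Qed.

Lemma cintN f : cL1 mu f -> cint mu (fun x => - f x) = - cint mu f.
Proof.
move=> fi; rewrite -mulN1r -cintZ//.
by apply: cint_ext => x; rewrite mulN1r.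
Qed.

Lemma cintB f g : cL1 mu f -> cL1 mu g ->
  cint mu (fun x => f x - g x) = cint mu f - cint mu g.
Proof. by move=> fi gi; rewrite cintD ?cintN//; exact: cL1N. Qed.

Lemma cint_conj f : cL1 mu f ->
  cint mu (fun x => conjc (f x)) = conjc (cint mu f).
Proof.
move=> fi; apply: complex_eqP.
  rewrite Re_conjc !Re_cint.
  by congr (Rintegral mu _ _); apply/funext => x; rewrite Re_conjc.
rewrite Im_conjc !Im_cint -mulN1r -RintegralZl//; last exact: cL1_Im.
by congr (Rintegral mu _ _); apply/funext => x; rewrite Im_conjc mulN1r.
Qed.

Lemma cint_sum (I : Type) (r : seq I) (P : pred I) (F : I -> T -> R[i]) :
  (forall i, P i -> cL1 mu (F i)) ->
  cint mu (fun x => \sum_(i <- r | P i) F i x) = \sum_(i <- r | P i) cint mu (F i).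
Proof.
move=> mF; elim: r => [|i r IH].
  by rewrite big_nil; under eq_fun do rewrite big_nil; exact: cint0.
rewrite big_cons; under eq_fun do rewrite big_cons.
case: (boolP (P i)) => // Pi; rewrite cintD ?IH//; first exact: mF.
exact: cL1_sum.
Qed.

Lemma Nint_ge0 f : 0 <= Nint mu f.
Proof. by rewrite NintE; apply: Rintegral_ge0 => x _; exact: cmod_ge0. Qed.

Lemma Nint_cint f : cL1 mu f -> (Nint mu f)%:C = cint mu (fun x => (cmod (f x))%:C).
Proof.
move=> fi; apply: complex_eqP; first by rewrite Re_cint NintE.
rewrite Im_cint /= /Rintegral.
by under eq_integral do rewrite /=; rewrite integral0.
Qed.

Lemma le_Nint f g : cL1 mu f -> cL1 mu g ->
  (forall x, cmod (f x) <= cmod (g x)) -> Nint mu f <= Nint mu g.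
Proof.
move=> fi gi fg; rewrite !NintE; apply: le_Rintegral => //; exact: cL1_normal.
Qed.

Lemma NintZ c f : cL1 mu f -> Nint mu (fun x => c * f x) = cmod c * Nint mu f.
Proof.
move=> fi; rewrite !NintE -RintegralZl//; last exact: cL1_normal.
by apply: eq_Rintegral => x _; rewrite cmodM.
Qed.

Lemma NintD f g : cL1 mu f -> cL1 mu g ->
  Nint mu (fun x => f x + g x) <= Nint mu f + Nint mu g.
Proof.
move=> fi gi; rewrite !NintE -RintegralD//; [|exact: cL1_normal..].
apply: le_Rintegral => //; last by move=> x _; exact: cmodD.
  exact: cL1_normal (cL1D fi gi).
exact: eq_integrable (integrableD measurableT (cL1_normal fi) (cL1_normal gi)).
Qed.

(** Rotation: with I the integral, |I|^2 is the real part of the integral of conj I times f, which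
    is at most |I| times the integral of |f|; then divide by |I|. *)
Lemma cmod_cint f : cL1 mu f -> cmod (cint mu f) <= Nint mu f.
Proof.
move=> fi; have [->|I0] := eqVneq (cint mu f) 0; first by rewrite cmod0 Nint_ge0.
have Igt0 : 0 < cmod (cint mu f) by rewrite cmod_gt0.
have fci := cL1Z (conjc (cint mu f)) fi.
have : cmod (cint mu f) ^+ 2 <= cmod (cint mu f) * Nint mu f.
  have -> : cmod (cint mu f) ^+ 2 = Re (conjc (cint mu f) * cint mu f).
    by rewrite ReM Re_conjc Im_conjc sqr_cmod; ring.
  rewrite -cintZ// Re_cint -[leRHS](congr1 (fun x => x * Nint mu f) (cmod_conjc _)).
  rewrite -NintZ// NintE; apply: le_Rintegral => //; [exact: cL1_Re|exact: cL1_normal|].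
  by move=> x _; exact: le_trans (ler_norm _) (Re_le_cmod _).
by rewrite expr2 ler_pM2l.
Qed.

Lemma cmod_cint_le f (C : R) : cL1 mu f -> Nint mu f <= C -> cmod (cint mu f) <= C.
Proof. by move=> /cmod_cint; exact: le_trans. Qed.

Lemma cintegral_mkcond D f :
  cintegral mu D f = cint mu (fun x => (x \in D)%:R * f x).
Proof.
rewrite cintE; apply: complex_eqP; rewrite /= Rintegral_mkcond.
  congr (Rintegral mu _ _); apply/funext => x; rewrite /patch.
  by case: (x \in D); rewrite ?mul1r ?mul0r.
congr (Rintegral mu _ _); apply/funext => x; rewrite /patch.
by case: (x \in D); rewrite ?mul1r ?mul0r.
Qed.

End Integral.

(** * Sequential limits of complex numbers and dominated convergence *)

Definition ctends (R : realType) (u : nat -> R[i]) (l : R[i]) : Prop :=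
  (fun n => cmod (u n - l)) @ \oo --> (0 : R).

Section Ctends.
Variable R : realType.
Implicit Types (u v : nat -> R[i]) (l m c : R[i]).

Lemma ctends0P (u : nat -> R) : (forall n, 0 <= u n) ->
  u @ \oo --> (0 : R) <-> forall e, 0 < e -> \forall n \near \oo, u n <= e.
Proof.
move=> u0; split=> [/cvgrPdist_le h e e0|h].
  by apply: filterS (h e e0) => n; rewrite sub0r normrN ger0_norm.
apply/cvgrPdist_le => e e0.
by apply: filterS (h e e0) => n; rewrite sub0r normrN ger0_norm.
Qed.

Lemma le_cvg0 (u v : nat -> R) : (forall n, 0 <= u n <= v n) ->
  v @ \oo --> (0 : R) -> u @ \oo --> (0 : R).
Proof.
move=> uv /ctends0P h; apply/ctends0P => [n|e e0]; first by case/andP: (uv n).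
have v0 n : 0 <= v n by case/andP: (uv n); exact: le_trans.
by apply: filterS (h v0 e e0) => n; apply: le_trans; case/andP: (uv n).
Qed.

Lemma ctends_le (u : nat -> R[i]) l (v : nat -> R) : (forall n, cmod (u n - l) <= v n) ->
  v @ \oo --> (0 : R) -> ctends u l.
Proof.
move=> uv v0; apply: (le_cvg0 _ v0) => n; by rewrite cmod_ge0 uv.
Qed.

Lemma ctends_cst l : ctends (fun _ => l) l.
Proof. by rewrite /ctends; under eq_fun do rewrite subrr cmod0; exact: cvg_cst. Qed.

Lemma cvg_real0_eq (u : nat -> R) (l : R) : (fun n => `|u n - l|) @ \oo --> (0 : R) ->
  u @ \oo --> l.
Proof.
move=> /cvgrPdist_le h; apply/cvgrPdist_le => e e0.
by apply: filterS (h e e0) => n; rewrite sub0r normrN normr_id distrC.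
Qed.

Lemma ctends_Re u l : ctends u l -> (fun n => Re (u n)) @ \oo --> Re l.
Proof.
move=> ul; apply: cvg_real0_eq.
apply: (le_cvg0 _ ul) => n.
by rewrite normr_ge0 -ReN -ReD Re_le_cmod.
Qed.

Lemma ctends_Im u l : ctends u l -> (fun n => Im (u n)) @ \oo --> Im l.
Proof.
move=> ul; apply: cvg_real0_eq.
apply: (le_cvg0 _ ul) => n.
by rewrite normr_ge0 -ImN -ImD Im_le_cmod.
Qed.

Lemma ctends_ReIm u l : (fun n => Re (u n)) @ \oo --> Re l ->
  (fun n => Im (u n)) @ \oo --> Im l -> ctends u l.
Proof.
move=> h1 h2; apply: (ctends_le (v := fun n => `|Re (u n) - Re l| + `|Im (u n) - Im l|)).
  by move=> n; rewrite -!(ReN, ImN) -ReD -ImD cmod_le_ReIm.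
rewrite -[X in _ --> X](addr0 (0 : R)); apply: cvgD.
  rewrite -[X in _ --> X](@normr0 _ R); apply: cvg_norm.
  by rewrite -(subrr (Re l)); apply: cvgB => //; exact: cvg_cst.
rewrite -[X in _ --> X](@normr0 _ R); apply: cvg_norm.
by rewrite -(subrr (Im l)); apply: cvgB => //; exact: cvg_cst.
Qed.

Lemma ctends_unique u l m : ctends u l -> ctends u m -> l = m.
Proof.
move=> ul um; apply: complex_eqP.
  exact: (cvg_unique _ (ctends_Re ul) (ctends_Re um)).
exact: (cvg_unique _ (ctends_Im ul) (ctends_Im um)).
Qed.

Lemma ctendsD u v l m : ctends u l -> ctends v m ->
  ctends (fun n => u n + v n) (l + m).
Proof.
move=> ul vm; apply: ctends_ReIm.
  rewrite ReD; under eq_fun do rewrite ReD.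
  by apply: cvgD; exact: ctends_Re.
rewrite ImD; under eq_fun do rewrite ImD.
by apply: cvgD; exact: ctends_Im.
Qed.

Lemma ctendsM u v l m : ctends u l -> ctends v m ->
  ctends (fun n => u n * v n) (l * m).
Proof.
move=> ul vm; apply: ctends_ReIm.
  rewrite ReM; under eq_fun do rewrite ReM.
  by apply: cvgB; apply: cvgM; by [exact: ctends_Re|exact: ctends_Im].
rewrite ImM; under eq_fun do rewrite ImM.
by apply: cvgD; apply: cvgM; by [exact: ctends_Re|exact: ctends_Im].
Qed.

Lemma ctendsZ c u l : ctends u l -> ctends (fun n => c * u n) (c * l).
Proof. by move=> ul; apply: ctendsM => //; exact: ctends_cst. Qed.

Lemma ctends_eq u v l : (forall n, u n = v n) -> ctends u l -> ctends v l.
Proof. by move=> /funext ->. Qed.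

End Ctends.

Section DominatedConvergence.
Context d (T : measurableType d) (R : realType).
Variable mu : {measure set T -> \bar R}.

Lemma real_DCT (f_ : nat -> T -> R) (f g : T -> R) :
  (forall n, measurable_fun setT (f_ n)) -> measurable_fun setT f ->
  {ae mu, forall x, (fun n => f_ n x) @ \oo --> f x} ->
  mu.-integrable setT (EFin \o g) -> (forall n x, `|f_ n x| <= g x) ->
  mu.-integrable setT (EFin \o f) /\
  (fun n => \int[mu]_x f_ n x) @ \oo --> \int[mu]_x f x.
Proof.
move=> mf_ mf fl gi fg.
have [||||| h1 _ h3] := @dominated_convergence _ _ _ mu setT measurableT
  (fun n => EFin \o f_ n) (EFin \o f) (EFin \o g).
- by move=> n; exact/measurable_EFinP.
- exact/measurable_EFinP.
- move: fl; apply: filterS => x h _.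
  by apply: cvg_EFin; [exact: nearW|exact: h].
- exact: gi.
- by apply/aeW => x n _ /=; rewrite lee_fin.
split=> //; apply: fine_cvg; rewrite fineK//; exact: integrable_fin_num.
Qed.

Lemma cDCT (f_ : nat -> T -> R[i]) (f : T -> R[i]) (g : T -> R) :
  (forall n, cmeasurable (f_ n)) -> cmeasurable f ->
  {ae mu, forall x, ctends (fun n => f_ n x) (f x)} ->
  mu.-integrable setT (EFin \o g) ->
  (forall n x, cmod (f_ n x) <= g x) ->
  cL1 mu f /\ ctends (fun n => cint mu (f_ n)) (cint mu f).
Proof.
move=> mf_ mf fl gi fg.
have [|||||re1 re2] := @real_DCT (fun n x => Re (f_ n x)) (fun x => Re (f x)) g.
- by move=> n; case: (mf_ n).
- by case: mf.
- by move: fl; apply: filterS => x /ctends_Re.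
- exact: gi.
- by move=> n x; exact: le_trans (Re_le_cmod _) (fg _ _).
have [|||||im1 im2] := @real_DCT (fun n x => Im (f_ n x)) (fun x => Im (f x)) g.
- by move=> n; case: (mf_ n).
- by case: mf.
- by move: fl; apply: filterS => x /ctends_Im.
- exact: gi.
- by move=> n x; exact: le_trans (Im_le_cmod _) (fg _ _).
split; first exact: cL1_ReIm.
by apply: ctends_ReIm; rewrite ?Re_cint ?Im_cint; under eq_fun do rewrite ?Re_cint ?Im_cint.
Qed.

Lemma cDCT_everywhere (f_ : nat -> T -> R[i]) (f : T -> R[i]) (g : T -> R) :
  (forall n, cmeasurable (f_ n)) -> cmeasurable f ->
  (forall x, ctends (fun n => f_ n x) (f x)) ->
  mu.-integrable setT (EFin \o g) ->
  (forall n x, cmod (f_ n x) <= g x) ->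
  cL1 mu f /\ ctends (fun n => cint mu (f_ n)) (cint mu f).
Proof. by move=> m1 m2 h i b; exact: (cDCT m1 m2 (aeW mu h) i b). Qed.

Lemma cint_ae_eq (f g : T -> R[i]) : cmeasurable f -> cmeasurable g ->
  {ae mu, forall x, f x = g x} -> cint mu f = cint mu g.
Proof.
move=> [f1 f2] [g1 g2] fg; rewrite !cintE; apply: complex_eqP; rewrite /= /Rintegral; congr fine.
  apply: ae_eq_integral => //; [exact/measurable_EFinP..|].
  by move: fg; apply: filterS => x /= -> _.
apply: ae_eq_integral => //; [exact/measurable_EFinP..|].
by move: fg; apply: filterS => x /= -> _.
Qed.

End DominatedConvergence.

(* A transparent copy of the product measure: in the library the canonical
   sigma-finite structure on [\x] is shadowed by the one for subprobabilities. *)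
Definition pmeas d1 d2 (T1 : measurableType d1) (T2 : measurableType d2)
    (R : realType) (m1 : {sigma_finite_measure set T1 -> \bar R})
    (m2 : {sigma_finite_measure set T2 -> \bar R}) :
  set (T1 * T2) -> \bar R := (m1 \x m2)%E.

(** * Fubini and Tonelli theorems for complex-valued functions *)

Section ProductMeasure.
Context d1 d2 (T1 : measurableType d1) (T2 : measurableType d2) (R : realType).
Variable m1 : {sigma_finite_measure set T1 -> \bar R}.
Variable m2 : {sigma_finite_measure set T2 -> \bar R}.

HB.instance Definition _ := Measure.on (pmeas m1 m2).

Lemma pmeas_sigma_finite : sigma_finite setT (pmeas m1 m2).
Proof.
have [F Ftop Fn] := sigma_finiteT m1; have [G Gtop Gn] := sigma_finiteT m2.
(* Codes that decode to no pair are sent to (0, 0), which merely repeats a rectangle. *)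
pose e (n : nat) := odflt (0%N, 0%N) (unpickle n : option (nat * nat)).
exists (fun n => F (e n).1 `*` G (e n).2).
  apply/seteqP; split => // -[x y] _.
  have : (\bigcup_i F i) x by rewrite -Ftop.
  have : (\bigcup_i G i) y by rewrite -Gtop.
  move=> [j _ Gy] [i _ Fx]; exists (pickle (i, j)) => //.
  by rewrite /e pickleK.
move=> n; have [mF Fy] := Fn (e n).1; have [mG Gy] := Gn (e n).2.
split; first exact: measurableX.
by rewrite /pmeas product_measure1E// lte_mul_pinfty// ge0_fin_numE.
Qed.

HB.instance Definition _ := Measure_isSigmaFinite.Build _ _ _
  (pmeas m1 m2) pmeas_sigma_finite.

Lemma cmeas_sec2 (F : T1 * T2 -> R[i]) y : cmeasurable F ->
  cmeasurable (fun x => F (x, y)).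
Proof. by move=> mF; apply: (cmeas_comp mF); exact: pair2_measurable. Qed.

Lemma cmeas_sec1 (F : T1 * T2 -> R[i]) x : cmeasurable F ->
  cmeasurable (fun y => F (x, y)).
Proof. by move=> mF; apply: (cmeas_comp mF); exact: pair1_measurable. Qed.

Lemma measurable_Rintegral2 (F : T1 * T2 -> R) : measurable_fun setT F ->
  measurable_fun setT (fun y => \int[m1]_x F (x, y)).
Proof.
move=> mF; apply: (measurableT_comp (fine_measurable measurableT)).
have mF' : measurable_fun setT (EFin \o F) by exact/measurable_EFinP.
have -> : (fun y => \int[m1]_x (F (x, y))%:E)%E =
    ((fun y => \int[m1]_x ((EFin \o F)^\+ (x, y))) \-
     (fun y => \int[m1]_x ((EFin \o F)^\- (x, y))))%E.
  apply/funext => y; rewrite [LHS]integralE.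
  by congr (_ - _)%E; apply: eq_integral => x _; rewrite ?funeposE ?funenegE.
apply: emeasurable_funB.
  by apply: measurable_fun_fubini_tonelli_G => //; exact: measurable_funepos.
by apply: measurable_fun_fubini_tonelli_G => //; exact: measurable_funeneg.
Qed.

(** The section integrals may be infinite or undefined for some y. Splitting F into positive and
    negative parts makes both section integrals measurable by Tonelli, and [fine] preserves
    measurability. *)
Lemma measurable_Rintegral1 (F : T1 * T2 -> R) : measurable_fun setT F ->
  measurable_fun setT (fun x => \int[m2]_y F (x, y)).
Proof.
move=> mF; apply: (measurableT_comp (fine_measurable measurableT)).
have mF' : measurable_fun setT (EFin \o F) by exact/measurable_EFinP.
have -> : (fun x => \int[m2]_y (F (x, y))%:E)%E =
    ((fun x => \int[m2]_y ((EFin \o F)^\+ (x, y))) \-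
     (fun x => \int[m2]_y ((EFin \o F)^\- (x, y))))%E.
  apply/funext => x; rewrite [LHS]integralE.
  by congr (_ - _)%E; apply: eq_integral => y _; rewrite ?funeposE ?funenegE.
apply: emeasurable_funB.
  by apply: measurable_fun_fubini_tonelli_F => //; exact: measurable_funepos.
by apply: measurable_fun_fubini_tonelli_F => //; exact: measurable_funeneg.
Qed.

Lemma cmeas_cint2 (F : T1 * T2 -> R[i]) : cmeasurable F ->
  cmeasurable (fun y => cint m1 (fun x => F (x, y))).
Proof.
move=> [F1 F2]; split; under eq_fun do rewrite ?Re_cint ?Im_cint.
  exact: measurable_Rintegral2 F1.
exact: measurable_Rintegral2 F2.
Qed.

Lemma cmeas_cint1 (F : T1 * T2 -> R[i]) : cmeasurable F ->
  cmeasurable (fun x => cint m2 (fun y => F (x, y))).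
Proof.
move=> [F1 F2]; split; under eq_fun do rewrite ?Re_cint ?Im_cint.
  exact: measurable_Rintegral1 F1.
exact: measurable_Rintegral1 F2.
Qed.

Lemma Rintegral_fubini1 (F : T1 * T2 -> R) :
  (pmeas m1 m2).-integrable setT (EFin \o F) ->
  m1.-integrable setT (EFin \o (fun x => \int[m2]_y F (x, y))) /\
  \int[pmeas m1 m2]_z F z = \int[m1]_x \int[m2]_y F (x, y).
Proof.
move=> Fi; have h1 := integrable_fubini_F Fi; have h2 := integral12_prod_meas1 Fi.
have mR : measurable_fun setT (fun x => \int[m2]_y F (x, y)).
  by apply: measurable_Rintegral1; case/integrableP : Fi => /measurable_EFinP.
have ae : ae_eq m1 setT (fubini_F m2 (EFin \o F))
    (EFin \o (fun x => \int[m2]_y F (x, y))).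
  have := integrable_ae measurableT h1; apply: filterS => x /(_ I) fi _.
  by rewrite /= fineK.
split.
  apply/integrableP; split; first exact/measurable_EFinP.
  have /integrableP[_] := h1; congr (_ < _)%E; apply: ae_eq_integral => //.
  - by apply: measurableT_comp => //; case/integrableP : h1.
  - by apply: measurableT_comp => //; exact/measurable_EFinP.
  - by move: ae; apply: filterS => x h xT; rewrite /= h.
rewrite /Rintegral; congr fine; rewrite -[LHS]h2; apply: ae_eq_integral => //.
  by case/integrableP : h1.
exact/measurable_EFinP.
Qed.

Lemma Rintegral_fubini2 (F : T1 * T2 -> R) :
  (pmeas m1 m2).-integrable setT (EFin \o F) ->
  m2.-integrable setT (EFin \o (fun y => \int[m1]_x F (x, y))) /\
  \int[pmeas m1 m2]_z F z = \int[m2]_y \int[m1]_x F (x, y).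
Proof.
move=> Fi; have h2 := integral21_prod_meas1 Fi.
have mF : measurable_fun setT (EFin \o F) by case/integrableP : Fi.
have h1 : m2.-integrable setT (fubini_G m1 (EFin \o F)).
  apply/integrableP; split; first exact: measurable_fubini_G Fi.
  apply: le_lt_trans ((integrable21ltyP _ _ mF).1 Fi).
  apply: ge0_le_integral => //.
  - by apply: measurableT_comp => //; exact: measurable_fubini_G Fi.
  - apply: (measurable_fun_fubini_tonelli_G (abse \o (EFin \o F))) => //=.
    exact: measurableT_comp.
  - move=> y _; apply: le_abse_integral => //.
    by apply: (measurableT_comp mF); exact: pair2_measurable.
have mR : measurable_fun setT (fun y => \int[m1]_x F (x, y)).
  by apply: measurable_Rintegral2; case/integrableP : Fi => /measurable_EFinP.
have ae : ae_eq m2 setT (fubini_G m1 (EFin \o F))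
    (EFin \o (fun y => \int[m1]_x F (x, y))).
  have := integrable_ae measurableT h1; apply: filterS => x /(_ I) fi _.
  by rewrite /= fineK.
split.
  apply/integrableP; split; first exact/measurable_EFinP.
  have /integrableP[_] := h1; congr (_ < _)%E; apply: ae_eq_integral => //.
  - by apply: measurableT_comp => //; case/integrableP : h1.
  - by apply: measurableT_comp => //; exact/measurable_EFinP.
  - by move: ae; apply: filterS => x h xT; rewrite /= h.
rewrite /Rintegral; congr fine; rewrite -[LHS]h2; apply: ae_eq_integral => //.
  by case/integrableP : h1.
exact/measurable_EFinP.
Qed.

Lemma fubini1 (F : T1 * T2 -> R[i]) : cL1 (pmeas m1 m2) F ->
  cL1 m1 (fun x => cint m2 (fun y => F (x, y))) /\
  cint (pmeas m1 m2) F = cint m1 (fun x => cint m2 (fun y => F (x, y))).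
Proof.
move=> Fi; have [h1 e1] := Rintegral_fubini1 (cL1_Re Fi).
have [h2 e2] := Rintegral_fubini1 (cL1_Im Fi).
split.
  by apply: cL1_ReIm; under eq_fun do rewrite ?Re_cint ?Im_cint.
apply: complex_eqP.
  by rewrite !Re_cint e1; congr (Rintegral _ _ _); apply/funext => x; rewrite Re_cint.
by rewrite !Im_cint e2; congr (Rintegral _ _ _); apply/funext => x; rewrite Im_cint.
Qed.

Lemma fubini2 (F : T1 * T2 -> R[i]) : cL1 (pmeas m1 m2) F ->
  cL1 m2 (fun y => cint m1 (fun x => F (x, y))) /\
  cint (pmeas m1 m2) F = cint m2 (fun y => cint m1 (fun x => F (x, y))).
Proof.
move=> Fi; have [h1 e1] := Rintegral_fubini2 (cL1_Re Fi).
have [h2 e2] := Rintegral_fubini2 (cL1_Im Fi).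
split.
  by apply: cL1_ReIm; under eq_fun do rewrite ?Re_cint ?Im_cint.
apply: complex_eqP.
  by rewrite !Re_cint e1; congr (Rintegral _ _ _); apply/funext => x; rewrite Re_cint.
by rewrite !Im_cint e2; congr (Rintegral _ _ _); apply/funext => x; rewrite Im_cint.
Qed.

Lemma cint_swap (F : T1 * T2 -> R[i]) : cL1 (pmeas m1 m2) F ->
  cint m1 (fun x => cint m2 (fun y => F (x, y))) =
  cint m2 (fun y => cint m1 (fun x => F (x, y))).
Proof. by move=> Fi; rewrite -(fubini1 Fi).2 (fubini2 Fi).2. Qed.

(** Integrability of every section makes the real number [Nint] agree with the extended-real section
    integral; a section of infinite norm would otherwise count as 0 and the majorant g would say
    nothing. *)
Lemma tonelli2 (F : T1 * T2 -> R[i]) (g : T2 -> R) : cmeasurable F ->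
  (forall y, cL1 m1 (fun x => F (x, y))) ->
  m2.-integrable setT (EFin \o g) ->
  (forall y, Nint m1 (fun x => F (x, y)) <= g y) -> cL1 (pmeas m1 m2) F.
Proof.
move=> mF Fy gi Fg; split => //.
have mn : measurable_fun setT (EFin \o (fun z => cmod (F z))).
  by apply/measurable_EFinP; exact: measurable_cmod.
have -> : (\int[pmeas m1 m2]_x (cmod (F x))%:E =
    \int[m2]_y \int[m1]_x (cmod (F (x, y)))%:E)%E.
  by apply: (fubini_tonelli2 _ mn) => x /=; rewrite lee_fin cmod_ge0.
case/integrableP : gi => mg; apply: le_lt_trans.
apply: ge0_le_integral => //.
- by move=> y _; apply: integral_ge0 => x _; rewrite lee_fin cmod_ge0.
- by apply: (measurable_fun_fubini_tonelli_G _ mn) => x /=; rewrite lee_fin cmod_ge0.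
- exact: measurableT_comp.
- move=> y _; apply: (@le_trans _ _ (Nint m1 (fun x => F (x, y)))%:E).
    by rewrite NintE /Rintegral fineK//; exact: integrable_fin_num (cL1_normal (Fy y)).
  by rewrite lee_fin; apply: le_trans (Fg y) (ler_norm _).
Qed.

Lemma tonelli1 (F : T1 * T2 -> R[i]) (g : T1 -> R) : cmeasurable F ->
  (forall x, cL1 m2 (fun y => F (x, y))) ->
  m1.-integrable setT (EFin \o g) ->
  (forall x, Nint m2 (fun y => F (x, y)) <= g x) -> cL1 (pmeas m1 m2) F.
Proof.
move=> mF Fy gi Fg; split => //.
have mn : measurable_fun setT (EFin \o (fun z => cmod (F z))).
  by apply/measurable_EFinP; exact: measurable_cmod.
have -> : (\int[pmeas m1 m2]_x (cmod (F x))%:E =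
    \int[m1]_x \int[m2]_y (cmod (F (x, y)))%:E)%E.
  by apply: (fubini_tonelli1 _ mn) => x /=; rewrite lee_fin cmod_ge0.
case/integrableP : gi => mg; apply: le_lt_trans.
apply: ge0_le_integral => //.
- by move=> y _; apply: integral_ge0 => x _; rewrite lee_fin cmod_ge0.
- by apply: (measurable_fun_fubini_tonelli_F _ mn) => x /=; rewrite lee_fin cmod_ge0.
- exact: measurableT_comp.
- move=> x _; apply: (@le_trans _ _ (Nint m2 (fun y => F (x, y)))%:E).
    by rewrite NintE /Rintegral fineK//; exact: integrable_fin_num (cL1_normal (Fy x)).
  by rewrite lee_fin; apply: le_trans (Fg x) (ler_norm _).
Qed.

Lemma cL1_tensor (f : T1 -> R[i]) (g : T2 -> R[i]) : cL1 m1 f -> cL1 m2 g ->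
  cL1 (pmeas m1 m2) (fun z => f z.1 * g z.2).
Proof.
move=> fi gi; apply: (@tonelli2 _ (fun y => Nint m1 f * cmod (g y))).
- by apply: cmeasM; [apply: (cmeas_comp (cL1_measurable fi))|
    apply: (cmeas_comp (cL1_measurable gi))].
- by move=> y /=; exact: cL1Zr.
- exact: eq_integrable (integrableZl measurableT (Nint m1 f) (cL1_normal gi)).
- move=> y /=; rewrite mulrC -NintZ//; apply: le_Nint; [exact: cL1Zr|exact: cL1Z|].
  by move=> x; rewrite mulrC.
Qed.

Lemma Nint_fubini2 (F : T1 * T2 -> R[i]) : cL1 (pmeas m1 m2) F ->
  m2.-integrable setT (EFin \o (fun y => Nint m1 (fun x => F (x, y)))) /\
  Nint (pmeas m1 m2) F = \int[m2]_y Nint m1 (fun x => F (x, y)).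
Proof.
move=> /cL1_normal /Rintegral_fubini2[h1 h2].
by split; [under eq_fun do rewrite NintE|rewrite NintE h2; under eq_Rintegral do rewrite -NintE].
Qed.

End ProductMeasure.

(** * Affine changes of variable for Lebesgue measure *)

Section AffineChange.
Variable R : realType.
Local Notation mu := (@lebesgue_measure R).
Implicit Types f : R -> R[i].

Lemma measurable_affine (a b : R) : measurable_fun setT (fun x : R => a * x + b).
Proof.
by apply: measurable_funD => //; apply: measurable_funM => //; exact: measurable_cst.
Qed.

(** The pushforward under the affine map, scaled by a, agrees with Lebesgue measure on half-open
    intervals, and these determine the measure. *)
Lemma lebesgue_affine (a b : R) (A : set R) : 0 < a -> measurable A ->
  mu A = (a%:E * mu ((fun x : R => (a * x + b)%R) @^-1` A))%E.
Proof.
move=> a0 mA.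
pose phi : measurableTypeR R -> measurableTypeR R := fun x => a * x + b.
have mphi : measurable_fun setT phi by exact: measurable_affine.
pose m' := mscale (NngNum (ltW a0)) (pushforward mu phi).
pose m := m' mphi.
have -> : (a%:E * mu (phi @^-1` A))%E = m A by [].
apply: lebesgue_measure_unique => //= _ [[x y]] _ <-.
rewrite /m /m' /mscale/= /pushforward/=.
have -> : phi @^-1` `]x, y] = `](x - b) / a, (y - b) / a]%classic.
  apply/seteqP; split => z; rewrite /phi /= !in_itv/= ltr_pdivrMr// ler_pdivlMr//.
    by rewrite ltrBlDr lerBrDr mulrC.
  by rewrite ltrBlDr lerBrDr mulrC.
rewrite !lebesgue_measure_itv/= !lte_fin ltr_pM2r ?invr_gt0// ltrD2r.
case: ifPn => _; rewrite ?mule0// -EFinB -EFinM; congr EFin.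
by field; exact: lt0r_neq0.
Qed.

Lemma ge0_integral_affine (a b : R) (f : R -> \bar R) : 0 < a ->
  measurable_fun setT f -> (forall x, (0 <= f x)%E) ->
  (\int[mu]_x f x = a%:E * \int[mu]_x f (a * x + b)%R)%E.
Proof.
move=> a0 mf f0.
pose phi : measurableTypeR R -> measurableTypeR R := fun x => a * x + b.
have mphi : measurable_fun setT phi by exact: measurable_affine.
pose m' := mscale (NngNum (ltW a0)) (pushforward mu phi).
pose m := m' mphi.
rewrite (@eq_measure_integral _ _ _ setT m mu); last first.
  by move=> A mA _; exact: (lebesgue_affine b a0 mA).
rewrite /m /m' ge0_integral_mscale//= ge0_integral_pushforward//=.
Qed.

Lemma ge0_integral_opp (f : R -> \bar R) :
  measurable_fun setT f -> (forall x, (0 <= f x)%E) ->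
  (\int[mu]_x f x = \int[mu]_x f (- x)%R)%E.
Proof.
move=> mf f0.
rewrite (@eq_measure_integral _ _ _ setT
  (pushforward mu (-%R : R -> measurableTypeR R)) mu); last first.
  by move=> A mA _; exact/esym/lebesgue_measureN.
by rewrite ge0_integral_pushforward.
Qed.

Lemma cL1_affine (a b : R) f : 0 < a -> cL1 mu f ->
  cL1 mu (fun x => f (a * x + b)).
Proof.
move=> a0 [mf fi]; split; first by apply: (cmeas_comp mf); exact: measurable_affine.
rewrite ltNge; apply/negP; rewrite leye_eq => /eqP E.
move: fi; rewrite (ge0_integral_affine b a0).
- by rewrite E gt0_muley ?lte_fin// ltxx.
- by apply/measurable_EFinP; exact: measurable_cmod.
- by move=> x; rewrite lee_fin cmod_ge0.
Qed.

Lemma cL1_opp f : cL1 mu f -> cL1 mu (fun x => f (- x)).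
Proof.
move=> [mf fi]; split; first exact: (cmeas_comp mf).
move: fi; rewrite ge0_integral_opp//.
- by apply/measurable_EFinP; exact: measurable_cmod.
- by move=> x; rewrite lee_fin cmod_ge0.
Qed.

Lemma Rintegral_affine (a b : R) (f : R -> R) : 0 < a ->
  mu.-integrable setT (EFin \o f) ->
  mu.-integrable setT (EFin \o (fun x => f (a * x + b))) ->
  \int[mu]_x f x = a * \int[mu]_x f (a * x + b).
Proof.
move=> a0 fi fai; have fin : (\int[mu]_x (f (a * x + b))%:E)%E \is a fin_num.
  exact: integrable_fin_num fai.
transitivity (fine (a%:E * \int[mu]_x (f (a * x + b))%:E)%E); last by rewrite fineM.
congr fine; rewrite integralE [in RHS]integralE.
have mf : measurable_fun setT (EFin \o f) by case/integrableP : fi.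
rewrite (ge0_integral_affine b a0) => [|| //]; last exact: measurable_funepos.
rewrite [X in (_ - X)%E](ge0_integral_affine b a0) => [|| //]; last exact: measurable_funeneg.
have fn : (\int[mu]_x ((fun x => (f (a * x + b))%:E)^\- x) \is a fin_num)%E.
  exact: integrable_fin_num (integrable_funeneg measurableT fai).
rewrite [RHS]muleBr => [|//|]; last by apply: fin_num_adde_defl; rewrite fin_numN; exact: fn.
by congr (_ * _ - _ * _)%E; apply: eq_integral => x _; rewrite ?funeposE ?funenegE.
Qed.

Lemma Rintegral_opp (f : R -> R) : mu.-integrable setT (EFin \o f) ->
  \int[mu]_x f x = \int[mu]_x f (- x).
Proof.
move=> fi; rewrite /Rintegral; congr fine; rewrite integralE [in RHS]integralE.
have mf : measurable_fun setT (EFin \o f) by case/integrableP : fi.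
rewrite ge0_integral_opp => [|| //]; last exact: measurable_funepos.
rewrite [X in (_ - X)%E = _]ge0_integral_opp => [|| //]; last exact: measurable_funeneg.
by congr (_ - _)%E; apply: eq_integral => x _; rewrite ?funeposE ?funenegE.
Qed.

Lemma cint_affine (a b : R) f : 0 < a -> cL1 mu f ->
  cint mu f = a%:C * cint mu (fun x => f (a * x + b)).
Proof.
move=> a0 fi; have fai := cL1_affine b a0 fi; apply: complex_eqP.
  rewrite mulrC ReMr mulrC !Re_cint (Rintegral_affine (b := b) a0)//; exact: cL1_Re.
rewrite mulrC ImMr mulrC !Im_cint (Rintegral_affine (b := b) a0)//; exact: cL1_Im.
Qed.

Lemma cint_shift (b : R) f : cL1 mu f -> cint mu (fun x => f (x + b)) = cint mu f.
Proof.
move=> fi; rewrite (cint_affine (a := 1) b ltr01 fi) mul1r.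
by apply: cint_ext => x; rewrite mul1r.
Qed.

Lemma cL1_shift (b : R) f : cL1 mu f -> cL1 mu (fun x => f (x + b)).
Proof.
by move=> /(@cL1_affine 1 b _ ltr01); apply: cL1_ext => x; rewrite mul1r.
Qed.

Lemma cint_opp f : cL1 mu f -> cint mu (fun x => f (- x)) = cint mu f.
Proof.
move=> fi; apply: complex_eqP.
  by rewrite !Re_cint [RHS]Rintegral_opp//; exact: cL1_Re.
by rewrite !Im_cint [RHS]Rintegral_opp//; exact: cL1_Im.
Qed.

Lemma cint_reflect (b : R) f : cL1 mu f -> cint mu (fun x => f (b - x)) = cint mu f.
Proof.
move=> fi; have h := cint_opp (cL1_shift b fi); rewrite cint_shift// in h.
by rewrite -h; apply: cint_ext => x; rewrite addrC.
Qed.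

Lemma cL1_reflect (b : R) f : cL1 mu f -> cL1 mu (fun x => f (b - x)).
Proof.
by move=> /(cL1_shift b) /cL1_opp; apply: cL1_ext => x; rewrite addrC.
Qed.

End AffineChange.

(** * Half-line exponential kernels *)

HB.lock Definition Kexp (R : realType) (a : R[i]) (t : R) : R[i] :=
  (0 < t)%R%:R * cexp (iC * a * t%:C).

Definition PI (R : realType) (a : R[i]) (f : R -> R[i]) (t : R) : R[i] :=
  cint (@lebesgue_measure R) (fun x => Kexp a (t - x) * f x).

Definition QI (R : realType) (a : R[i]) (f : R -> R[i]) (t : R) : R[i] :=
  cint (@lebesgue_measure R) (fun x => Kexp a (x - t) * f x).

Section Kernel.
Variable R : realType.
Local Notation mu := (@lebesgue_measure R).
Implicit Types (a b : R[i]) (f g h : R -> R[i]).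

Lemma KexpE a t : Kexp a t = (0 < t)%R%:R * cexp (iC * a * t%:C).
Proof. by rewrite Kexp.unlock. Qed.

Lemma cmod_Kexp a t : cmod (Kexp a t) = (0 < t)%R%:R * expR (- (Im a * t)).
Proof. by rewrite KexpE cmodM cmod_bool cmod_cexp ReMr ReMi mulNr. Qed.

Lemma Kexp_le1 a t : 0 <= Im a -> cmod (Kexp a t) <= 1.
Proof.
move=> a0; rewrite cmod_Kexp; case: ltP => t0; rewrite ?mul0r// mul1r.
by rewrite -expR0 ler_expR oppr_le0 mulr_ge0// ltW.
Qed.

Lemma KexpD a b t : Kexp a t * Kexp b t = Kexp (a + b) t.
Proof.
rewrite !KexpE; case: (0 < t); rewrite ?mul0r ?mul1r//.
by rewrite -cexpD; congr cexp; ring.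
Qed.

Lemma Kexp_split a x y t : x < t ->
  (y < x)%R%:R * Kexp a (t - y) = Kexp a (t - x) * Kexp a (x - y).
Proof.
move=> xt; rewrite !KexpE !subr_gt0 xt mul1r; case: ltP => yx; last by rewrite !mul0r mulr0.
rewrite (lt_trans yx xt) !mul1r -cexpD; congr cexp.
by rewrite -mulrDr -rmorphD/=; congr (_ * _%:C); ring.
Qed.

Lemma Kexp0 a t : t <= 0 -> Kexp a t = 0.
Proof. by move=> t0; rewrite KexpE ltNge t0 mul0r. Qed.

Lemma cmeas_id_real : cmeasurable (fun x : R => x%:C).
Proof. exact: cmeas_real. Qed.

Lemma cmeas_Kexp a : cmeasurable (Kexp a).
Proof.
have -> : Kexp a = fun t : R => (0 < t)%R%:R * cexp (iC * a * t%:C).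
  by apply/funext => t; rewrite KexpE.
apply: cmeasM; first by apply: cmeas_bool; apply: measurable_fun_ltr => //; exact: measurable_cst.
by apply: cmeas_cexp; apply: cmeasM; [exact: cmeas_cst|exact: cmeas_id_real].
Qed.

Lemma measurable_sub12 : measurable_fun setT (fun z : R * R => z.1 - z.2).
Proof. by apply: measurable_funB. Qed.

Lemma measurable_sub21 : measurable_fun setT (fun z : R * R => z.2 - z.1).
Proof. by apply: measurable_funB. Qed.

Lemma measurable_subr (t : R) : measurable_fun setT (fun x : R => t - x).
Proof. by apply: measurable_funB => //; exact: measurable_cst. Qed.

Lemma measurable_subl (t : R) : measurable_fun setT (fun x : R => x - t).
Proof. by apply: measurable_funB => //; exact: measurable_cst. Qed.

Lemma cmeas_PI a f : cmeasurable f -> cmeasurable (PI a f).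
Proof.
move=> mf; apply: (@cmeas_cint1 _ _ _ _ R mu (fun z : R * R => Kexp a (z.1 - z.2) * f z.2)).
apply: cmeasM; first exact: (cmeas_comp (cmeas_Kexp a) measurable_sub12).
exact: (cmeas_comp mf).
Qed.

Lemma cmeas_QI a f : cmeasurable f -> cmeasurable (QI a f).
Proof.
move=> mf; apply: (@cmeas_cint1 _ _ _ _ R mu (fun z : R * R => Kexp a (z.2 - z.1) * f z.2)).
apply: cmeasM; first exact: (cmeas_comp (cmeas_Kexp a) measurable_sub21).
exact: (cmeas_comp mf).
Qed.

Lemma integral_expR_half (k : R) : 0 < k ->
  (\int[mu]_(x in `[0%R, +oo[) (expR (- (k * x)))%:E = (k^-1)%:E)%E.
Proof.
move=> k0.
have dE x : is_derive x (1 : R) (fun x : R => - k^-1 * expR (- (k * x))) (expR (- (k * x))).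
  apply: is_derive_eq.
  by rewrite /GRing.scale/= mulr1 mulrN mulNr mulrN opprK mulrCA mulVf ?mulr1// gt_eqF.
have cE : continuous (fun x : R => - k^-1 * expR (- (k * x))).
  by move=> x; apply: differentiable_continuous; exact/derivable1_diffP.
rewrite (@ge0_continuous_FTC2y _ _ (fun x => - k^-1 * expR (- (k * x))) 0 0)//.
- by rewrite mulr0 oppr0 expR0 mulr1 sub0e /= opprK.
- apply: continuous_subspaceT => x; apply: differentiable_continuous.
  exact/derivable1_diffP.
- rewrite -[X in _ --> X](mulr0 (- k^-1)); apply: cvgM; first exact: cvg_cst.
  rewrite (_ : (fun x => expR (- (k * x))) = (fun z => expR (- z)) \o (fun z => k * z))//.
  apply: (@cvg_comp _ _ _ _ _ _ (pinfty_nbhs R)); last exact: cvgr_expR.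
  exact: gt0_cvgMry.
- apply: cvg_at_right_filter; exact: cE.
- by move=> x _; rewrite derive1E; apply: derive_val.
Qed.

Lemma cL1_Kexp a : 0 < Im a -> cL1 mu (Kexp a).
Proof.
move=> a0; split; first exact: cmeas_Kexp.
apply: (@le_lt_trans _ _ (\int[mu]_(x in `[0%R, +oo[) (expR (- (Im a * x)))%:E)%E).
  rewrite [leRHS]integral_mkcond/=; apply: ge0_le_integral => //.
  - by move=> x _; rewrite lee_fin cmod_ge0.
  - by apply/measurable_EFinP; exact: measurable_cmod (cmeas_Kexp a).
  - apply/(measurable_restrictT _ _).1 => //; apply/measurable_EFinP.
    apply: measurable_funTS; apply: measurableT_comp => //.
    by apply: measurableT_comp => //; apply: measurable_funM => //; exact: measurable_cst.
  - move=> x _; rewrite cmod_Kexp /patch; case: ltP => x0.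
      by rewrite mem_set ?mul1r//= in_itv/= ltW.
    by rewrite mul0r; case: ifP => // _; rewrite lee_fin expR_ge0.
by rewrite integral_expR_half// ltry.
Qed.

Lemma Nint_reflect f t : cL1 mu f -> Nint mu (fun x => f (t - x)) = Nint mu f.
Proof.
move=> fi; apply: complexI; rewrite !Nint_cint//; last exact: cL1_reflect.
by rewrite (cint_reflect t (cL1_cmod fi)).
Qed.

Lemma Nint_shift f t : cL1 mu f -> Nint mu (fun x => f (x - t)) = Nint mu f.
Proof.
move=> fi; apply: complexI; rewrite !Nint_cint//; last exact: cL1_shift.
by rewrite (cint_shift (- t) (cL1_cmod fi)).
Qed.

Lemma cL1_conv1 f k : cL1 mu f -> cL1 mu k ->
  cL1 (pmeas mu mu) (fun z : R * R => f z.1 * k (z.1 - z.2)).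
Proof.
move=> fi ki; apply: (@tonelli1 _ _ _ _ _ mu mu _ (fun x => Nint mu k * cmod (f x))).
- apply: cmeasM; first exact: (cmeas_comp (cL1_measurable fi)).
  exact: (cmeas_comp (cL1_measurable ki) measurable_sub12).
- by move=> x /=; apply: cL1Z; exact: cL1_reflect.
- exact: eq_integrable (integrableZl measurableT (Nint mu k) (cL1_normal fi)).
- by move=> x /=; rewrite NintZ ?Nint_reflect// 1?mulrC//; exact: cL1_reflect.
Qed.

Lemma cL1_conv2 f k : cL1 mu f -> cL1 mu k ->
  cL1 (pmeas mu mu) (fun z : R * R => k (z.1 - z.2) * f z.2).
Proof.
move=> fi ki; apply: (@tonelli2 _ _ _ _ _ mu mu _ (fun x => Nint mu k * cmod (f x))).
- apply: cmeasM; first exact: (cmeas_comp (cL1_measurable ki) measurable_sub12).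
  exact: (cmeas_comp (cL1_measurable fi)).
- by move=> x /=; apply: cL1Zr; exact: cL1_shift.
- exact: eq_integrable (integrableZl measurableT (Nint mu k) (cL1_normal fi)).
- move=> x /=.
  rewrite -[leRHS]mulrC -[X in cmod _ * X](Nint_shift x ki) -NintZ; last exact: cL1_shift.
  apply: le_Nint; [by apply: cL1Zr; exact: cL1_shift|by apply: cL1Z; exact: cL1_shift|].
  by move=> y; rewrite mulrC.
Qed.

(** This crude form of the arithmetic-geometric inequality stands in for Cauchy-Schwarz throughout:
    integrals of products have to be finite or, after rescaling, small, and sharp constants are not
    at stake. *)
Lemma sqrt_amgm (x y : R) : x * y <= x ^+ 2 + y ^+ 2.
Proof. by have := sqr_ge0 (x - y); have := sqr_ge0 (x + y); rewrite !expr2; lra. Qed.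

Lemma sq_cL1 f : square_integrable f -> cL1 mu (fun x => ((cmod (f x)) ^+ 2)%:C).
Proof.
move=> [mf fi]; split.
  by apply: cmeas_real; apply: measurable_funX; exact: measurable_cmod.
move: fi; congr (_ < _)%E; apply: eq_integral => x _.
by rewrite cmod_real ger0_norm// sqr_ge0.
Qed.

Lemma cL1_sq f : cmeasurable f -> cL1 mu (fun x => ((cmod (f x)) ^+ 2)%:C) ->
  square_integrable f.
Proof.
move=> mf [_ fi]; split=> //.
move: fi; congr (_ < _)%E; apply: eq_integral => x _.
by rewrite cmod_real ger0_norm// sqr_ge0.
Qed.

Lemma sq_le f g : cmeasurable f -> square_integrable g ->
  (forall x, cmod (f x) <= cmod (g x)) -> square_integrable f.
Proof.
move=> mf gi fg; apply: cL1_sq => //; apply: cL1_le (sq_cL1 gi) _.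
  by apply: cmeas_real; apply: measurable_funX; exact: measurable_cmod.
move=> x; rewrite !cmod_real !ger0_norm ?sqr_ge0//.
by rewrite ler_pXn2r// nnegrE cmod_ge0.
Qed.

Lemma sq_conj f : square_integrable f -> square_integrable (fun x => conjc (f x)).
Proof.
move=> fi; apply: (sq_le _ fi); first by apply: cmeas_conj; case: fi.
by move=> x; rewrite cmod_conjc.
Qed.

Lemma sqMbd f g (C : R) : square_integrable f -> cmeasurable g ->
  (forall x, cmod (g x) <= C) -> square_integrable (fun x => f x * g x).
Proof.
move=> fi mg gC; apply: cL1_sq; first by apply: cmeasM => //; case: fi.
have h := @cL1Mbd _ _ _ mu _ (fun x => ((cmod (g x)) ^+ 2)%:C) (C ^+ 2) (sq_cL1 fi).
apply: cL1_ext (h _ _) => [x||x].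
- by rewrite -rmorphM/= cmodM exprMn.
- by apply: cmeas_real; apply: measurable_funX; exact: measurable_cmod.
- rewrite cmod_real ger0_norm ?sqr_ge0// ler_pXn2r// ?nnegrE ?cmod_ge0//.
  exact: le_trans (cmod_ge0 _) (gC x).
Qed.

Lemma sqM f g : square_integrable f -> square_integrable g ->
  cL1 mu (fun x => f x * g x).
Proof.
move=> fi gi; have h := cL1D (sq_cL1 fi) (sq_cL1 gi).
apply: (cL1_le _ h); first by apply: cmeasM; [case: fi|case: gi].
move=> x; rewrite cmodM -rmorphD cmod_real ger0_norm ?addr_ge0 ?sqr_ge0//.
exact: sqrt_amgm.
Qed.

Lemma Nint_sqM f g : square_integrable f -> square_integrable g ->
  Nint mu (fun x => f x * g x) <=
  Nint mu (fun x => ((cmod (f x)) ^+ 2)%:C) + Nint mu (fun x => ((cmod (g x)) ^+ 2)%:C).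
Proof.
move=> fi gi; have h := cL1D (sq_cL1 fi) (sq_cL1 gi).
apply: le_trans (NintD (sq_cL1 fi) (sq_cL1 gi)).
apply: (le_Nint (sqM fi gi) h).
move=> x; rewrite cmodM -rmorphD cmod_real ger0_norm ?addr_ge0 ?sqr_ge0//.
exact: sqrt_amgm.
Qed.

Lemma sqD f g : square_integrable f -> square_integrable g ->
  square_integrable (fun x => f x + g x).
Proof.
move=> fi gi; apply: cL1_sq; first by apply: cmeasD; [case: fi|case: gi].
apply: (cL1_le _ (cL1Z 2 (cL1D (sq_cL1 fi) (sq_cL1 gi)))).
  apply: cmeas_real; apply: measurable_funX; apply: measurable_cmod.
  by apply: cmeasD; [case: fi|case: gi].
move=> x; rewrite cmodM cmod_nat -rmorphD !cmod_real !ger0_norm ?addr_ge0 ?sqr_ge0//.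
apply: (@le_trans _ _ ((cmod (f x) + cmod (g x)) ^+ 2)).
  by rewrite ler_pXn2r ?cmodD// nnegrE ?addr_ge0 ?cmod_ge0.
by have := sqr_ge0 (cmod (f x) - cmod (g x)); rewrite !expr2; lra.
Qed.

Lemma sq_Kexp a : 0 < Im a -> square_integrable (Kexp a).
Proof.
move=> a0; apply: cL1_sq; first exact: cmeas_Kexp.
apply: (cL1_le _ (cL1_Kexp a0)).
  by apply: cmeas_real; apply: measurable_funX; apply: measurable_cmod; exact: cmeas_Kexp.
move=> x; rewrite cmod_real ger0_norm ?sqr_ge0// expr2 ler_piMr ?cmod_ge0//.
by apply: Kexp_le1; exact: ltW.
Qed.

Lemma sq_reflect f t : square_integrable f -> square_integrable (fun x => f (t - x)).
Proof.
move=> fi; apply: cL1_sq; first by case: fi => mf _; apply: (cmeas_comp mf); exact: measurable_subr.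
exact: (cL1_reflect t (sq_cL1 fi)).
Qed.

Lemma sq_shift f t : square_integrable f -> square_integrable (fun x => f (x - t)).
Proof.
move=> fi; apply: cL1_sq; first by case: fi => mf _; apply: (cmeas_comp mf); exact: measurable_subl.
exact: (cL1_shift (- t) (sq_cL1 fi)).
Qed.

Lemma okP_L1 a f t : 0 <= Im a -> cL1 mu f -> cL1 mu (fun x => Kexp a (t - x) * f x).
Proof.
move=> a0 fi; apply: (@cL1bdM _ _ _ _ _ _ 1) => //.
  exact: (cmeas_comp (cmeas_Kexp a) (measurable_subr t)).
by move=> x; exact: Kexp_le1.
Qed.

Lemma okQ_L1 a f t : 0 <= Im a -> cL1 mu f -> cL1 mu (fun x => Kexp a (x - t) * f x).
Proof.
move=> a0 fi; apply: (@cL1bdM _ _ _ _ _ _ 1) => //.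
  exact: (cmeas_comp (cmeas_Kexp a) (measurable_subl t)).
by move=> x; exact: Kexp_le1.
Qed.

Lemma okP_sq a f t : 0 < Im a -> square_integrable f ->
  cL1 mu (fun x => Kexp a (t - x) * f x).
Proof. by move=> a0 fi; apply: sqM => //; apply: sq_reflect; exact: sq_Kexp. Qed.

Lemma okQ_sq a f t : 0 < Im a -> square_integrable f ->
  cL1 mu (fun x => Kexp a (x - t) * f x).
Proof. by move=> a0 fi; apply: sqM => //; apply: sq_shift; exact: sq_Kexp. Qed.

(** As the kernel has modulus at most 1, the bound is free of a. The asymptotic estimates rest on
    this, since Im a may be arbitrarily small there; the bounds [PI_bd_sq] and [QI_bd_sq] depend on
    a and serve at fixed a. *)
Lemma PI_bd_L1 a f t : 0 <= Im a -> cL1 mu f -> cmod (PI a f t) <= Nint mu f.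
Proof.
move=> a0 fi; apply: cmod_cint_le; first exact: okP_L1.
apply: le_Nint => //; first exact: okP_L1.
by move=> x; rewrite cmodM ler_piMl ?cmod_ge0// Kexp_le1.
Qed.

Lemma QI_bd_L1 a f t : 0 <= Im a -> cL1 mu f -> cmod (QI a f t) <= Nint mu f.
Proof.
move=> a0 fi; apply: cmod_cint_le; first exact: okQ_L1.
apply: le_Nint => //; first exact: okQ_L1.
by move=> x; rewrite cmodM ler_piMl ?cmod_ge0// Kexp_le1.
Qed.

Definition sqnorm f : R := Nint mu (fun x => ((cmod (f x)) ^+ 2)%:C).

Lemma PI_Nbd_sq a f t : 0 < Im a -> square_integrable f ->
  Nint mu (fun x => Kexp a (t - x) * f x) <= sqnorm (Kexp a) + sqnorm f.
Proof.
move=> a0 fi; have h := sq_Kexp a0.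
apply: le_trans (Nint_sqM (sq_reflect t h) fi) _.
by rewrite /sqnorm -(Nint_reflect t (sq_cL1 h)).
Qed.

Lemma QI_Nbd_sq a f t : 0 < Im a -> square_integrable f ->
  Nint mu (fun x => Kexp a (x - t) * f x) <= sqnorm (Kexp a) + sqnorm f.
Proof.
move=> a0 fi; have h := sq_Kexp a0.
apply: le_trans (Nint_sqM (sq_shift t h) fi) _.
by rewrite /sqnorm -(Nint_shift t (sq_cL1 h)).
Qed.

Lemma PI_bd_sq a f t : 0 < Im a -> square_integrable f ->
  cmod (PI a f t) <= sqnorm (Kexp a) + sqnorm f.
Proof.
move=> a0 fi; apply: cmod_cint_le; first exact: okP_sq.
exact: PI_Nbd_sq.
Qed.

Lemma QI_bd_sq a f t : 0 < Im a -> square_integrable f ->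
  cmod (QI a f t) <= sqnorm (Kexp a) + sqnorm f.
Proof.
move=> a0 fi; apply: cmod_cint_le; first exact: okQ_sq.
exact: QI_Nbd_sq.
Qed.

(** Absolute convergence of the double integral behind the pairing of h with [PI a f]; it is what
    the transposition of [PI] into [QI] requires. *)
Definition joint a h f : Prop :=
  cL1 (pmeas mu mu) (fun z : R * R => h z.1 * (Kexp a (z.1 - z.2) * f z.2)).

Lemma cmeas_joint a h f : cmeasurable h -> cmeasurable f ->
  cmeasurable (fun z : R * R => h z.1 * (Kexp a (z.1 - z.2) * f z.2)).
Proof.
move=> mh mf; apply: cmeasM; first exact: (cmeas_comp mh).
apply: cmeasM; first exact: (cmeas_comp (cmeas_Kexp a) measurable_sub12).
exact: (cmeas_comp mf).
Qed.

(** The integrand is at most |K| (|h|^2 + |f|^2), a sum of two convolution integrands of L1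
    functions with the integrable kernel K. *)
Lemma joint_sqsq a h f : 0 < Im a -> square_integrable h -> square_integrable f ->
  joint a h f.
Proof.
move=> a0 hi fi; have K := cL1_Kexp a0.
have h1 := cL1_conv1 (sq_cL1 hi) K; have h2 := cL1_conv2 (sq_cL1 fi) K.
have h3 := cL1D (cL1_cmod h1) (cL1_cmod h2).
apply: (cL1_le _ h3); first by apply: cmeas_joint; [case: hi|case: fi].
move=> z; rewrite -rmorphD cmod_real ger0_norm ?addr_ge0 ?cmod_ge0//.
rewrite !cmodM !cmod_real !(@ger0_norm _ (_ ^+ 2)) ?sqr_ge0//.
rewrite [leLHS]mulrCA [X in _ <= X + _]mulrC -mulrDr ler_wpM2l ?cmod_ge0//.
exact: sqrt_amgm.
Qed.

Lemma joint_sqL1 a h f : 0 < Im a -> square_integrable h -> cL1 mu f -> joint a h f.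
Proof.
move=> a0 hi fi.
apply: (@tonelli2 _ _ _ _ _ mu mu _ (fun x => (sqnorm (Kexp a) + sqnorm h) * cmod (f x))).
- by apply: cmeas_joint; [case: hi|case: fi].
- move=> x /=; apply: cL1_ext (cL1Zr (f x) (okQ_sq x a0 hi)) => t /=; ring.
- exact: eq_integrable (integrableZl measurableT _ (cL1_normal fi)).
- move=> x /=; rewrite mulrC.
  apply: le_trans (ler_wpM2l (cmod_ge0 _) (QI_Nbd_sq x a0 hi)).
  have ok := okQ_sq x a0 hi; rewrite -NintZ//.
  have ok1 : cL1 mu (fun t => h t * (Kexp a (t - x) * f x)).
    by apply: cL1_ext (cL1Zr (f x) ok) => t /=; ring.
  apply: (le_Nint ok1 (cL1Z (f x) ok)) => t.
  suff -> : h t * (Kexp a (t - x) * f x) = f x * (Kexp a (t - x) * h t) by [].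
  ring.
Qed.

Lemma joint_L1L1 a h f : 0 <= Im a -> cL1 mu h -> cL1 mu f -> joint a h f.
Proof.
move=> a0 hi fi.
have := cL1Mbd (cL1_tensor hi fi)
  (cmeas_comp (cmeas_Kexp a) measurable_sub12) (fun z => Kexp_le1 _ a0).
by apply: cL1_ext => z /=; ring.
Qed.

Lemma joint_cL1P a h f : joint a h f ->
  (forall t, cL1 mu (fun x => Kexp a (t - x) * f x)) ->
  cL1 mu (fun t => h t * PI a f t).
Proof.
move=> /fubini1[H _] ok; apply: cL1_ext H => t /=.
by rewrite (cintZ (h t) (ok t)).
Qed.

Lemma joint_cL1Q a h f : joint a h f ->
  (forall t, cL1 mu (fun x => Kexp a (x - t) * h x)) ->
  cL1 mu (fun x => QI a h x * f x).
Proof.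
move=> /fubini2[H _] ok; apply: cL1_ext H => x /=.
rewrite /QI -(cintZr (f x) (ok x)); apply: cint_ext => t; ring.
Qed.

(** Both sides are iterated forms of one double integral: integrating out t before x transfers the
    kernel from f to h and reverses its direction. *)
Lemma PQ_dual a h f : joint a h f ->
  (forall t, cL1 mu (fun x => Kexp a (t - x) * f x)) ->
  (forall t, cL1 mu (fun x => Kexp a (x - t) * h x)) ->
  cint mu (fun t => h t * PI a f t) = cint mu (fun x => QI a h x * f x).
Proof.
move=> J okp okq; transitivity (cint mu (fun t => cint mu (fun x =>
    h t * (Kexp a (t - x) * f x)))).
  by apply: cint_ext => t; rewrite (cintZ (h t) (okp t)).
rewrite (cint_swap J); apply: cint_ext => x.
rewrite /QI -(cintZr (f x) (okq x)); apply: cint_ext => t /=; ring.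
Qed.

Lemma PI_cL1 a f : 0 < Im a -> cL1 mu f -> cL1 mu (PI a f).
Proof. by move=> a0 fi; have [] := fubini1 (cL1_conv2 fi (cL1_Kexp a0)). Qed.

Lemma bounded_L1_sq f (C : R) : cL1 mu f -> (forall x, cmod (f x) <= C) ->
  square_integrable f.
Proof.
move=> fi fC; apply: cL1_sq; first by case: fi.
apply: (cL1_le _ (cL1Z C%:C fi)).
  by apply: cmeas_real; apply: measurable_funX; apply: measurable_cmod; case: fi.
move=> x; rewrite cmodM !cmod_real ger0_norm ?sqr_ge0// expr2 ler_wpM2r ?cmod_ge0//.
exact: le_trans (fC x) (ler_norm _).
Qed.

Lemma cint_point0 (x : R) f : cmeasurable f ->
  cint mu (fun y => (y == x)%R%:R * f y) = 0.
Proof.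
move=> mf; rewrite -[RHS](cint0 mu); apply: cint_ae_eq.
- apply: cmeasM => //; apply: cmeas_bool.
  by apply: measurable_fun_eqr => //; exact: measurable_cst.
- exact: cmeas_cst.
- exists [set x]; split => //; first exact: lebesgue_measure_set1.
  move=> y /= h; apply: contrapT => yx; apply: h.
  by case: eqP => // _; rewrite mul0r.
Qed.

Lemma measurable_ltl (x : R) : measurable_fun setT (fun y : R => (y < x)%R).
Proof. by apply: measurable_fun_ltr => //; exact: measurable_cst. Qed.

Lemma measurable_ltr (x : R) : measurable_fun setT (fun y : R => (x < y)%R).
Proof. by apply: measurable_fun_ltr => //; exact: measurable_cst. Qed.

Lemma cint_split (x : R) f : cL1 mu f ->
  cint mu f = cint mu (fun y => (y < x)%R%:R * f y) + cint mu (fun y => (x < y)%R%:R * f y).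
Proof.
move=> fi.
have h1 := cL1_bool fi (measurable_ltl x); have h2 := cL1_bool fi (measurable_ltr x).
rewrite -(cintD h1 h2) -[RHS]addr0 -(cint_point0 x (cL1_measurable fi)).
have h3 : cL1 mu (fun y => (y == x)%R%:R * f y).
  apply: cL1_bool => //; by apply: measurable_fun_eqr => //; exact: measurable_cst.
rewrite -(cintD (cL1D h1 h2) h3); apply: cint_ext => y.
by case: ltgtP; rewrite ?mul1r ?mul0r ?addr0 ?add0r.
Qed.

(** The plane is cut along its diagonal, a null set: the simplest shuffle relation between iterated
    integrals. *)
Lemma cint_mul_split f g : cL1 mu f -> cL1 mu g ->
  [/\ cL1 mu (fun x => f x * cint mu (fun y => (y < x)%R%:R * g y)),
      cL1 mu (fun y => g y * cint mu (fun x => (x < y)%R%:R * f x)) &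
  cint mu f * cint mu g =
    cint mu (fun x => f x * cint mu (fun y => (y < x)%R%:R * g y)) +
    cint mu (fun y => g y * cint mu (fun x => (x < y)%R%:R * f x))].
Proof.
move=> fi gi; have T := cL1_tensor fi gi.
have m1 : measurable_fun setT (fun z : R * R => (z.1 < z.2)%R).
  exact: measurable_fun_ltr.
have m2 : measurable_fun setT (fun z : R * R => (z.2 < z.1)%R).
  exact: measurable_fun_ltr.
have T1 := cL1_bool T m1; have T2 := cL1_bool T m2.
have e2 x : cint mu (fun y => (y < x)%R%:R * (f x * g y)) =
    f x * cint mu (fun y => (y < x)%R%:R * g y).
  rewrite -cintZ; last exact: cL1_bool gi (measurable_ltl x).
  by apply: cint_ext => y; rewrite mulrCA.
have e1 y : cint mu (fun x => (x < y)%R%:R * (f x * g y)) =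
    g y * cint mu (fun x => (x < y)%R%:R * f x).
  rewrite -cintZ; last exact: cL1_bool fi (measurable_ltl y).
  by apply: cint_ext => x; ring.
have e1' x : cint mu (fun y => (x < y)%R%:R * (f x * g y)) =
    f x * cint mu (fun y => (x < y)%R%:R * g y).
  rewrite -cintZ; last exact: cL1_bool gi (measurable_ltr x).
  by apply: cint_ext => y; rewrite mulrCA.
have [i1 _] := fubini1 T2; have [i2 _] := fubini2 T1; have [i3 _] := fubini1 T1.
have j1 : cL1 mu (fun x => f x * cint mu (fun y => (y < x)%R%:R * g y)).
  by apply: cL1_ext i1 => x; exact: e2.
have j2 : cL1 mu (fun y => g y * cint mu (fun x => (x < y)%R%:R * f x)).
  by apply: cL1_ext i2 => x; exact: e1.
have j3 : cL1 mu (fun x => f x * cint mu (fun y => (x < y)%R%:R * g y)).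
  by apply: cL1_ext i3 => x; exact: e1'.
have E : cint mu (fun y => g y * cint mu (fun x => (x < y)%R%:R * f x)) =
         cint mu (fun x => f x * cint mu (fun y => (x < y)%R%:R * g y)).
  transitivity (cint mu (fun y => cint mu (fun x => (x < y)%R%:R * (f x * g y)))).
    by apply: cint_ext => y; rewrite e1.
  transitivity (cint mu (fun x => cint mu (fun y => (x < y)%R%:R * (f x * g y)))).
    by apply/esym; exact: (cint_swap T1).
  by apply: cint_ext => x; rewrite e1'.
split => //; rewrite E -(cintD j1 j3) -(cintZr _ fi); apply: cint_ext => x.
by rewrite -mulrDr -cint_split.
Qed.

Lemma PI_mul a b f g t :
  cL1 mu (fun x => Kexp a (t - x) * f x) -> cL1 mu (fun x => Kexp b (t - x) * g x) ->
  [/\ cL1 mu (fun x => Kexp (a + b) (t - x) * (f x * PI b g x)),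
      cL1 mu (fun x => Kexp (a + b) (t - x) * (g x * PI a f x)) &
  PI a f t * PI b g t =
    PI (a + b) (fun x => f x * PI b g x) t + PI (a + b) (fun x => g x * PI a f x) t].
Proof.
move=> fi gi; have [h1 h2 h3] := cint_mul_split fi gi.
have e c d k l x : cL1 mu (fun y => Kexp c (t - y) * k y) ->
   Kexp d (t - x) * l x * cint mu (fun y => (y < x)%R%:R * (Kexp c (t - y) * k y)) =
   Kexp (d + c) (t - x) * (l x * PI c k x).
  move=> ki; case: (ltP x t) => xt; last first.
    by rewrite !Kexp0 ?mul0r// subr_le0.
  transitivity (Kexp d (t - x) * l x * (Kexp c (t - x) * PI c k x)); last first.
    by rewrite -KexpD; ring.
  congr (_ * _); have e1 y : (y < x)%R%:R * (Kexp c (t - y) * k y) =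
      Kexp c (t - x) * (Kexp c (x - y) * k y).
    by rewrite mulrA Kexp_split// mulrA.
  have K0 : Kexp c (t - x) != 0.
    by rewrite KexpE subr_gt0 xt mul1r cexp_neq0.
  (* Integrability is known for the kernel ending at t only. Below x it is the kernel ending at x
     times a nonzero constant, so it may be divided out. *)
  have H : cL1 mu (fun y => Kexp c (x - y) * k y).
    apply: cL1_ext (cL1Z (Kexp c (t - x))^-1 (cL1_bool ki (measurable_ltl x))) => y /=.
    by rewrite e1 mulKf.
  by rewrite (cint_ext mu e1) cintZ.
split; first by apply: cL1_ext h1 => x; exact: e.
  by apply: cL1_ext h2 => x; rewrite (addrC a b); exact: e.
rewrite [LHS]h3; congr (_ + _); apply: cint_ext => x; first exact: e.
by rewrite (addrC a b); exact: e.
Qed.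

Lemma QI_PI a f t : cL1 mu (fun x => Kexp a (x - t) * f x) ->
  QI a f t = PI a (fun x => f (- x)) (- t).
Proof.
move=> fi; rewrite /QI -(cint_opp fi); apply: cint_ext => x.
by rewrite addrC.
Qed.

(** Reflection of the line exchanges [QI] and [PI] and reduces this to [PI_mul]. *)
Lemma QI_mul a b f g t :
  (forall t, cL1 mu (fun x => Kexp a (x - t) * f x)) ->
  (forall t, cL1 mu (fun x => Kexp b (x - t) * g x)) ->
  [/\ cL1 mu (fun x => Kexp (a + b) (x - t) * (f x * QI b g x)),
      cL1 mu (fun x => Kexp (a + b) (x - t) * (g x * QI a f x)) &
  QI a f t * QI b g t =
    QI (a + b) (fun x => f x * QI b g x) t + QI (a + b) (fun x => g x * QI a f x) t].
Proof.
move=> fi gi.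
have sw c k s : (forall t, cL1 mu (fun x => Kexp c (x - t) * k x)) ->
    cL1 mu (fun x => Kexp c (- s - x) * k (- x)).
  move=> H; apply: cL1_ext (cL1_opp (H s)) => x /=; by rewrite addrC.
have [h1 h2 h3] := PI_mul (sw _ _ t fi) (sw _ _ t gi).
have e c k x : (forall t, cL1 mu (fun x => Kexp c (x - t) * k x)) ->
    PI c (fun x => k (- x)) x = QI c k (- x).
  by move=> H; rewrite (QI_PI (H _)) opprK.
have E1 : (fun x => f (- x) * PI b (fun x => g (- x)) x) =
    (fun x => f (- x) * QI b g (- x)) by apply/funext => x; rewrite e.
have E2 : (fun x => g (- x) * PI a (fun x => f (- x)) x) =
    (fun x => g (- x) * QI a f (- x)) by apply/funext => x; rewrite e.
have k1 : cL1 mu (fun x => Kexp (a + b) (x - t) * (f x * QI b g x)).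
  apply: cL1_ext (cL1_opp h1) => x /=; rewrite e// !opprK.
  by rewrite (addrC (- t)).
have k2 : cL1 mu (fun x => Kexp (a + b) (x - t) * (g x * QI a f x)).
  apply: cL1_ext (cL1_opp h2) => x /=; rewrite e// !opprK.
  by rewrite (addrC (- t)).
split => //; rewrite (QI_PI (fi t)) (QI_PI (gi t)) h3 E1 E2.
by rewrite (QI_PI k1) (QI_PI k2).
Qed.

Lemma Kexp_zero (t : R) : Kexp 0 t = (0 < t)%R%:R.
Proof. by rewrite KexpE mulr0 mul0r cexp0 mulr1. Qed.

(** [PI 0] is the primitive that vanishes at minus infinity, so the product rule with one exponent 0
    is integration by parts against a partial integral. *)
Lemma PI0E f t : PI 0 f t = cint mu (fun x => (x < t)%R%:R * f x).
Proof. by apply: cint_ext => x; rewrite Kexp_zero subr_gt0. Qed.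

(** The product rule with both exponents 0, evaluated at plus infinity. *)
Lemma cint_mul_PI0 f g : cL1 mu f -> cL1 mu g ->
  [/\ cL1 mu (fun x => f x * PI 0 g x), cL1 mu (fun x => g x * PI 0 f x) &
  cint mu f * cint mu g =
    cint mu (fun x => f x * PI 0 g x) + cint mu (fun x => g x * PI 0 f x)].
Proof.
move=> fi gi; have [h1 h2 h3] := cint_mul_split fi gi.
split; first by apply: cL1_ext h1 => x; rewrite PI0E.
  by apply: cL1_ext h2 => x; rewrite PI0E.
by rewrite h3; congr (_ + _); apply: cint_ext => x; rewrite PI0E.
Qed.

Lemma PID a f g t : cL1 mu (fun x => Kexp a (t - x) * f x) ->
  cL1 mu (fun x => Kexp a (t - x) * g x) ->
  PI a (fun x => f x + g x) t = PI a f t + PI a g t.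
Proof.
by move=> h1 h2; rewrite /PI -cintD//; apply: cint_ext => x; rewrite mulrDr.
Qed.

Lemma PIZ a c f t : cL1 mu (fun x => Kexp a (t - x) * f x) ->
  PI a (fun x => c * f x) t = c * PI a f t.
Proof.
by move=> h1; rewrite /PI -cintZ//; apply: cint_ext => x; rewrite mulrCA.
Qed.

Lemma PI_ext a f g t : (forall x, f x = g x) -> PI a f t = PI a g t.
Proof. by move=> /funext ->. Qed.

Lemma cint_lin2 c1 c2 f1 f2 : cL1 mu f1 -> cL1 mu f2 ->
  cint mu (fun x => c1 * f1 x + c2 * f2 x) = c1 * cint mu f1 + c2 * cint mu f2.
Proof.
by move=> i1 i2; rewrite (cintD (cL1Z c1 i1) (cL1Z c2 i2)) (cintZ c1 i1) (cintZ c2 i2).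
Qed.

(** * The algebraic identity behind b_6 *)

Section Position.
Variables (q : R -> R[i]) (a : R[i]).
Hypotheses (hq : square_integrable q) (a0 : 0 < Im a).

Local Notation qc := (fun x => conjc (q x)).
Local Notation P := (PI a qc).
Local Notation Q := (QI a q).
(** Up to powers of lambda, [u] and [v] are the integrals s_2 and s_4 restricted to points below t.
    The function [g] is the correction that arises when u is moved out of [PI a]. *)
Local Notation phi := (fun x => q x * P x).
Local Notation u := (PI 0 phi).
Local Notation g := (PI a (fun x => phi x * P x)).
Local Notation psi := (fun x => q x * PI a (fun y => qc y * u y) x).
Local Notation v := (PI 0 psi).

Let a0w : 0 <= Im a. Proof. exact: ltW. Qed.
Let z0 : 0 <= Im (0 : R[i]). Proof. exact: lexx. Qed.
Let hqc : square_integrable qc. Proof. exact: sq_conj. Qed.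
Let mq : cmeasurable q. Proof. by case: hq. Qed.
Let mqc : cmeasurable qc. Proof. by case: hqc. Qed.
Let mP : cmeasurable P. Proof. exact: cmeas_PI. Qed.
Let mQ : cmeasurable Q. Proof. exact: cmeas_QI. Qed.
Let CP : R := sqnorm (Kexp a) + sqnorm qc.
Let bP x : cmod (P x) <= CP. Proof. exact: PI_bd_sq. Qed.
Let CQ : R := sqnorm (Kexp a) + sqnorm q.
Let bQ x : cmod (Q x) <= CQ. Proof. exact: QI_bd_sq. Qed.

Lemma phi_L1 : cL1 mu phi.
Proof. by apply: joint_cL1P => [|t]; [exact: joint_sqsq|exact: okP_sq]. Qed.

Let mu_ : cmeasurable u. Proof. by apply: cmeas_PI; exact: cL1_measurable phi_L1. Qed.
Let bu x : cmod (u x) <= Nint mu phi.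
Proof. by apply: PI_bd_L1 => //; exact: phi_L1. Qed.

Lemma phiP_L1 : cL1 mu (fun x => phi x * P x).
Proof. exact: cL1Mbd phi_L1 mP bP. Qed.

Lemma g_L1 : cL1 mu g. Proof. exact: PI_cL1 a0 phiP_L1. Qed.
Let bg x : cmod (g x) <= Nint mu (fun x => phi x * P x).
Proof. exact: PI_bd_L1 a0w phiP_L1. Qed.
Let gsq : square_integrable g. Proof. exact: bounded_L1_sq g_L1 bg. Qed.
Let mg : cmeasurable g. Proof. by case: gsq. Qed.

Let qg_L1 : cL1 mu (fun x => q x * g x). Proof. exact: sqM. Qed.
Let uphi_L1 : cL1 mu (fun x => phi x * u x).
Proof. exact: cL1Mbd phi_L1 mu_ bu. Qed.

Let qcu_sq : square_integrable (fun y => qc y * u y).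
Proof. exact: sqMbd hqc mu_ bu. Qed.

(** The product rule with exponents a and 0, applied to P and u, moves u out of the integral. *)
Lemma PI_qcu t : PI a (fun y => qc y * u y) t = u t * P t - g t.
Proof.
have [_ _] := PI_mul (okP_sq t a0 hqc) (okP_L1 t z0 phi_L1).
by rewrite addr0 mulrC => ->; rewrite addrK.
Qed.

Let psiE x : psi x = phi x * u x + -1 * (q x * g x).
Proof. by rewrite /= PI_qcu; ring. Qed.

Let psi_L1 : cL1 mu psi.
Proof.
have h : cL1 mu (fun x => phi x * u x + -1 * (q x * g x)).
  by apply: cL1D => //; exact: cL1Z.
by apply: cL1_ext h => x; rewrite psiE.
Qed.

Let mv : cmeasurable v. Proof. by apply: cmeas_PI; exact: cL1_measurable psi_L1. Qed.
Local Notation G := (PI 0 (fun x => q x * g x)).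

Let usq t : u t * u t = 2 * PI 0 (fun x => phi x * u x) t.
Proof.
have [_ _] := PI_mul (okP_L1 t z0 phi_L1) (okP_L1 t z0 phi_L1).
by rewrite addr0 => ->; ring.
Qed.

Let vE t : v t = u t * u t / 2 - G t.
Proof.
rewrite (PI_ext _ _ psiE) PID; [|exact: okP_L1|apply: okP_L1 => //; exact: cL1Z].
rewrite PIZ; last exact: okP_L1.
by rewrite usq; field.
Qed.

Local Notation W := (PI a (fun x => phi x * g x)).

Let phig_L1 : cL1 mu (fun x => phi x * g x). Proof. exact: cL1Mbd phi_L1 mg bg. Qed.
Let phiPu_L1 : cL1 mu (fun x => phi x * P x * u x).
Proof. exact: cL1Mbd phiP_L1 mu_ bu. Qed.

(** The same move for v. Two copies of W arise: one because psi P equals phi P u - phi g, the other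
    when u is in turn moved out of the integral of phi P u. *)
Lemma PI_qcv t : PI a (fun y => qc y * v y) t = P t * v t - g t * u t + 2 * W t.
Proof.
have [_ _ h1] := PI_mul (okP_sq t a0 hqc) (okP_L1 t z0 psi_L1).
have [_ _ h2] := PI_mul (okP_L1 t a0w phiP_L1) (okP_L1 t z0 phi_L1).
rewrite addr0 in h1; rewrite addr0 in h2.
have e x : psi x * P x = phi x * P x * u x + -1 * (phi x * g x).
  by rewrite psiE; ring.
rewrite (PI_ext a t e) PID in h1; [|exact: okP_L1|apply: okP_L1 => //; exact: cL1Z].
rewrite PIZ in h1; last exact: okP_L1.
have -> : PI a (fun y => qc y * v y) t = P t * v t
    - (PI a (fun x => phi x * P x * u x) t - W t) by rewrite h1; ring.
by rewrite h2; ring.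
Qed.

Local Notation J2 := (cint mu phi).
Local Notation J4 := (cint mu psi).
Local Notation J6 := (cint mu (fun x => q x * PI a (fun y => qc y * v y) x)).
Local Notation Ginf := (cint mu (fun x => q x * g x)).
Local Notation X := (cint mu (fun x => q x * W x)).

Let qgu_L1 : cL1 mu (fun x => q x * g x * u x). Proof. exact: cL1Mbd qg_L1 mu_ bu. Qed.
Let W_L1 : cL1 mu W. Proof. exact: PI_cL1. Qed.
Let qW_L1 : cL1 mu (fun x => q x * W x).
Proof.
apply: sqM => //; apply: (bounded_L1_sq W_L1) => x; exact: (PI_bd_L1 x a0w phig_L1).
Qed.

Let mG : cmeasurable G. Proof. by apply: cmeas_PI; exact: cL1_measurable qg_L1. Qed.
Let phiG_L1 : cL1 mu (fun x => phi x * G x).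
Proof. by apply: (cL1Mbd phi_L1 mG) => x; exact: (PI_bd_L1 x z0 qg_L1). Qed.
Let phiuu_L1 : cL1 mu (fun x => phi x * u x * u x). Proof. exact: cL1Mbd uphi_L1 mu_ bu. Qed.

Let J4E : J4 = J2 ^+ 2 / 2 - Ginf.
Proof.
have [_ _ h] := cint_mul_PI0 phi_L1 phi_L1.
transitivity (cint mu (fun x => 1 * (phi x * u x) + -1 * (q x * g x))).
  by apply: cint_ext => x; rewrite psiE mul1r.
by rewrite (cint_lin2 1 (-1) uphi_L1 qg_L1) expr2 h; field.
Qed.

(** The integrated form of (u^3)' = 3 u^2 u', where u' = phi; the product rule is used twice. *)
Let J23 : J2 ^+ 3 = 3 * cint mu (fun x => phi x * u x * u x).
Proof.
have h2i : cL1 mu (fun x => 2 * (phi x * u x)) by exact: cL1Z.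
have [_ _ h1] := cint_mul_PI0 phi_L1 phi_L1.
have [_ _ h2] := cint_mul_PI0 phi_L1 h2i.
have -> : J2 ^+ 3 = J2 * cint mu (fun x => 2 * (phi x * u x)).
  by rewrite (cintZ 2 uphi_L1) exprS expr2 h1; ring.
rewrite h2 (_ : 3 = 1 + 2); last by ring.
rewrite mulrDl mul1r; congr (_ + _).
  apply: cint_ext => x; rewrite PIZ; last exact: okP_L1.
  by rewrite -usq mulrA.
by rewrite -cintZ//; apply: cint_ext => x; ring.
Qed.

(** Together with [J4E] this makes all products of lower integrals cancel in J6 - J2 J4 + J2^3 / 3:
    the cubes have coefficients 1/6 - 1/2 + 1/3 and the terms J2 Ginf are opposite. Only 2 X
    survives. *)
Let J6E : J6 = J2 ^+ 3 / 6 - J2 * Ginf + 2 * X.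
Proof.
have [_ _ h] := cint_mul_PI0 phi_L1 qg_L1.
pose k1 x := 2^-1 * (phi x * u x * u x) + -1 * (phi x * G x).
pose k2 x := -1 * (q x * g x * u x) + 2 * (q x * W x).
have k1i : cL1 mu k1 by exact: cL1D (cL1Z _ phiuu_L1) (cL1Z _ phiG_L1).
have k2i : cL1 mu k2 by exact: cL1D (cL1Z _ qgu_L1) (cL1Z _ qW_L1).
transitivity (cint mu (fun x => 1 * k1 x + 1 * k2 x)).
  by apply: cint_ext => x; rewrite /k1 /k2 PI_qcv vE; field.
rewrite (cint_lin2 1 1 k1i k2i) (cint_lin2 _ _ phiuu_L1 phiG_L1).
rewrite (cint_lin2 _ _ qgu_L1 qW_L1).
by rewrite J23 h; field.
Qed.

Let phiPP_L1 : cL1 mu (fun x => phi x * P x * P x). Proof. exact: cL1Mbd phiP_L1 mP bP. Qed.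
Let qcg_L1 : cL1 mu (fun x => qc x * g x). Proof. exact: sqM. Qed.

Lemma theta_L1 : cL1 mu (fun x => q x * Q x).
Proof.
have J := joint_sqsq a0 hq hq.
have := joint_cL1Q J (fun t => okQ_sq t a0 hq).
by apply: cL1_ext => x; rewrite mulrC.
Qed.

(** Transposition turns the outer [PI a] into Q, so X is the integral of q Q times g P. The product
    rule writes g P as [PI (a + a)] of a sum, and a second transposition, with exponent 2a, meets q
    Q. There the factor 2 is absorbed because Q^2 is twice [QI (a + a)] of q Q. *)
Let XE : 2 * X = cint mu (fun x => q x * P x ^+ 3 * Q x ^+ 2) +
                 cint mu (fun x => qc x * Q x ^+ 2 * g x).
Proof.
have e1 : X = cint mu (fun x => Q x * (phi x * g x)).
  apply: PQ_dual; [exact: joint_sqL1|by move=> t; exact: okP_L1|].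
  by move=> t; exact: okQ_sq.
have e2 x : g x * P x = PI (a + a) (fun y => phi y * P y * P y) x +
    PI (a + a) (fun y => qc y * g y) x.
  by have [_ _] := PI_mul (okP_L1 x a0w phiP_L1) (okP_sq x a0 hqc).
have e3 x : Q x * Q x = 2 * QI (a + a) (fun y => q y * Q y) x.
  have [_ _ ->] := QI_mul x (fun t => okQ_sq t a0 hq) (fun t => okQ_sq t a0 hq).
  by ring.
have aa : 0 <= Im (a + a) by rewrite ImD addr_ge0.
have D k : cL1 mu k -> cL1 mu (fun x => q x * Q x * PI (a + a) k x) /\
    2 * cint mu (fun x => q x * Q x * PI (a + a) k x) = cint mu (fun x => Q x * Q x * k x).
  move=> ki; have J := joint_L1L1 aa theta_L1 ki.
  have i := joint_cL1P J (fun t => okP_L1 t aa ki).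
  split => //; rewrite (PQ_dual J (fun t => okP_L1 t aa ki) (fun t => okQ_L1 t aa theta_L1)).
  rewrite -cintZ; last exact: (joint_cL1Q J (fun t => okQ_L1 t aa theta_L1)).
  by apply: cint_ext => x; rewrite e3 mulrA.
have [i1 d1] := D _ phiPP_L1; have [i2 d2] := D _ qcg_L1.
transitivity (2 * cint mu (fun x => q x * Q x * PI (a + a) (fun y => phi y * P y * P y) x) +
   2 * cint mu (fun x => q x * Q x * PI (a + a) (fun y => qc y * g y) x)).
  rewrite -mulrDr -cintD// e1; congr (_ * _); apply: cint_ext => x.
  by rewrite -mulrDr -e2; ring.
by rewrite d1 d2; congr (_ + _); apply: cint_ext => x; ring.
Qed.

Lemma position_identity : J6 - J2 * J4 + J2 ^+ 3 / 3 =
  cint mu (fun x => q x * P x ^+ 3 * Q x ^+ 2) +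
  cint mu (fun x => qc x * Q x ^+ 2 * g x).
Proof. by rewrite -XE J6E J4E; field. Qed.

End Position.

End Kernel.

Section ProductMore.
Context d (T : measurableType d) (R : realType).
Local Notation mu := (@lebesgue_measure R).
Variable m : {sigma_finite_measure set T -> \bar R}.

Lemma cL1_swap d2 (T2 : measurableType d2) (m2 : {sigma_finite_measure set T2 -> \bar R})
    (F : T * T2 -> R[i]) : cL1 (pmeas m m2) F ->
  cL1 (pmeas m2 m) (fun z => F (z.2, z.1)).
Proof.
move=> [mF Fi]; have msw : measurable_fun setT (fun z : T2 * T => (z.2, z.1)).
  exact: measurable_swap.
have mF' : cmeasurable (fun z : T2 * T => F (z.2, z.1)) by exact: (cmeas_comp mF msw).
split => //.
have mn : measurable_fun setT (EFin \o (fun z => cmod (F z))).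
  by apply/measurable_EFinP; exact: measurable_cmod.
have mn' : measurable_fun setT (EFin \o (fun z : T2 * T => cmod (F (z.2, z.1)))).
  by apply/measurable_EFinP; exact: measurable_cmod mF'.
have e1 : (\int[pmeas m m2]_x (cmod (F x))%:E =
    \int[m2]_y \int[m]_x (cmod (F (x, y)))%:E)%E.
  by apply: (fubini_tonelli2 _ mn) => x /=; rewrite lee_fin cmod_ge0.
have e2 : (\int[pmeas m2 m]_x (cmod (F (x.2, x.1)))%:E =
    \int[m2]_y \int[m]_x (cmod (F (x, y)))%:E)%E.
  by apply: (fubini_tonelli1 _ mn') => x /=; rewrite lee_fin cmod_ge0.
by rewrite e2 -e1.
Qed.

Lemma Nint_fubini1 d2 (T2 : measurableType d2)
    (m2 : {sigma_finite_measure set T2 -> \bar R}) (F : T * T2 -> R[i]) :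
  cL1 (pmeas m m2) F ->
  Nint (pmeas m m2) F = \int[m]_x Nint m2 (fun y => F (x, y)).
Proof.
move=> /cL1_normal /Rintegral_fubini1[_ h2].
by rewrite NintE h2; under eq_Rintegral do rewrite -NintE.
Qed.

Lemma Nint_tensor d2 (T2 : measurableType d2)
    (m2 : {sigma_finite_measure set T2 -> \bar R}) (f : T -> R[i]) (g : T2 -> R[i]) :
  cL1 m f -> cL1 m2 g ->
  Nint (pmeas m m2) (fun z => f z.1 * g z.2) = Nint m f * Nint m2 g.
Proof.
move=> fi gi; rewrite (Nint_fubini2 (cL1_tensor fi gi)).2.
have H := RintegralZl (Nint m f) measurableT (cL1_normal gi).
rewrite (NintE m2) -H; apply: eq_Rintegral => y _.
rewrite mulrC -NintZ// !NintE; apply: eq_Rintegral => x _.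
by rewrite /= mulrC.
Qed.

End ProductMore.

(** * Ordered multiple integrals, extended by one pair of variables at a time *)

Section IteratedIntegrals.
Context d (T : measurableType d) (R : realType).
Local Notation mu := (@lebesgue_measure R).
Variable m : {sigma_finite_measure set T -> \bar R}.
Variables (q : R -> R[i]) (a : R[i]).
Hypotheses (hq : square_integrable q) (a0 : 0 < Im a).
Local Notation qc := (fun x => conjc (q x)).
Variables (K : T -> R[i]) (l : T -> R).
Hypotheses (Ki : cL1 m K) (ml : measurable_fun setT l).

(* Appends a pair x < y, with x above the last point [l] of a chain, to an
   iterated integral with kernel [K]. *)
Definition step_kernel (z : T * R * R) : R[i] :=
  K z.1.1 * (l z.1.1 < z.1.2)%R%:R *
  (q z.2 * (Kexp a (z.2 - z.1.2) * qc z.1.2)).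

(** The part of the integral carried by chains that end below t. For chains of one and of two pairs
    it becomes the function u, respectively v, of the algebraic identity. *)
Definition step_fun (t : R) : R[i] := cint m (fun z => (l z < t)%R%:R * K z).

Let mK : cmeasurable K. Proof. by case: Ki. Qed.
Let hqc : square_integrable qc. Proof. exact: sq_conj. Qed.

Let ml12 : measurable_fun setT (fun z : T * R => (l z.1 < z.2)%R).
Proof. by apply: measurable_fun_ltr => //; exact: measurableT_comp. Qed.

Let sec_L1 y : cL1 (pmeas m mu) (fun z : T * R => step_kernel (z, y)).
Proof.
have h := cL1_bool (cL1_tensor Ki (cL1Z (q y) (okP_sq y a0 hqc))) ml12.
by apply: cL1_ext h => z; rewrite /step_kernel /=; ring.
Qed.

(** Dropping the order constraint between the old chain and the new pair leaves a tensor product. *)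
Let sec_le y : Nint (pmeas m mu) (fun z : T * R => step_kernel (z, y)) <=
  Nint m K * Nint mu (fun x => q y * (Kexp a (y - x) * qc x)).
Proof.
have i2 := cL1Z (q y) (okP_sq y a0 hqc).
rewrite -(Nint_tensor Ki i2); apply: le_Nint; [exact: sec_L1|exact: (cL1_tensor Ki i2)|].
move=> z; rewrite /step_kernel /= mulrAC [leLHS]cmodM cmod_bool ler_piMr ?cmod_ge0//.
by case: (_ < _).
Qed.

Let Kjoint : cL1 (pmeas mu mu) (fun z : R * R => q z.2 * (Kexp a (z.2 - z.1) * qc z.1)).
Proof. exact: cL1_swap (joint_sqsq a0 hq hqc). Qed.

Lemma step_kernel_cmeas : cmeasurable step_kernel.
Proof.
apply: cmeasM; first apply: cmeasM.
- by apply: (cmeas_comp mK); exact: measurableT_comp.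
- apply: cmeas_bool; exact: (measurableT_comp ml12).
- have m21 : measurable_fun setT (fun z : T * R * R => (z.1.2, z.2)).
    by apply/measurable_fun_pair => //; exact: measurableT_comp.
  exact: (cmeas_comp (cL1_measurable Kjoint) m21).
Qed.

Lemma step_kernel_L1 : cL1 (pmeas (pmeas m mu) mu) step_kernel.
Proof.
apply: (@tonelli2 _ _ _ _ _ (pmeas m mu) mu _
  (fun y => Nint m K * Nint mu (fun x => q y * (Kexp a (y - x) * qc x)))).
- exact: step_kernel_cmeas.
- exact: sec_L1.
- have [h _] := Nint_fubini2 Kjoint.
  exact: eq_integrable (integrableZl measurableT (Nint m K) h).
- exact: sec_le.
Qed.

Let step_fun_meas : cmeasurable step_fun.
Proof.
have h : cmeasurable (fun z : T * R => (l z.1 < z.2)%R%:R * K z.1).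
  by apply: cmeasM; [exact: cmeas_bool|apply: (cmeas_comp mK)].
exact: (cmeas_cint2 m h).
Qed.

Let sec_int y : cint (pmeas m mu) (fun z : T * R => step_kernel (z, y)) =
  q y * PI a (fun x => qc x * step_fun x) y.
Proof.
rewrite (fubini2 (sec_L1 y)).2 /PI -cintZ; last first.
  have bs x : cmod (step_fun x) <= Nint m K.
    apply: cmod_cint_le; first by apply: cL1_bool => //; exact: measurable_fun_ltr.
    apply: le_Nint => //; first by apply: cL1_bool => //; exact: measurable_fun_ltr.
    by move=> z; rewrite [leLHS]cmodM cmod_bool ler_piMl ?cmod_ge0//; case: (_ < _).
  by apply: okP_sq => //; exact: sqMbd hqc step_fun_meas bs.
apply: cint_ext => x; rewrite /step_fun.
have i1 : cL1 m (fun z => (l z < x)%R%:R * K z).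
  by apply: cL1_bool => //; exact: measurable_fun_ltr.
rewrite mulrA -[_ * cint _ _]mulrC mulrA mulrAC mulrC -!mulrA -(cintZr _ i1).
apply: cint_ext => z; rewrite /step_kernel /=; ring.
Qed.

Lemma step_total : cint (pmeas (pmeas m mu) mu) step_kernel =
  cint mu (fun y => q y * PI a (fun x => qc x * step_fun x) y).
Proof.
by rewrite (fubini2 step_kernel_L1).2; apply: cint_ext => y; exact: sec_int.
Qed.

(** The left side is the [step_fun] of the extended chain, so the construction can be iterated. *)
Lemma step_partial t :
  cint (pmeas (pmeas m mu) mu) (fun z => (z.2 < t)%R%:R * step_kernel z) =
  PI 0 (fun y => q y * PI a (fun x => qc x * step_fun x) y) t.
Proof.
have mt : measurable_fun setT (fun z : T * R * R => (z.2 < t)%R).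
  by apply: measurable_fun_ltr => //; exact: measurable_cst.
rewrite (fubini2 (cL1_bool step_kernel_L1 mt)).2 PI0E; apply: cint_ext => y /=.
by rewrite -sec_int -(cintZ _ (sec_L1 y)).
Qed.

End IteratedIntegrals.

(** Integrals see a measure only as a set function. This transports them from the product measures
    of the definitions to the copies [pmeas], which carry different structures. *)
Lemma eq_cintegral d (T : measurableType d) (R : realType)
    (m m' : {measure set T -> \bar R}) D (f : T -> R[i]) :
  (m : set T -> \bar R) = (m' : set T -> \bar R) ->
  cintegral m D f = cintegral m' D f.
Proof. by move=> e; rewrite /cintegral /Rintegral e. Qed.

Lemma prod_pmeas d1 d2 (T1 : measurableType d1) (T2 : measurableType d2)
    (R : realType) (m : set T1 -> \bar R)
    (m1 : {sigma_finite_measure set T1 -> \bar R})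
    (m2 : {sigma_finite_measure set T2 -> \bar R}) :
  m = m1 -> (m \x m2)%E = pmeas m1 m2.
Proof. by move=> ->. Qed.

(** * From the definition of b_6 to its expression through P and Q *)

Section BSix.
Variable R : realType.
Local Notation mu := (@lebesgue_measure R).
Variables (q : R -> R[i]) (lam : R[i]).
Hypotheses (hq : square_integrable q) (hlam : 0 < Im (lam ^+ 2)).
Local Notation a := (2 * lam ^+ 2).
Local Notation qc := (fun x => conjc (q x)).
Local Notation P := (PI a qc).
Local Notation Q := (QI a q).

Lemma Im_a : 0 < Im a.
Proof. by rewrite mulrC -(rmorph_nat (real_complex R)) ImMr mulr_gt0. Qed.

Let hqc : square_integrable qc. Proof. exact: sq_conj. Qed.

Let K2 (z : R * R) : R[i] := q z.2 * (Kexp a (z.2 - z.1) * qc z.1).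

Let K2i : cL1 (pmeas mu mu) K2.
Proof. exact: cL1_swap (joint_sqsq Im_a hq hqc). Qed.

Let l2 (z : R * R) : R := z.2.
Let ml2 : measurable_fun setT l2. Proof. exact: measurable_snd. Qed.

Let sec2 y : cint mu (fun x => K2 (x, y)) = q y * P y.
Proof. by rewrite /K2 /= (cintZ (q y) (okP_sq y Im_a hqc)). Qed.

Let J2E : cint (pmeas mu mu) K2 = cint mu (fun y => q y * P y).
Proof. by rewrite (fubini2 K2i).2; apply: cint_ext => y; exact: sec2. Qed.

Let uE t : step_fun (pmeas mu mu) K2 l2 t = PI 0 (fun y => q y * P y) t.
Proof.
have mt : measurable_fun setT (fun z : R * R => (z.2 < t)%R).
  by apply: measurable_fun_ltr => //; exact: measurable_cst.
rewrite /step_fun (fubini2 (cL1_bool K2i mt)).2 PI0E; apply: cint_ext => y /=.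
rewrite -sec2 -cintZ//=.
by apply: cL1_ext (cL1Z (q y) (okP_sq y Im_a hqc)).
Qed.

Local Notation K4 := (step_kernel q a K2 l2).
Let l4 (z : R * R * R * R) : R := z.2.
Let ml4 : measurable_fun setT l4. Proof. exact: measurable_snd. Qed.
Let K4i : cL1 (pmeas (pmeas (pmeas mu mu) mu) mu) K4.
Proof. exact: (step_kernel_L1 hq Im_a K2i ml2). Qed.

Local Notation u := (PI 0 (fun y => q y * P y)).
Local Notation v := (PI 0 (fun x => q x * PI a (fun y => qc y * u y) x)).

Let uE' : step_fun (pmeas mu mu) K2 l2 = u.
Proof. by apply/funext => t; exact: uE. Qed.

Let J4E : cint (pmeas (pmeas (pmeas mu mu) mu) mu) K4 =
  cint mu (fun x => q x * PI a (fun y => qc y * u y) x).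
Proof. by rewrite (step_total hq Im_a K2i ml2) uE'. Qed.

Let vE : step_fun (pmeas (pmeas (pmeas mu mu) mu) mu) K4 l4 = v.
Proof.
apply/funext => t; have := step_partial hq Im_a K2i ml2 t.
by rewrite uE'.
Qed.

Local Notation K6 := (step_kernel q a K4 l4).

Let J6E : cint (pmeas (pmeas (pmeas (pmeas (pmeas mu mu) mu) mu) mu) mu) K6 =
  cint mu (fun x => q x * PI a (fun y => qc y * v y) x).
Proof. by rewrite (step_total hq Im_a K4i ml4) vE. Qed.

Let pairE x y : (x < y)%R%:R * pair_kernel q lam x y =
  q y * (Kexp a (y - x) * conjc (q x)).
Proof.
rewrite KexpE subr_gt0 /pair_kernel (_ : 2 * iC * lam ^+ 2 = iC * a); first by ring.
by ring.
Qed.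

Lemma s2E : s2 q lam = - lam ^+ 2 * cint mu (fun y => q y * P y).
Proof.
rewrite /s2 expr1 mulN1r; congr (_ * _); rewrite -J2E.
transitivity (cintegral (pmeas mu mu)
  [set z : R * R | let: (x1, y1) := z in x1 < y1]
  (fun z => let: (x1, y1) := z in pair_kernel q lam x1 y1)) => //.
rewrite cintegral_mkcond; apply: cint_ext => -[x1 y1].
rewrite /K2 /= -pairE; set b := (_ \in _); have -> // : b = (x1 < y1).
by apply/idP/idP => [/set_mem|h]; rewrite ?inE.
Qed.

Lemma s4E : s4 q lam = lam ^+ 4 * cint mu (fun x => q x * PI a (fun y => qc y * u y) x).
Proof.
rewrite /s4 sqrrN expr1n mul1r; congr (_ * _); rewrite -J4E.
rewrite (@eq_cintegral _ _ _ _ (pmeas (pmeas (pmeas mu mu) mu) mu)); last by do 2 apply: prod_pmeas.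
rewrite cintegral_mkcond; apply: cint_ext => -[[[x1 y1] x2] y2].
rewrite /step_kernel /K2 /l2 /= -!pairE.
set b := (_ \in _); have -> : b = [&& x1 < y1, y1 < x2 & x2 < y2].
  by apply/idP/idP => [/set_mem [-> -> ->]|/and3P[]]; rewrite ?inE.
by case: (x1 < y1); case: (y1 < x2); case: (x2 < y2); rewrite ?mul1r ?mul0r ?mulr0 ?mulr1 ?mul0r.
Qed.

Lemma s6E : s6 q lam = - lam ^+ 6 * cint mu (fun x => q x * PI a (fun y => qc y * v y) x).
Proof.
rewrite /s6 (_ : (-1) ^+ 3 = -1); last by ring.
rewrite mulN1r; congr (_ * _); rewrite -J6E.
rewrite (@eq_cintegral _ _ _ _ (pmeas (pmeas (pmeas (pmeas (pmeas mu mu) mu) mu) mu) mu)); last by do 4 apply: prod_pmeas.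
rewrite cintegral_mkcond; apply: cint_ext => -[[[[[x1 y1] x2] y2] x3] y3].
rewrite /step_kernel /K2 /l2 /l4 /= -!pairE.
set b := (_ \in _).
have -> : b = [&& x1 < y1, y1 < x2, x2 < y2, y2 < x3 & x3 < y3].
  by apply/idP/idP => [/set_mem [-> -> -> -> ->]|/and5P[]]; rewrite ?inE.
by case: (x1 < y1); case: (y1 < x2); case: (x2 < y2); case: (y2 < x3); case: (x3 < y3);
  rewrite ?mul1r ?mul0r ?mulr0 ?mulr1 ?mul0r.
Qed.

Lemma b6_position : b6 q lam = - lam ^+ 6 *
  (cint mu (fun x => q x * P x ^+ 3 * Q x ^+ 2) +
   cint mu (fun x => qc x * Q x ^+ 2 * PI a (fun x => q x * P x * P x) x)).
Proof.
by rewrite -(position_identity hq Im_a) /b6 s2E s4E s6E; field.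
Qed.

End BSix.

(** * Differentiation of complex-valued functions *)

Definition cder (R : realType) (F f : R -> R[i]) : Prop :=
  (forall x : R, is_derive x (1 : R) (fun t : R => Re (F t)) (Re (f x))) /\
  (forall x : R, is_derive x (1 : R) (fun t : R => Im (F t)) (Im (f x))).

Definition ccont (R : realType) (f : R -> R[i]) : Prop :=
  continuous (fun t : R => Re (f t)) /\ continuous (fun t : R => Im (f t)).

Section Calculus.
Variable R : realType.
Local Notation mu := (@lebesgue_measure R).
Implicit Types F G f g : R -> R[i].

Lemma cder_ccont F f : cder F f -> ccont F.
Proof.
move=> [h1 h2]; split => x.
  apply: differentiable_continuous; apply/derivable1_diffP; exact: (@ex_derive _ _ _ _ _ _ _ (h1 x)).
apply: differentiable_continuous; apply/derivable1_diffP; exact: (@ex_derive _ _ _ _ _ _ _ (h2 x)).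
Qed.

Lemma ccont_meas f : ccont f -> cmeasurable f.
Proof. by move=> [h1 h2]; split; exact: continuous_measurable_fun. Qed.

Lemma cder_eq F f g : cder F f -> (forall x, f x = g x) -> cder F g.
Proof. by move=> h /funext <-. Qed.

Lemma cder_cst c : cder (fun _ : R => c) (fun _ => 0).
Proof. by split => x; exact: is_derive_cst. Qed.

Lemma cderD F f G g : cder F f -> cder G g ->
  cder (fun x => F x + G x) (fun x => f x + g x).
Proof.
move=> [h1 h2] [k1 k2]; split => x; under eq_fun do rewrite ?ReD ?ImD; rewrite ?ReD ?ImD.
  exact: is_deriveD.
exact: is_deriveD.
Qed.

Lemma cderM F f G g : cder F f -> cder G g ->
  cder (fun x => F x * G x) (fun x => f x * G x + F x * g x).
Proof.
move=> [h1 h2] [k1 k2]; split => x.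
  under eq_fun do rewrite ReM.
  apply: (is_derive_eq (is_deriveB (is_deriveM (h1 x) (k1 x)) (is_deriveM (h2 x) (k2 x)))).
  by rewrite ReD !ReM /GRing.scale/=; ring.
under eq_fun do rewrite ImM.
apply: (is_derive_eq (is_deriveD (is_deriveM (h1 x) (k2 x)) (is_deriveM (h2 x) (k1 x)))).
by rewrite ImD !ImM /GRing.scale/=; ring.
Qed.

Lemma cderZ c F f : cder F f -> cder (fun x => c * F x) (fun x => c * f x).
Proof.
move=> h; apply: (cder_eq (cderM (cder_cst c) h)) => x.
by rewrite mul0r add0r.
Qed.

Lemma cder_conj F f : cder F f -> cder (fun x => conjc (F x)) (fun x => conjc (f x)).
Proof.
move=> [h1 h2]; split => x.
  by under eq_fun do rewrite Re_conjc; rewrite Re_conjc.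
by under eq_fun do rewrite Im_conjc; rewrite Im_conjc; exact: is_deriveN.
Qed.

Lemma cder_cexp c d : cder (fun x : R => cexp (c * x%:C + d))
  (fun x => c * cexp (c * x%:C + d)).
Proof.
have e1 (x : R) : Re (c * x%:C + d) = Re c * x + Re d by rewrite ReD ReMr.
have e2 (x : R) : Im (c * x%:C + d) = Im c * x + Im d by rewrite ImD ImMr.
split => x.
  under eq_fun do rewrite Re_cexp e1 e2.
  rewrite [Re (c * _)]ReM Re_cexp Im_cexp e1 e2.
  by apply: is_derive_eq; rewrite /GRing.scale/=; ring.
under eq_fun do rewrite Im_cexp e1 e2.
rewrite [Im (c * _)]ImM Re_cexp Im_cexp e1 e2.
by apply: is_derive_eq; rewrite /GRing.scale/=; ring.
Qed.

Lemma real_FTC (F f : R -> R) (s t : R) : s < t ->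
  (forall x : R, is_derive x (1 : R) F (f x)) -> continuous f ->
  \int[mu]_x ((s < x < t)%R%:R * f x) = F t - F s.
Proof.
move=> st dF cf.
have cF : continuous F.
  move=> x; apply: differentiable_continuous; apply/derivable1_diffP.
  exact: (@ex_derive _ _ _ _ _ _ _ (dF x)).
have mf : measurable_fun setT f by exact: continuous_measurable_fun.
have : (\int[mu]_(x in `[s, t]) (f x)%:E = (F t)%:E - (F s)%:E)%E.
  apply: (@continuous_FTC2 _ f F) => //.
  - exact: continuous_subspaceT.
  - split.
    + by move=> x _; exact: (@ex_derive _ _ _ _ _ _ _ (dF x)).
    + exact: cvg_at_right_filter (cF s).
    + exact: cvg_at_left_filter (cF t).
  - by move=> x _; rewrite derive1E; exact: (@derive_val _ _ _ _ _ _ _ (dF x)).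
rewrite -integral_itv_bndo_bndc; last by apply/measurable_EFinP; exact: measurable_funTS.
rewrite -integral_itv_obnd_cbnd; last by apply/measurable_EFinP; exact: measurable_funTS.
move=> /(congr1 fine); rewrite /= => <-.
rewrite -[RHS]/(Rintegral mu `]s, t[ f) Rintegral_mkcond; congr (Rintegral mu _ _).
apply/funext => x; rewrite /patch.
case: ifP => [/set_mem|/negbT /negP h]; rewrite /= ?in_itv/=; first by move=> ->; rewrite mul1r.
suff -> : (s < x < t) = false by rewrite mul0r.
by apply/negP => h2; apply: h; rewrite inE/= in_itv/=.
Qed.

Lemma ctends_eventually (u : nat -> R[i]) l (N : nat) :
  (forall n, (N <= n)%N -> u n = l) -> ctends u l.
Proof.
move=> h; apply/ctends0P => [n|e e0]; first exact: cmod_ge0.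
by exists N => // n /= Nn; rewrite h// subrr cmod0 ltW.
Qed.

Lemma ctends_near (u v : nat -> R[i]) l (N : nat) :
  (forall n, (N <= n)%N -> u n = v n) -> ctends u l -> ctends v l.
Proof.
move=> h /ctends0P ul; apply/ctends0P => [n|e e0]; first exact: cmod_ge0.
have un n : 0 <= cmod (u n - l) by exact: cmod_ge0.
have [M _ hM] := ul un e e0; exists (maxn N M) => // n /=.
rewrite geq_max => /andP[Nn Mn]; rewrite -h//; exact: hM.
Qed.

Lemma nat_above (x : R) : exists N : nat, forall n, (N <= n)%N -> x < n%:R.
Proof.
exists (Num.Def.archi_bound `|x|) => n Nn.
apply: le_lt_trans (ler_norm x) _.
by apply: (lt_le_trans (archi_boundP (normr_ge0 x))); rewrite ler_nat.
Qed.

Lemma measurable_itvoo (s t : R) : measurable_fun setT (fun x : R => (s < x < t)).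
Proof.
by apply: measurable_and; [exact: measurable_ltr|exact: measurable_ltl].
Qed.

Lemma cint_FTC F f (s t : R) : s < t -> cder F f -> ccont f ->
  cint mu (fun x => (s < x < t)%R%:R * f x) = F t - F s.
Proof.
move=> st [h1 h2] [c1 c2].
have R1 (b : bool) (z : R[i]) : Re (b%:R * z) = b%:R * Re z.
  by case: b; rewrite ?mul1r ?mul0r.
have I1 (b : bool) (z : R[i]) : Im (b%:R * z) = b%:R * Im z.
  by case: b; rewrite ?mul1r ?mul0r.
apply: complex_eqP.
  rewrite Re_cint ReD ReN -(real_FTC st h1 c1).
  by congr (Rintegral mu _ _); apply/funext => x; rewrite R1.
rewrite Im_cint ImD ImN -(real_FTC st h2 c2).
by congr (Rintegral mu _ _); apply/funext => x; rewrite I1.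
Qed.

(** Once -n < t, the integral over (-n, t) is F t - F (-n); dominated convergence lets n grow. A
    limit of F along the integers is therefore enough. *)
Lemma cint_FTC_half F f (t : R) : cder F f -> ccont f ->
  cL1 mu (fun x => (x < t)%R%:R * f x) -> ctends (fun n => F (- n%:R)) 0 ->
  cint mu (fun x => (x < t)%R%:R * f x) = F t.
Proof.
move=> dF cf fi F0.
pose g (n : nat) (x : R) : R[i] := (- n%:R < x < t)%R%:R * f x.
have mf := ccont_meas cf.
have [_ h] : cL1 mu (fun x => (x < t)%R%:R * f x) /\
    ctends (fun n => cint mu (g n)) (cint mu (fun x => (x < t)%R%:R * f x)).
  apply: (cDCT_everywhere _ _ _ (cL1_normal fi)).
  - by move=> n; apply: cmeasM => //; apply: cmeas_bool; exact: measurable_itvoo.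
  - by apply: cmeasM => //; apply: cmeas_bool; exact: measurable_ltl.
  - move=> x; have [N hN] := nat_above (- x).
    by apply: (ctends_eventually (N := N)) => n /hN xn; rewrite /g ltrNl xn.
  - move=> n x; rewrite /g [leLHS]cmodM [leRHS]cmodM ler_wpM2r ?cmod_ge0// !cmod_bool.
    by rewrite ler_nat; case: (_ < x); case: (x < t).
have [N hN] := nat_above (- t).
apply: (ctends_unique h); apply: (ctends_near (N := N) (u := fun n => F t + -1 * F (- n%:R))).
  move=> n /hN tn; rewrite /g (cint_FTC (F := F))//; last by rewrite ltrNl.
  by rewrite mulN1r.
rewrite -[X in ctends _ X]addr0 -[X in _ + X](mulr0 (-1)).
by apply: ctendsD; [exact: ctends_cst|exact: ctendsZ].
Qed.

Lemma cint_FTC_full F f : cder F f -> ccont f -> cL1 mu f ->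
  ctends (fun n => F (- n%:R)) 0 -> ctends (fun n => F n%:R) 0 -> cint mu f = 0.
Proof.
move=> dF cf fi F0 F1.
pose g (n : nat) (x : R) : R[i] := (- n%:R < x < n%:R)%R%:R * f x.
have mf := ccont_meas cf.
have [_ h] : cL1 mu f /\ ctends (fun n => cint mu (g n)) (cint mu f).
  apply: (@cDCT_everywhere _ _ _ mu g f _ _ mf _ (cL1_normal fi)).
  - by move=> n; apply: cmeasM => //; apply: cmeas_bool; exact: measurable_itvoo.
  - move=> x; have [N hN] := nat_above (- x); have [M hM] := nat_above x.
    apply: (ctends_eventually (N := maxn N M)) => n; rewrite geq_max => /andP[/hN xn /hM xm].
    by rewrite /g ltrNl xn xm mul1r.
  - move=> n x; rewrite /g [leLHS]cmodM ler_piMl ?cmod_ge0// cmod_bool.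
    by case: (_ && _).
apply: (ctends_unique h).
(* From n = 1 on the interval (-n, n) is nonempty, as the theorem on bounded intervals requires. *)
apply: (ctends_near (N := 1) (u := fun n => F n%:R + -1 * F (- n%:R))).
  move=> n n0; rewrite /g (cint_FTC (F := F)) ?mulN1r//.
  by rewrite (@lt_trans _ _ 0)// ?oppr_lt0 ltr0n.
rewrite -[X in ctends _ X]addr0 -[X in _ + X](mulr0 (-1)).
by apply: ctendsD => //; exact: ctendsZ.
Qed.

Lemma cvg_expRN (k : R) : 0 < k -> (fun n : nat => expR (- (k * n%:R))) @ \oo --> (0 : R).
Proof.
move=> k0; have -> : (fun n : nat => expR (- (k * n%:R))) = (fun n => expR (- k) ^+ n).
  by apply/funext => n; rewrite -expRM_natl; congr expR; ring.
by apply: cvg_expr; rewrite ger0_norm ?expR_ge0// expR_lt1 oppr_lt0.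
Qed.

(** After a reflection the integral runs over x < 0, where the integrand has an exponential
    primitive that decays at minus infinity. *)
Lemma cint_Kexp (a : R[i]) : 0 < Im a -> cint mu (Kexp a) = iC / a.
Proof.
move=> a0; pose c : R[i] := - (iC * a).
have aN0 : a != 0 by apply: contraTneq a0 => ->; rewrite ltxx.
have c0 : c != 0 by rewrite oppr_eq0 mulf_neq0// iC_neq0.
have dF := cderZ c^-1 (cder_cexp c 0).
have E x : Kexp a (- x) = (x < 0)%R%:R * (c^-1 * (c * cexp (c * x%:C + 0))).
  rewrite KexpE oppr_gt0 mulKf// addr0; congr (_ * cexp _).
  by rewrite rmorphN /c; ring.
rewrite -(cint_opp (cL1_Kexp a0)).
transitivity (cint mu (fun x => (x < 0)%R%:R * (c^-1 * (c * cexp (c * x%:C + 0))))).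
  by apply: cint_ext => x; exact: E.
rewrite (cint_FTC_half dF).
- rewrite mulr0 addr0 cexp0 mulr1 /c invrN invfM -[iC^-1]mulr1.
  have -> : iC^-1 = - iC :> R[i].
    by apply: (mulfI (iC_neq0 R)); rewrite mulfV ?iC_neq0// mulrN iC2 opprK.
  by rewrite mulr1 mulNr opprK.
- have d2 := cderZ c^-1 (cderZ c (cder_cexp c 0)).
  exact: cder_ccont d2.
- by apply: cL1_ext (cL1_opp (cL1_Kexp a0)) => x; exact: E.
- apply: (ctends_le (v := fun n => cmod c^-1 * expR (- (Im a * n%:R)))) => [n|].
    rewrite subr0 cmodM cmod_cexp ler_wpM2l ?cmod_ge0//.
    by rewrite ReD ReMr /c ReN ReMi opprK/= addr0 mulrN.
  rewrite -[X in _ --> X](mulr0 (cmod c^-1)); apply: cvgM; first exact: cvg_cst.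
  exact: cvg_expRN.
Qed.

End Calculus.

(** * Fourier transform of the half-line kernels *)

HB.lock Definition eC (R : realType) (t : R) : R[i] := cexp (iC * t%:C).

HB.lock Definition ft (R : realType) (f : R -> R[i]) (xi : R) : R[i] :=
  (Num.sqrt (2 * pi))^-1%:C *
  cint (@lebesgue_measure R) (fun x => f x * eC (- (x * xi))).

Section Poisson.
Variable R : realType.
Local Notation mu := (@lebesgue_measure R).
Implicit Types (f g : R -> R[i]) (e s t xi : R).

Lemma eCE t : eC t = cexp (iC * t%:C). Proof. by rewrite eC.unlock. Qed.

Lemma ftE f xi : ft f xi =
  (Num.sqrt (2 * pi))^-1%:C * cint mu (fun x => f x * eC (- (x * xi))).
Proof. by rewrite ft.unlock. Qed.

Lemma eCD s t : eC (s + t) = eC s * eC t.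
Proof. by rewrite !eCE -cexpD rmorphD mulrDr. Qed.

Lemma cmod_eC t : cmod (eC t) = 1.
Proof. by rewrite eCE cmod_cexp ReMi oppr0 expR0. Qed.

Lemma eC0 : eC (0 : R) = 1. Proof. by rewrite eCE mulr0 cexp0. Qed.

Lemma conj_eC t : conjc (eC t) = eC (- t).
Proof. by rewrite !eCE conj_cexp conjcM conj_iC conjc_real rmorphN/= mulNr mulrN. Qed.

Lemma cmeas_eC d (T : measurableType d) (h : T -> R) : measurable_fun setT h ->
  cmeasurable (fun x => eC (h x)).
Proof.
move=> mh; have -> : (fun x => eC (h x)) = (fun x => cexp (iC * (h x)%:C)).
  by apply/funext => x; rewrite eCE.
by apply: cmeas_cexp; apply: cmeasM; [exact: cmeas_cst|exact: cmeas_real].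
Qed.

Lemma measurable_Nmulr (c : R) : measurable_fun setT (fun x : R => - (x * c)).
Proof.
apply: measurableT_comp => //; apply: measurable_funM => //; exact: measurable_cst.
Qed.

Lemma cL1_eC f (h : R -> R) : cL1 mu f -> measurable_fun setT h ->
  cL1 mu (fun x => f x * eC (h x)).
Proof.
move=> fi mh; apply: (@cL1Mbd _ _ _ mu _ _ 1 fi) => [|x]; last by rewrite cmod_eC.
exact: cmeas_eC.
Qed.

Lemma cL1_ae d (T : measurableType d) (m : {measure set T -> \bar R})
    (f g : T -> R[i]) : cL1 m f -> cmeasurable g ->
  {ae m, forall x, f x = g x} -> cL1 m g.
Proof.
move=> [mf fi] mg fg; split=> //; move: fi; congr (_ < _)%E.
apply: ae_eq_integral => //.
- by apply/measurable_EFinP; exact: measurable_cmod.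
- by apply/measurable_EFinP; exact: measurable_cmod.
- by move: fg; apply: filterS => x -> _.
Qed.

Lemma ae_neq (y : R) (A : R -> Prop) : (forall x, x != y -> A x) ->
  {ae mu, forall x, A x}.
Proof.
move=> h; exists [set y]; split => //; first exact: lebesgue_measure_set1.
by move=> x /= nA; apply: contrapT => /eqP xy; apply: nA; exact: h.
Qed.

(* The regularising factor e^{-e|eta|}; its Fourier integral is the Poisson
   kernel [pk e]. [wK e s] writes [wP e eta * e^{i eta s}] with two half-line
   exponentials (they differ at [eta = 0] only). *)
Definition wP e (eta : R) : R[i] := (expR (- (e * `|eta|)))%:C.

Definition wK e s (eta : R) : R[i] :=
  Kexp (s%:C + iC * e%:C) eta + Kexp (- s%:C + iC * e%:C) (- eta).

Lemma cmeas_wP e : cmeasurable (wP e).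
Proof.
apply: cmeas_real; apply: measurableT_comp => //; apply: measurableT_comp => //.
by apply: measurable_funM; [exact: measurable_cst|exact: normr_measurable].
Qed.

Lemma wP_wK e s (eta : R) : eta != 0 -> wK e s eta = wP e eta * eC (eta * s).
Proof.
have H (x y : R) : iC * (x%:C + iC * e%:C) * y%:C = (- (e * y))%:C + iC * (y * x)%:C.
  rewrite !rmorphN !rmorphM/=.
  rewrite (_ : iC * _ * _ = (iC * iC) * (e%:C * y%:C) + iC * (y%:C * x%:C)); last by ring.
  by rewrite iC2 mulN1r.
have cr (x : R) : cexp x%:C = (expR x)%:C.
  by apply: complex_eqP; rewrite ?Re_cexp ?Im_cexp /= ?cos0 ?sin0 ?mulr1 ?mulr0.
rewrite /wK /wP eCE; case: ltgtP => // eta0 _.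
  rewrite Kexp0 ?(ltW eta0)// add0r KexpE oppr_gt0 eta0 mul1r -rmorphN H cexpD.
  by rewrite cr ltr0_norm// mulrNN.
rewrite [X in _ + X]Kexp0 ?oppr_le0 ?(ltW eta0)// addr0 KexpE eta0 mul1r H cexpD.
by rewrite cr gtr0_norm.
Qed.

Let ImK s e : Im (s%:C + iC * e%:C) = e.
Proof. by rewrite ImD ImMi/= add0r. Qed.
Let ImK' s e : Im (- s%:C + iC * e%:C) = e.
Proof. by rewrite ImD ImMi/= oppr0 add0r. Qed.

Lemma wK_L1 e s : 0 < e -> cL1 mu (wK e s).
Proof.
move=> e0; apply: cL1D; first by apply: cL1_Kexp; rewrite ImK.
by apply: cL1_opp; apply: cL1_Kexp; rewrite ImK'.
Qed.

Lemma wP_L1 e : 0 < e -> cL1 mu (wP e).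
Proof.
move=> e0; apply: (cL1_ae (wK_L1 0 e0) (cmeas_wP e)).
by apply: (ae_neq (y := 0)) => x x0; rewrite wP_wK// mulr0 eC0 mulr1.
Qed.

Definition pk e s : R := 2 * e / (e ^+ 2 + s ^+ 2).

(** The two half-line exponentials contribute i / (s + ie) and i / (-s + ie), and these add up to 2e
    / (e^2 + s^2), a kernel of total mass 2 pi. *)
Lemma poisson_ft e s : 0 < e -> cint mu (fun eta => wP e eta * eC (eta * s)) = (pk e s)%:C.
Proof.
move=> e0.
have mw : cmeasurable (fun eta => wP e eta * eC (eta * s)).
  apply: cmeasM; first exact: cmeas_wP.
  by apply: cmeas_eC; apply: measurable_funM => //; exact: measurable_cst.
rewrite -(@cint_ae_eq _ _ _ mu (wK e s)) => [|||]; first last.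
- by apply: (ae_neq (y := 0)) => x x0; rewrite wP_wK.
- exact: mw.
- exact: cL1_measurable (wK_L1 s e0).
have i1 : cL1 mu (Kexp (s%:C + iC * e%:C)) by apply: cL1_Kexp; rewrite ImK.
have i2 : cL1 mu (Kexp (- s%:C + iC * e%:C)) by apply: cL1_Kexp; rewrite ImK'.
rewrite /wK (cintD i1 (cL1_opp i2)) (cint_opp i2) !cint_Kexp ?ImK ?ImK'//.
have n1 : s%:C + iC * e%:C != 0.
  by apply: contraTneq e0 => h; rewrite -(ImK s e) h ltxx.
have n2 : - s%:C + iC * e%:C != 0.
  by apply: contraTneq e0 => h; rewrite -(ImK' s e) h ltxx.
have es : e ^+ 2 + s ^+ 2 != 0 by rewrite gt_eqF// ltr_wpDr ?sqr_ge0// exprn_gt0.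
have esC : (e ^+ 2 + s ^+ 2)%:C != 0 by rewrite -(rmorph0 (real_complex R)) (inj_eq (@complexI R)).
have D : (s%:C + iC * e%:C) * (- s%:C + iC * e%:C) = - (e ^+ 2 + s ^+ 2)%:C.
  rewrite rmorphD !rmorphXn/=.
  rewrite (_ : _ * _ = iC * iC * e%:C ^+ 2 - s%:C ^+ 2); last by ring.
  by rewrite iC2; ring.
rewrite /pk rmorphM fmorphV/= rmorphM/= rmorph_nat.
apply: (mulIf esC); rewrite mulfVK//.
rewrite -[X in _ * X = _]opprK -D.
rewrite (_ : _ * - _ = - (iC * ((- s%:C + iC * e%:C) + (s%:C + iC * e%:C)))); last first.
  by field; rewrite n1 n2.
by rewrite (_ : - _ = - (iC * iC) * (2 * e%:C)); [rewrite iC2 opprK mul1r|ring].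
Qed.

Lemma oneDsqr_L1 : cL1 mu (fun v => ((1 + v ^+ 2)^-1)%:C) /\
  cint mu (fun v => ((1 + v ^+ 2)^-1)%:C) = pi%:C.
Proof.
have c1 : continuous (fun v : R => (1 + v ^+ 2)^-1) := @continuous_oneDsqrV R.
have p0 (v : R) : 0 <= (1 + v ^+ 2)^-1 by rewrite invr_ge0 addr_ge0 ?sqr_ge0.
have E : (\int[mu]_v ((1 + v ^+ 2)^-1)%:E = pi%:E)%E.
  rewrite (@ge0_symfun_integralT R (fun v => (1 + v ^+ 2)^-1))//; last first.
    by move=> x /=; rewrite sqrrN.
  by rewrite -set_itvcy (@integral0y_oneDsqr R) -EFinM; congr EFin; field.
split.
  split; first by apply: cmeas_real; exact: continuous_measurable_fun.
  have -> : (\int[mu]_x (cmod ((1 + x ^+ 2)^-1)%:C)%:E = \int[mu]_v ((1 + v ^+ 2)^-1)%:E)%E.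
    by apply: eq_integral => x _; rewrite cmod_real ger0_norm.
  by rewrite E ltry.
apply: complex_eqP.
  by rewrite Re_cint /= /Rintegral E.
rewrite Im_cint /= /Rintegral.
by under eq_integral do rewrite /=; rewrite integral0.
Qed.

Lemma cint_tensor d1 d2 (T1 : measurableType d1) (T2 : measurableType d2)
    (m1 : {sigma_finite_measure set T1 -> \bar R})
    (m2 : {sigma_finite_measure set T2 -> \bar R}) (f : T1 -> R[i]) (g : T2 -> R[i]) :
  cL1 m1 f -> cL1 m2 g ->
  cint (pmeas m1 m2) (fun z => f z.1 * g z.2) = cint m1 f * cint m2 g.
Proof.
move=> fi gi; rewrite (fubini2 (cL1_tensor fi gi)).2 -(cintZ _ gi).
by apply: cint_ext => y /=; rewrite cintZr.
Qed.

(** The common pattern of the exchanges of Fourier integrals: two integrable factors coupled by a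
    bounded kernel, here always a phase of modulus 1. *)
Lemma cint_swap_bounded d1 d2 (T1 : measurableType d1) (T2 : measurableType d2)
    (m1 : {sigma_finite_measure set T1 -> \bar R})
    (m2 : {sigma_finite_measure set T2 -> \bar R}) (f : T1 -> R[i]) (g : T2 -> R[i])
    (k : T1 * T2 -> R[i]) (C : R) :
  cL1 m1 f -> cL1 m2 g -> cmeasurable k -> (forall z, cmod (k z) <= C) ->
  [/\ cL1 m1 (fun x => f x * cint m2 (fun y => g y * k (x, y))),
      cL1 m2 (fun y => g y * cint m1 (fun x => f x * k (x, y))) &
  cint m1 (fun x => f x * cint m2 (fun y => g y * k (x, y))) =
  cint m2 (fun y => g y * cint m1 (fun x => f x * k (x, y)))].
Proof.
move=> fi gi mk kC.
have H := cL1Mbd (cL1_tensor fi gi) mk kC.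
have gx x : cL1 m2 (fun y => g y * k (x, y)).
  by apply: (cL1Mbd gi (C := C)) => //; exact: cmeas_sec1.
have fy y : cL1 m1 (fun x => f x * k (x, y)).
  by apply: (cL1Mbd fi (C := C)) => //; exact: cmeas_sec2.
have [h1 e1] := fubini1 H; have [h2 e2] := fubini2 H.
have E1 x : cint m2 (fun y => f (x, y).1 * g (x, y).2 * k (x, y)) =
    f x * cint m2 (fun y => g y * k (x, y)).
  by rewrite -(cintZ _ (gx x)); apply: cint_ext => y /=; rewrite mulrA.
have E2 y : cint m1 (fun x => f (x, y).1 * g (x, y).2 * k (x, y)) =
    g y * cint m1 (fun x => f x * k (x, y)).
  by rewrite -(cintZ _ (fy y)); apply: cint_ext => x /=; ring.
split.
- by apply: cL1_ext h1 => x; rewrite E1.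
- by apply: cL1_ext h2 => y; rewrite E2.
- rewrite -(cint_ext _ E1) -e1 e2; exact: cint_ext.
Qed.

Local Notation isq := ((Num.sqrt (2 * pi))^-1 : R).

Lemma pi2_gt0 : 0 < 2 * pi :> R.
Proof. by rewrite mulr_gt0// pi_gt0. Qed.

Lemma isq2 : isq%:C * isq%:C = (2 * pi)^-1%:C :> R[i].
Proof.
rewrite -rmorphM -invfM -expr2 sqr_sqrtr//.
exact: ltW pi2_gt0.
Qed.

Lemma measurable_mulC (c : R) : measurable_fun setT (fun x : R => x * c).
Proof. by apply: measurable_funM => //; exact: measurable_cst. Qed.

Lemma measurable_mul12 : measurable_fun setT (fun z : R * R => z.1 * z.2).
Proof. exact: measurable_funM. Qed.

Lemma measurable_mul21 : measurable_fun setT (fun z : R * R => - (z.2 * z.1)).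
Proof. by apply: measurableT_comp => //; exact: measurable_funM. Qed.

Lemma cmeas_ft f : cmeasurable f -> cmeasurable (ft f).
Proof.
move=> mf; rewrite (_ : ft f = fun xi => isq%:C * cint mu (fun x => f x * eC (- (x * xi)))); last first.
  by apply/funext => xi; rewrite ftE.
apply: cmeasM; first exact: cmeas_cst.
have h : cmeasurable (fun z : R * R => f z.2 * eC (- (z.2 * z.1))).
  apply: cmeasM; first exact: (cmeas_comp mf).
  by apply: cmeas_eC; exact: measurable_mul21.
exact: (@cmeas_cint1 _ _ _ _ R mu _ h).
Qed.

Lemma pk_scale e v : 0 < e -> (pk e (e * v))%:C = (2 / e)%:C * ((1 + v ^+ 2)^-1)%:C.
Proof.
move=> e0; rewrite -rmorphM /pk; congr (_%:C); field.
by rewrite !gt_eqF ?ltr_wpDr ?sqr_ge0 ?exprn_gt0.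
Qed.

Lemma pk_L1 e : 0 < e -> cL1 mu (fun s => (pk e s)%:C).
Proof.
move=> e0; have ei : 0 < e^-1 by rewrite invr_gt0.
apply: cL1_ext (cL1Z (2 / e)%:C (cL1_affine 0 ei oneDsqr_L1.1)) => s.
by rewrite addr0 -pk_scale// mulrA mulfV ?mul1r// gt_eqF.
Qed.

(** The substitution s = e v moves e from the kernel into the argument of h, so that the limit e ->
    0 becomes a matter of dominated convergence. *)
Lemma cint_pk e (h : R -> R[i]) (C : R) : 0 < e -> cmeasurable h ->
  (forall x, cmod (h x) <= C) ->
  cint mu (fun s => (pk e s)%:C * h s) =
  2 * cint mu (fun v => ((1 + v ^+ 2)^-1)%:C * h (e * v)).
Proof.
move=> e0 mh hC.
have i1 := cL1Mbd (pk_L1 e0) mh hC.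
rewrite (cint_affine 0 e0 i1).
have i2 : cL1 mu (fun v => ((1 + v ^+ 2)^-1)%:C * h (e * v)).
  apply: (cL1Mbd oneDsqr_L1.1 (C := C)) => //.
  by apply: (cmeas_comp mh); apply: measurable_funM => //; exact: measurable_cst.
rewrite -(cintZ 2 i2) -(cintZ e%:C (cL1_affine 0 e0 i1)).
apply: cint_ext => v; rewrite addr0 (pk_scale v e0) !mulrA; congr (_ * _ * _).
by rewrite -rmorphM -(rmorph_nat (real_complex R)); congr (_%:C); field; rewrite gt_eqF.
Qed.

Lemma pk_ge0 e s : 0 < e -> 0 <= pk e s.
Proof.
move=> e0; rewrite /pk mulr_ge0 ?invr_ge0 ?addr_ge0 ?sqr_ge0//.
by rewrite mulr_ge0// ltW.
Qed.

Lemma Nint_pk e : 0 < e -> Nint mu (fun s => (pk e s)%:C) = 2 * pi.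
Proof.
move=> e0; apply: (@complexI R); rewrite (Nint_cint (pk_L1 e0)).
transitivity (cint mu (fun s => (pk e s)%:C * 1)).
  by apply: cint_ext => s; rewrite cmod_real ger0_norm ?pk_ge0// mulr1.
rewrite (@cint_pk e (fun=> 1) 1 e0) => [||x]; last by rewrite cmod1.
  have -> : cint mu (fun v => ((1 + v ^+ 2)^-1)%:C * 1) = cint mu (fun v => ((1 + v ^+ 2)^-1)%:C).
    by apply: cint_ext => v; rewrite mulr1.
  by rewrite oneDsqr_L1.2 rmorphM/= rmorph_nat.
exact: cmeas_cst.
Qed.

Lemma sqnormE f : sqnorm f = \int[mu]_x cmod ((cmod (f x) ^+ 2)%:C : R[i]).
Proof. exact: NintE. Qed.

(** The square of the transform is a double integral of f(x) conj f(y) e^{i eta (y - x)};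
    integrating it against [wP e] puts the Poisson kernel at y - x. Bounding |f(x) f(y)| by |f(x)|^2
    + |f(y)|^2 and using the mass 2 pi gives a bound that does not depend on e. *)
Lemma ft_sqr_reg f e : 0 < e -> cL1 mu f -> square_integrable f ->
  cL1 mu (fun eta => wP e eta * ((cmod (ft f eta)) ^+ 2)%:C) /\
  Nint mu (fun eta => wP e eta * ((cmod (ft f eta)) ^+ 2)%:C) <=
    isq ^+ 2 * (2 * pi * (2 * sqnorm f)).
Proof.
move=> e0 fi fs; pose fc x := conjc (f x).
have fci : cL1 mu fc by exact: cL1_conj.
have T := cL1_tensor fi fci.
pose k (z : R * (R * R)) := eC (z.1 * (z.2.2 - z.2.1)).
have mk : cmeasurable k.
  apply: cmeas_eC; apply: measurable_funM => //.
  by apply: measurable_funB; exact: measurableT_comp.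
have kb z : cmod (k z) <= 1 by rewrite cmod_eC.
have [h1 h2 h3] := cint_swap_bounded (wP_L1 e0) T mk kb.
have inner eta : cint (pmeas mu mu) (fun z => f z.1 * fc z.2 * k (eta, z)) * (isq ^+ 2)%:C =
    ((cmod (ft f eta)) ^+ 2)%:C.
  have i1 : cL1 mu (fun x => f x * eC (- (x * eta))).
    by apply: cL1_eC => //; exact: measurable_Nmulr.
  have i2 : cL1 mu (fun x => fc x * eC (x * eta)).
    by apply: cL1_eC => //; exact: measurable_mulC.
  transitivity (cint mu (fun x => f x * eC (- (x * eta))) *
      cint mu (fun x => fc x * eC (x * eta)) * (isq ^+ 2)%:C).
    rewrite -(cint_tensor i1 i2); congr (_ * _); apply: cint_ext => z.
    have -> : k (eta, z) = eC (- (z.1 * eta)) * eC (z.2 * eta).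
      by rewrite -eCD /k /=; congr eC; ring.
    ring.
  have -> : cint mu (fun x => fc x * eC (x * eta)) =
      conjc (cint mu (fun x => f x * eC (- (x * eta)))).
    rewrite -(cint_conj i1); apply: cint_ext => x.
    by rewrite conjcM conj_eC opprK.
  rewrite ftE cmodM exprMn cmod_real ger0_norm ?invr_ge0 ?sqrtr_ge0//.
  set I := cint _ _.
  have -> : I * conjc I = (cmod I ^+ 2)%:C.
    apply: complex_eqP; first by rewrite ReM Re_conjc Im_conjc/= sqr_cmod; ring.
    by rewrite ImM Re_conjc Im_conjc/=; ring.
  by rewrite -rmorphM mulrC.
have E eta : wP e eta * cint (pmeas mu mu) (fun z => f z.1 * fc z.2 * k (eta, z)) *
    (isq ^+ 2)%:C = wP e eta * ((cmod (ft f eta)) ^+ 2)%:C.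
  by rewrite -mulrA inner.
have L : cL1 mu (fun eta => wP e eta * ((cmod (ft f eta)) ^+ 2)%:C).
  by apply: cL1_ext (cL1Zr (isq ^+ 2)%:C h1) => eta; exact: E.
split => //.
have pos eta : cmod (wP e eta * ((cmod (ft f eta)) ^+ 2)%:C) =
    Re (wP e eta * ((cmod (ft f eta)) ^+ 2)%:C).
  rewrite ReMr cmodM /wP !cmod_real [`|expR _|]ger0_norm ?expR_ge0//.
  by rewrite [`|_ ^+ 2|]ger0_norm ?sqr_ge0.
have -> : Nint mu (fun eta => wP e eta * ((cmod (ft f eta)) ^+ 2)%:C) =
    Re (cint mu (fun eta => wP e eta * ((cmod (ft f eta)) ^+ 2)%:C)).
  by rewrite NintE Re_cint; apply: eq_Rintegral => x _; rewrite pos.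
apply: le_trans (ler_norm _) _; apply: le_trans (Re_le_cmod _) _.
have -> : cint mu (fun eta => wP e eta * ((cmod (ft f eta)) ^+ 2)%:C) =
    cint mu (fun eta => wP e eta *
      cint (pmeas mu mu) (fun z => f z.1 * fc z.2 * k (eta, z))) * (isq ^+ 2)%:C.
  by rewrite -(cintZr _ h1); apply: cint_ext => eta; rewrite E.
rewrite cmodM cmod_real ger0_norm ?sqr_ge0// mulrC ler_wpM2l ?sqr_ge0// h3.
have inn z : f z.1 * fc z.2 * cint mu (fun x => wP e x * k (x, z)) =
    f z.1 * fc z.2 * (pk e (z.2 - z.1))%:C.
  by rewrite /k/= poisson_ft.
have h2' : cL1 (pmeas mu mu) (fun z => f z.1 * fc z.2 * (pk e (z.2 - z.1))%:C).
  by apply: cL1_ext h2 => z; exact: inn.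
have -> : cint (pmeas mu mu) (fun z => f z.1 * fc z.2 * cint mu (fun x => wP e x * k (x, z)))
    = cint (pmeas mu mu) (fun z => f z.1 * fc z.2 * (pk e (z.2 - z.1))%:C).
  by apply: cint_ext => z; exact: inn.
pose pk' s : R[i] := (pk e s)%:C.
have pki : cL1 mu pk' := pk_L1 e0.
have pkE (x y : R) : pk e (y - x) = pk e (x - y).
  by rewrite /pk -(opprB x y) sqrrN.
have s1 := cL1_conv1 (sq_cL1 fs) pki; have s2 := cL1_conv2 (sq_cL1 fs) pki.
apply: cmod_cint_le => //.
have s12 := cL1D s1 s2.
apply: (@le_trans _ _ (Nint (pmeas mu mu) (fun z : R * R =>
   (cmod (f z.1) ^+ 2)%:C * pk' (z.1 - z.2) + pk' (z.1 - z.2) * (cmod (f z.2) ^+ 2)%:C))).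
  apply: (le_Nint h2' s12) => z.
  rewrite [X in _ <= cmod (X + _)]mulrC -mulrDr -rmorphD pkE.
  rewrite [leRHS]cmodM [leLHS]cmodM mulrC ler_wpM2l ?cmod_ge0//.
  rewrite cmod_real ger0_norm ?addr_ge0 ?sqr_ge0// cmodM /fc cmod_conjc.
  exact: sqrt_amgm.
apply: le_trans (NintD s1 s2) _.
have -> : Nint (pmeas mu mu) (fun z : R * R => (cmod (f z.1) ^+ 2)%:C * pk' (z.1 - z.2)) =
    2 * pi * sqnorm f.
  rewrite (Nint_fubini1 s1).
  rewrite sqnormE.
  rewrite -RintegralZl//; last exact: cL1_normal (sq_cL1 fs).
  apply: eq_Rintegral => x _ /=.
  by rewrite NintZ ?(Nint_reflect x pki) ?Nint_pk 1?mulrC//; exact: cL1_reflect.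
have -> : Nint (pmeas mu mu) (fun z : R * R => pk' (z.1 - z.2) * (cmod (f z.2) ^+ 2)%:C) =
    2 * pi * sqnorm f.
  rewrite (Nint_fubini2 s2).2.
  rewrite sqnormE.
  rewrite -RintegralZl//; last exact: cL1_normal (sq_cL1 fs).
  apply: eq_Rintegral => x _ /=.
  have -> : (fun y : R => pk' (y - x) * (cmod (f x) ^+ 2)%:C) =
     (fun y : R => (cmod (f x) ^+ 2)%:C * pk' (y - x)) by apply/funext => y; rewrite mulrC.
  by rewrite NintZ ?(Nint_shift x pki) ?Nint_pk 1?mulrC//; exact: cL1_shift.
by rewrite le_eqVlt; apply/orP; left; apply/eqP; ring.
Qed.

Lemma cmod_dist (z w : R[i]) : `|cmod z - cmod w| <= cmod (z - w).
Proof.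
have h1 := cmodD (z - w) w; have h2 := cmodD (w - z) z.
rewrite subrK in h1; rewrite subrK cmodBC in h2.
by rewrite ler_norml; apply/andP; split; lra.
Qed.

Lemma fatou_cL1 d (T : measurableType d) (m : {measure set T -> \bar R})
    (u : nat -> T -> R[i]) (g : T -> R[i]) (C : R) :
  (forall n, cL1 m (u n)) -> (forall n, Nint m (u n) <= C) -> cmeasurable g ->
  (forall x, ctends (fun n => u n x) (g x)) -> cL1 m g.
Proof.
move=> ui uC mg ug; split => //.
pose v (n : nat) (x : T) : \bar R := (cmod (u n x))%:E.
have mv n : measurable_fun setT (v n).
  by apply/measurable_EFinP; apply: measurable_cmod; case: (ui n).
have v0 n x : setT x -> (0 <= v n x)%E by move=> _; rewrite lee_fin cmod_ge0.
have lim x : limn_einf (v^~ x) = (cmod (g x))%:E.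
  have h : v^~ x @ \oo --> (cmod (g x))%:E.
    apply: cvg_EFin; first exact: nearW.
    apply: cvg_real0_eq; apply: (le_cvg0 _ (ug x)) => n.
    by rewrite normr_ge0/= cmod_dist.
  by rewrite (cvg_limn_einf_sup h).1.
have := fatou m measurableT mv v0.
have -> : (\int[m]_x limn_einf (v^~ x) = \int[m]_x (cmod (g x))%:E)%E.
  by apply: eq_integral => x _; exact: lim.
move=> /le_lt_trans; apply.
apply: (@le_lt_trans _ _ C%:E); last exact: ltry.
rewrite limn_einf_lim; apply: lime_le; first exact: is_cvg_einfs.
apply: nearW => n; apply: (@le_trans _ _ (\int[m]_x v n x)%E).
  by apply: ereal_inf_lbound; exists n => /=.
have -> : (\int[m]_x v n x)%E = (Nint m (u n))%:E.
  by rewrite NintE /Rintegral fineK//; exact: integrable_fin_num (cL1_normal (ui n)).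
by rewrite lee_fin.
Qed.

Definition en (n : nat) : R := n.+1%:R^-1.

Lemma en_gt0 n : 0 < en n. Proof. by rewrite invr_gt0 ltr0n. Qed.

Lemma en_cvg : en @ \oo --> (0 : R).
Proof. exact: cvg_harmonic. Qed.

Lemma en_cvgM (c : R) : (fun n => en n * c) @ \oo --> (0 : R).
Proof. by rewrite -[X in _ --> X](mul0r c); apply: cvgM; [exact: en_cvg|exact: cvg_cst]. Qed.

Lemma ccont_ctends (h : R -> R[i]) (u : nat -> R) (x : R) : ccont h ->
  u @ \oo --> x -> ctends (fun n => h (u n)) (h x).
Proof.
move=> [h1 h2] ux; apply: ctends_ReIm.
  exact: (cvg_comp u (fun t => Re (h t)) ux (h1 x)).
exact: (cvg_comp u (fun t => Im (h t)) ux (h2 x)).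
Qed.

Lemma wP_ctends (eta : R) : ctends (fun n => wP (en n) eta) 1.
Proof.
have h := ccont_ctends (cder_ccont (cder_cexp (1 : R[i]) 0)) (en_cvgM (- `|eta|)).
rewrite mulr0 addr0 cexp0 in h; apply: ctends_eq h => n.
rewrite /wP mul1r addr0; apply: complex_eqP.
  by rewrite Re_cexp /= cos0 mulr1 mulrN.
by rewrite Im_cexp /= sin0 mulr0.
Qed.

Lemma wP_le1 e eta : 0 < e -> cmod (wP e eta) <= 1.
Proof.
move=> e0; rewrite cmod_real ger0_norm ?expR_ge0// -expR0 ler_expR oppr_le0.
by rewrite mulr_ge0// ltW.
Qed.

(** Fatou's lemma removes the regularising factor from the uniform bound of [ft_sqr_reg]. *)
Lemma bessel f : cL1 mu f -> square_integrable f -> square_integrable (ft f).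
Proof.
move=> fi fs; have mft := cmeas_ft (cL1_measurable fi).
apply: cL1_sq => //.
apply: (@fatou_cL1 _ _ mu (fun n eta => wP (en n) eta * ((cmod (ft f eta)) ^+ 2)%:C) _
  (isq ^+ 2 * (2 * pi * (2 * sqnorm f)))).
- by move=> n; have [] := ft_sqr_reg (en_gt0 n) fi fs.
- by move=> n; have [] := ft_sqr_reg (en_gt0 n) fi fs.
- by apply: cmeas_real; apply: measurable_funX; exact: measurable_cmod.
- move=> eta; rewrite -[X in ctends _ X]mul1r.
  by apply: ctendsM; [exact: wP_ctends|exact: ctends_cst].
Qed.

(** * P_a and Q_a as Fourier multipliers *)

Section Resolvent.
Variable a : R[i].
Hypothesis a0 : 0 < Im a.

Definition rs (eta : R) : R[i] := (a + eta%:C)^-1.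

Lemma Im_rs eta : Im (a + eta%:C) = Im a. Proof. by rewrite ImD/= addr0. Qed.

Lemma rs_neq0 eta : a + eta%:C != 0.
Proof. by apply: contraTneq a0 => h; rewrite -(Im_rs eta) h ltxx. Qed.

Lemma cmeas_rs : cmeasurable rs.
Proof. by apply: cmeas_inv; apply: cmeasD; [exact: cmeas_cst|exact: cmeas_id_real]. Qed.

Lemma rs_bd eta : cmod (rs eta) <= (Im a)^-1.
Proof.
rewrite /rs cmodV lef_pV2 ?posrE ?cmod_gt0 ?rs_neq0//.
by rewrite -(Im_rs eta) (le_trans (ler_norm _))// Im_le_cmod.
Qed.

(** The function |rs|^2 is a translate of the Poisson kernel [pk (Im a)], divided by 2 Im a. *)
Lemma rs_sq : square_integrable rs.
Proof.
apply: cL1_sq; first exact: cmeas_rs.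
have h := cL1Z ((2 * Im a)^-1)%:C (cL1_shift (Re a) (pk_L1 a0)).
apply: cL1_ext h => eta; rewrite -rmorphM; congr (_%:C).
rewrite /rs cmodV exprVn sqr_cmod Im_rs ReD /= /pk (addrC eta).
have h2 : 2 * Im a != 0 by rewrite mulf_neq0 ?pnatr_eq0// gt_eqF.
by rewrite mulrA (mulVf h2) mul1r; congr (_^-1); exact: addrC.
Qed.

Lemma rs_Kexp eta : rs eta = - iC * cint mu (fun s => Kexp a s * eC (eta * s)).
Proof.
have -> : cint mu (fun s => Kexp a s * eC (eta * s)) = cint mu (Kexp (a + eta%:C)).
  apply: cint_ext => s; rewrite !KexpE eCE -mulrA -cexpD; congr (_ * cexp _).
  by rewrite rmorphM/=; ring.
rewrite cint_Kexp ?Im_rs// mulrA mulNr iC2 opprK mul1r.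
by [].
Qed.

(* As [rs] is a half-line integral of exponentials, [Bk e] is a Poisson mean of
   [Kexp a]; it tends to [- 2 pi i Kexp a (- t)] as [e] tends to [0]. *)
Definition Bk e t : R[i] := cint mu (fun eta => wP e eta * (rs eta * eC (eta * t))).

Lemma BkE1 e t : 0 < e -> Bk e t = - iC * cint mu (fun s => (pk e s)%:C * Kexp a (s - t)).
Proof.
move=> e0; pose k (z : R * R) := eC (z.1 * (z.2 + t)).
have mk : cmeasurable k.
  apply: cmeas_eC; apply: measurable_funM => //.
  by apply: measurable_funD => //; exact: measurable_cst.
have kb z : cmod (k z) <= 1 by rewrite cmod_eC.
have [h1 h2 h3] := cint_swap_bounded (wP_L1 e0) (cL1_Kexp a0) mk kb.
have Ki (eta : R) : cL1 mu (fun s => Kexp a s * eC (eta * s)).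
  apply: cL1_eC; first exact: cL1_Kexp.
  by apply: measurable_funM => //; exact: measurable_cst.
have E1 : Bk e t = - iC * cint mu (fun eta => wP e eta * cint mu (fun s => Kexp a s * k (eta, s))).
  rewrite -(cintZ _ h1); apply: cint_ext => eta; rewrite rs_Kexp mulrCA.
  transitivity (- iC * (wP e eta * (cint mu (fun s => Kexp a s * eC (eta * s)) * eC (eta * t)))).
    ring.
  congr (_ * (_ * _)); rewrite -(cintZr _ (Ki eta)); apply: cint_ext => s.
  by rewrite /k /= mulrDr eCD mulrA.
rewrite E1 h3; congr (_ * _).
have E2 s : Kexp a s * cint mu (fun eta => wP e eta * k (eta, s)) =
    (pk e (s + t))%:C * Kexp a (s + t - t).
  by rewrite /k/= poisson_ft// addrK mulrC.
transitivity (cint mu (fun s => (pk e (s + t))%:C * Kexp a (s + t - t))).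
  by apply: cint_ext => s; exact: E2.
have H : cL1 mu (fun s => (pk e s)%:C * Kexp a (s - t)).
  apply: (cL1Mbd (pk_L1 e0) (C := 1)).
    exact: (cmeas_comp (cmeas_Kexp a) (measurable_subl t)).
  by move=> s; apply: Kexp_le1; exact: ltW.
exact: (cint_shift t H).
Qed.

Lemma Bk_bd e t : 0 < e -> cmod (Bk e t) <= 2 * pi.
Proof.
move=> e0; rewrite BkE1// cmodM cmodN cmod_iC mul1r.
have H : cL1 mu (fun s => (pk e s)%:C * Kexp a (s - t)).
  apply: (cL1Mbd (pk_L1 e0) (C := 1)).
    exact: (cmeas_comp (cmeas_Kexp a) (measurable_subl t)).
  by move=> s; apply: Kexp_le1; exact: ltW.
apply: cmod_cint_le => //; rewrite -(Nint_pk e0).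
apply: (le_Nint H (pk_L1 e0)) => s.
by rewrite cmodM ler_piMr ?cmod_ge0// Kexp_le1// ltW.
Qed.

Lemma Kexp_ctends (u : nat -> R) (x : R) : x != 0 -> u @ \oo --> x ->
  ctends (fun n => Kexp a (u n)) (Kexp a x).
Proof.
move=> x0 ux.
have hc : ctends (fun n => cexp (iC * a * (u n)%:C)) (cexp (iC * a * x%:C)).
  have h := ccont_ctends (cder_ccont (cder_cexp (iC * a) 0)) ux.
  by rewrite addr0 in h; apply: ctends_eq h => n; rewrite addr0.
case: (ltgtP x 0) x0 => // xs _.
  have [N _ hN] : \forall n \near \oo, u n < 0 by exact: (cvgr_lt x ux).
  apply: (ctends_eventually (N := N)) => n Nn.
  by rewrite !Kexp0 ?ltW//; exact: hN.
have [N _ hN] : \forall n \near \oo, 0 < u n by exact: (cvgr_gt x ux).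
rewrite [X in ctends _ X]KexpE xs mul1r; apply: (ctends_near (N := N) _ hc) => n Nn.
by rewrite KexpE (hN n Nn) mul1r.
Qed.

(** After rescaling, the Poisson mean samples the kernel at e v - t, which tends to -t for every v;
    the condition on t avoids the jump of [Kexp a] at 0. *)
Lemma Bk_ctends t : t != 0 ->
  ctends (fun n => Bk (en n) t) (- iC * (2 * pi)%:C * Kexp a (- t)).
Proof.
move=> t0; have [oi1 oi2] := oneDsqr_L1.
have mK : cmeasurable (fun s => Kexp a (s - t)).
  exact: (cmeas_comp (cmeas_Kexp a) (measurable_subl t)).
have bK s : cmod (Kexp a (s - t)) <= 1 by apply: Kexp_le1; exact: ltW.
apply: (ctends_eq (u := fun n => - iC * (2 * cint mu (fun v =>
    ((1 + v ^+ 2)^-1)%:C * Kexp a (en n * v - t))))).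
  by move=> n; rewrite (BkE1 _ (en_gt0 n)) (cint_pk (en_gt0 n) mK bK).
rewrite -mulrA; apply: ctendsZ.
rewrite rmorphM/= rmorph_nat -mulrA; apply: ctendsZ.
rewrite -oi2 -(cintZr _ oi1).
apply: (cDCT_everywhere _ _ _ (cL1_normal oi1) _).2.
- move=> n; apply: cmeasM; first by case: oi1.
  apply: (cmeas_comp (cmeas_Kexp a)); apply: measurable_funB; last exact: measurable_cst.
  by apply: measurable_funM => //; exact: measurable_cst.
- by apply: cmeasM; [case: oi1|exact: cmeas_cst].
- move=> v; apply: ctendsZ; apply: Kexp_ctends; first by rewrite oppr_eq0.
  rewrite -[X in _ --> X]add0r; apply: cvgD; first exact: en_cvgM.
  exact: cvg_cst.
- by move=> n v; rewrite cmodM ler_piMr ?cmod_ge0// Kexp_le1// ltW.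
Qed.

Lemma ft_dual W f : cL1 mu W -> cL1 mu f ->
  cint mu (fun eta => W eta * ft f (- eta)) =
  isq%:C * cint mu (fun x => f x * cint mu (fun eta => W eta * eC (eta * x))).
Proof.
move=> Wi fi; pose k (z : R * R) := eC (z.1 * z.2).
have mk : cmeasurable k by apply: cmeas_eC; exact: measurable_mul12.
have kb z : cmod (k z) <= 1 by rewrite cmod_eC.
have [h1 h2 <-] := cint_swap_bounded Wi fi mk kb.
rewrite -(cintZ _ h1); apply: cint_ext => eta.
rewrite ftE mulrCA; congr (_ * (_ * _)); apply: cint_ext => x.
by rewrite /k/=; congr (_ * eC _); ring.
Qed.

Lemma cmeas_eCNmul y : cmeasurable (fun eta : R => eC (- (eta * y))).
Proof. apply: cmeas_eC; exact: measurable_Nmulr. Qed.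

Lemma wP_rs_L1 e y : 0 < e -> cL1 mu (fun eta => wP e eta * (rs eta * eC (- (eta * y)))).
Proof.
move=> e0; apply: (cL1Mbd (wP_L1 e0) (C := (Im a)^-1)).
  by apply: cmeasM; [exact: cmeas_rs|exact: cmeas_eCNmul].
by move=> eta; rewrite cmodM cmod_eC mulr1 rs_bd.
Qed.

Lemma resolvent_L1 (F : R -> R[i]) y : square_integrable F ->
  cL1 mu (fun eta => F (- eta) * (rs eta * eC (- (eta * y)))).
Proof.
move=> Fs; have Fr := sq_reflect 0 Fs.
have h : square_integrable (fun eta => rs eta * eC (- (eta * y))).
  by apply: (sqMbd (C := 1) rs_sq (cmeas_eCNmul y)) => x; rewrite cmod_eC.
by apply: cL1_ext (sqM Fr h) => eta; rewrite sub0r.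
Qed.

(** With the factor [wP] inserted, Fubini moves the transform from f to the weight and produces
    [Bk]. Both sides then converge by dominated convergence; the jump of the kernel at x = y affects
    a null set only. *)
Lemma ft_resolvent f y : cL1 mu f -> square_integrable f ->
  PI a f y = iC * isq%:C * cint mu (fun eta => ft f (- eta) * (rs eta * eC (- (eta * y)))).
Proof.
move=> fi fs.
have Hi := resolvent_L1 y (bessel fi fs).
have E1 n : cint mu (fun eta => wP (en n) eta * (rs eta * eC (- (eta * y))) * ft f (- eta)) =
    isq%:C * cint mu (fun x => f x * Bk (en n) (x - y)).
  rewrite (ft_dual (wP_rs_L1 y (en_gt0 n)) fi); congr (_ * _); apply: cint_ext => x.
  congr (_ * _); apply: cint_ext => eta.
  by rewrite -!mulrA -eCD; congr (_ * (_ * eC _)); ring.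
have mB n : cmeasurable (fun x : R => Bk (en n) (x - y)).
  apply: (@cmeas_cint1 _ _ _ _ R mu (fun z : R * R =>
    wP (en n) z.2 * (rs z.2 * eC (z.2 * (z.1 - y))))).
  apply: cmeasM; first exact: (cmeas_comp (cmeas_wP _)).
  apply: cmeasM; first exact: (cmeas_comp cmeas_rs).
  apply: cmeas_eC; apply: measurable_funM => //.
  by apply: measurable_funB => //; exact: measurable_cst.
have L1 : ctends (fun n => cint mu (fun eta => wP (en n) eta * (rs eta * eC (- (eta * y))) *
    ft f (- eta))) (cint mu (fun eta => ft f (- eta) * (rs eta * eC (- (eta * y))))).
  apply: (cDCT_everywhere _ _ _ (cL1_normal Hi) _).2.
  - move=> n; apply: cmeasM; first exact: cL1_measurable (wP_rs_L1 y (en_gt0 n)).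
    exact: (cmeas_comp (cmeas_ft (cL1_measurable fi))).
  - exact: cL1_measurable Hi.
  - move=> eta; rewrite -[X in ctends _ X]mul1r.
    apply: (ctends_eq (u := fun n => wP (en n) eta * (ft f (- eta) * (rs eta * eC (- (eta * y)))))).
      by move=> n; ring.
    by apply: ctendsM; [exact: wP_ctends|exact: ctends_cst].
  - move=> n eta; rewrite -mulrA [leLHS]cmodM [_ * ft f _]mulrC.
    by rewrite ler_piMl ?cmod_ge0// wP_le1 ?en_gt0.
have L2 : ctends (fun n => isq%:C * cint mu (fun x => f x * Bk (en n) (x - y)))
    (isq%:C * cint mu (fun x => f x * (- iC * (2 * pi)%:C * Kexp a (y - x)))).
  apply: ctendsZ.
  have Gi := cL1Z (2 * pi)%:C fi.
  apply: (cDCT _ _ _ (cL1_normal Gi) _).2.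
  - by move=> n; apply: cmeasM; [case: fi|exact: mB].
  - apply: cmeasM; first by case: fi.
    apply: cmeasM; first exact: cmeas_cst.
    exact: (cmeas_comp (cmeas_Kexp a) (measurable_subr y)).
  - apply: (ae_neq (y := y)) => x xy; apply: ctendsM; first exact: ctends_cst.
    by have := @Bk_ctends (x - y); rewrite subr_eq0 opprB; exact.
  - move=> n x; rewrite !cmodM mulrC ler_wpM2r ?cmod_ge0// cmod_real.
    by rewrite [leRHS]ger0_norm ?(ltW pi2_gt0)// Bk_bd// en_gt0.
have E := ctends_unique L1 (ctends_eq (fun n => esym (E1 n)) L2).
have Kf := okP_L1 y (ltW a0) fi.
rewrite E; transitivity (iC * isq%:C * (isq%:C * (- iC * (2 * pi)%:C * PI a f y))).
  have -> : iC * isq%:C * (isq%:C * (- iC * (2 * pi)%:C * PI a f y)) =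
      (isq%:C * isq%:C) * (2 * pi)%:C * (- (iC * iC)) * PI a f y by ring.
  rewrite isq2 iC2 opprK mulr1 -rmorphM mulVf ?mul1r//.
  by rewrite gt_eqF ?pi2_gt0.
congr (_ * (_ * _)); rewrite /PI -(cintZ _ Kf); apply: cint_ext => x; ring.
Qed.

Lemma sq_ext f g : (forall x, f x = g x) -> square_integrable f -> square_integrable g.
Proof. by move=> fg; rewrite (_ : f = g)//; apply/funext. Qed.

Lemma sqZ c f : square_integrable f -> square_integrable (fun x => c * f x).
Proof.
move=> fs; have h := sqMbd fs (@cmeas_cst _ _ R c) (fun _ => lexx (cmod c)).
by apply: sq_ext h => x; rewrite mulrC.
Qed.

Lemma sqB f g : square_integrable f -> square_integrable g ->
  square_integrable (fun x => f x - g x).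
Proof.
move=> fs gs; apply: sq_ext (sqD fs (sqZ (-1) gs)) => x; by rewrite mulN1r.
Qed.

(** Multiplying g by the square root of d and dividing f by it leaves the product unchanged. The
    free parameter d makes the bound small whenever f is small in L2. *)
Lemma Nint_sqM_scaled f g (d : R) : 0 < d -> square_integrable f -> square_integrable g ->
  Nint mu (fun x => f x * g x) <= d^-1 * sqnorm f + d * sqnorm g.
Proof.
move=> d0 fs gs; pose c := Num.sqrt d.
have c0 : 0 < c by rewrite sqrtr_gt0.
have cc : c ^+ 2 = d by rewrite sqr_sqrtr// ltW.
have scl h (k : R) : square_integrable h -> 0 < k ->
    square_integrable (fun x => k%:C * h x) /\ sqnorm (fun x => k%:C * h x) = k ^+ 2 * sqnorm h.
  move=> hs k0; have E x : ((cmod (k%:C * h x)) ^+ 2)%:C = (k ^+ 2)%:C * ((cmod (h x)) ^+ 2)%:C.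
    by rewrite cmodM cmod_real exprMn real_normK ?num_real// rmorphM.
  split.
    apply: cL1_sq; first by apply: cmeasM; [exact: cmeas_cst|case: hs].
    by apply: cL1_ext (cL1Z (k ^+ 2)%:C (sq_cL1 hs)) => x; rewrite E.
  transitivity (Nint mu (fun x => (k ^+ 2)%:C * ((cmod (h x)) ^+ 2)%:C)).
    by rewrite /sqnorm; congr (Nint _ _); apply/funext => x; rewrite E.
  by rewrite (NintZ _ (sq_cL1 hs)) cmod_real ger0_norm ?sqr_ge0.
have ci0 : 0 < c^-1 by rewrite invr_gt0.
have [f1 f2] := scl f c^-1 fs ci0; have [g1 g2] := scl g c gs c0.
have := Nint_sqM f1 g1.
rewrite -/(sqnorm (fun x => c^-1%:C * f x)) -/(sqnorm (fun x => c%:C * g x)) f2 g2 exprVn cc.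
congr (_ <= _); congr (Nint _ _); apply/funext => x.
rewrite mulrACA -rmorphM mulVf ?mul1r// gt_eqF//.
Qed.

Lemma sqnorm_ge0 f : 0 <= sqnorm f. Proof. exact: Nint_ge0. Qed.

Lemma cint_L2_ctends (u : nat -> R -> R[i]) f h :
  (forall n, square_integrable (u n)) -> square_integrable f -> square_integrable h ->
  (fun n => sqnorm (fun x => u n x - f x)) @ \oo --> (0 : R) ->
  ctends (fun n => cint mu (fun x => u n x * h x)) (cint mu (fun x => f x * h x)).
Proof.
move=> us fs hs uf; apply/ctends0P => [n|e e0]; first exact: cmod_ge0.
(* Chosen so that d times the square norm of h is at most e/2; the added 1 covers h of norm 0. *)
pose d := e / (2 * (sqnorm h + 1)).
have s1 : 0 < sqnorm h + 1 by rewrite ltr_wpDl ?sqnorm_ge0.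
have d0 : 0 < d by rewrite divr_gt0// mulr_gt0.
have /ctends0P H := uf; have {}H := H (fun n => sqnorm_ge0 _) (d * (e / 2)).
have {}H : \forall n \near \oo, sqnorm (fun x => u n x - f x) <= d * (e / 2).
  by apply: H; rewrite mulr_gt0// divr_gt0.
apply: filterS H => n Hn.
have ds := sqB (us n) fs.
rewrite -(cintB (sqM (us n) hs) (sqM fs hs)).
rewrite (_ : cint mu _ = cint mu (fun x => (u n x - f x) * h x)); last first.
  by apply: cint_ext => x; rewrite mulrBl.
apply: cmod_cint_le; first exact: sqM.
apply: (le_trans (Nint_sqM_scaled d0 ds hs)).
have h1 : d^-1 * sqnorm (fun x => u n x - f x) <= e / 2.
  by rewrite ler_pdivrMl.
have h2 : d * sqnorm h <= e / 2.
  have -> : d * sqnorm h = (e / 2) * (sqnorm h / (sqnorm h + 1)).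
    by rewrite /d; field; rewrite gt_eqF.
  apply: ler_piMr; first by rewrite ltW// divr_gt0.
  by rewrite ler_pdivrMr// mul1r lerDl.
lra.
Qed.

(* Being a Plancherel pair, in a form that is visibly stable under conjugation,
   modulation and reflection, unlike approximation by truncations. *)
Definition fourier_pair f F : Prop :=
  [/\ square_integrable f, square_integrable F &
  exists u : nat -> R -> R[i], [/\ forall n, cL1 mu (u n),
    forall n x, cmod (u n x) <= cmod (f x),
    forall x, ctends (fun n => u n x) (f x) &
    (fun n => sqnorm (fun x => ft (u n) x - F x)) @ \oo --> (0 : R)]].

Lemma PI_dominated_ctends f (u : nat -> R -> R[i]) y : square_integrable f ->
  (forall n, cmeasurable (u n)) -> (forall n x, cmod (u n x) <= cmod (f x)) ->
  (forall x, ctends (fun n => u n x) (f x)) ->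
  ctends (fun n => PI a (u n) y) (PI a f y).
Proof.
move=> fs mu_ uf ut; have Hi := okP_sq y a0 fs.
have mK : cmeasurable (fun x : R => Kexp a (y - x)).
  exact: (cmeas_comp (cmeas_Kexp a) (measurable_subr y)).
apply: (cDCT_everywhere _ _ _ (cL1_normal Hi) _).2.
- by move=> n; apply: cmeasM => //; exact: mu_.
- by apply: cmeasM => //; case: fs.
- by move=> x; apply: ctendsZ.
- by move=> n x; rewrite !cmodM ler_wpM2l ?cmod_ge0.
Qed.

Lemma reflect_sqnorm f : square_integrable f -> sqnorm (fun x => f (- x)) = sqnorm f.
Proof.
move=> fs; rewrite /sqnorm -[RHS](Nint_reflect 0 (sq_cL1 fs)).
by congr (Nint _ _); apply/funext => x; rewrite sub0r.
Qed.

Lemma sq_opp f : square_integrable f -> square_integrable (fun x => f (- x)).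
Proof.
by move=> /(sq_reflect 0); apply: sq_ext => x; rewrite sub0r.
Qed.

(** Pass to the limit along the approximants of the pair: on the left by domination at the fixed
    point y, on the right by L2 convergence tested against the square integrable resolvent. *)
Lemma PI_fourier f F y : fourier_pair f F ->
  PI a f y = iC * isq%:C * cint mu (fun eta => F (- eta) * (rs eta * eC (- (eta * y)))).
Proof.
case=> fs Fs [u [u1 u2 u3 u4]].
have us n : square_integrable (u n) by apply: (sq_le _ fs) => //; case: (u1 n).
have hs : square_integrable (fun eta => rs eta * eC (- (eta * y))).
  by apply: (sqMbd (C := 1) rs_sq (cmeas_eCNmul y)) => x; rewrite cmod_eC.
have L1 := PI_dominated_ctends y fs (fun n => cL1_measurable (u1 n)) u2 u3.
apply: (ctends_unique L1).
apply: (ctends_eq (fun n => esym (ft_resolvent y (u1 n) (us n)))).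
apply: ctendsZ; apply: (cint_L2_ctends (u := fun n x => ft (u n) (- x))) => //.
- by move=> n; apply: sq_opp; exact: bessel.
- exact: sq_opp.
- apply: cvg_trans u4; apply: near_eq_cvg; apply: nearW => n.
  exact: esym (reflect_sqnorm (sqB (bessel (u1 n) (us n)) Fs)).
Qed.

Lemma cvg0_eq (u v : nat -> R) : (forall n, v n = u n) -> u @ \oo --> (0 : R) ->
  v @ \oo --> (0 : R).
Proof. by move=> uv; rewrite (_ : v = u)//; apply/funext. Qed.

Lemma sqnorm_cmod f g : (forall x, cmod (f x) = cmod (g x)) -> sqnorm f = sqnorm g.
Proof.
by move=> fg; rewrite /sqnorm; congr (Nint _ _); apply/funext => x; rewrite fg.
Qed.

Lemma ft_conj f xi : cL1 mu f -> ft (fun x => conjc (f x)) xi = conjc (ft f (- xi)).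
Proof.
move=> fi; rewrite !ftE conjcM -cint_conj.
  congr (_ * _); first by apply: complex_eqP => //=; rewrite oppr0.
  apply: cint_ext => x; rewrite conjcM conj_eC; congr (_ * eC _); ring.
by apply: cL1_eC => //; exact: measurable_Nmulr.
Qed.

Lemma ft_mod f c xi : ft (fun x => f x * eC (c * x)) xi = ft f (xi - c).
Proof.
rewrite !ftE; congr (_ * _); apply: cint_ext => x.
rewrite -mulrA -eCD; congr (_ * eC _); ring.
Qed.

Lemma ft_opp f xi : cL1 mu f -> ft (fun x => f (- x)) xi = ft f (- xi).
Proof.
move=> fi; rewrite !ftE; congr (_ * _).
have h : cL1 mu (fun x => f x * eC (- (x * - xi))).
  by apply: cL1_eC => //; exact: measurable_Nmulr.
rewrite -(cint_opp h); apply: cint_ext => x; congr (_ * eC _); ring.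
Qed.

Lemma fourier_pair_conj f F : fourier_pair f F ->
  fourier_pair (fun x => conjc (f x)) (fun x => conjc (F (- x))).
Proof.
case=> fs Fs [u [u1 u2 u3 u4]]; split; [exact: sq_conj|exact: sq_conj (sq_opp Fs)|].
exists (fun n x => conjc (u n x)); split.
- by move=> n; exact: cL1_conj.
- by move=> n x; rewrite !cmod_conjc.
- move=> x; apply: (le_cvg0 _ (u3 x)) => n.
  by rewrite -conjcN -conjcD cmod_conjc cmod_ge0 lexx.
- have us n : square_integrable (u n) by apply: (sq_le _ fs) => //; case: (u1 n).
  apply: (cvg0_eq _ u4) => n.
  rewrite -[RHS](reflect_sqnorm (sqB (bessel (u1 n) (us n)) Fs)).
  by apply: sqnorm_cmod => x; rewrite (ft_conj x (u1 n)) -conjcN -conjcD cmod_conjc.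
Qed.

Lemma fourier_pair_mod f F c : fourier_pair f F ->
  fourier_pair (fun x => f x * eC (c * x)) (fun x => F (x - c)).
Proof.
have me : cmeasurable (fun x : R => eC (c * x)).
  by apply: cmeas_eC; apply: measurable_funM => //; exact: measurable_cst.
case=> fs Fs [u [u1 u2 u3 u4]]; split; [|exact: sq_shift|].
  by apply: (sqMbd (C := 1) fs me) => x; rewrite cmod_eC.
exists (fun n x => u n x * eC (c * x)); split.
- move=> n; apply: cL1_eC => //; apply: measurable_funM => //; exact: measurable_cst.
- by move=> n x; rewrite !cmodM cmod_eC !mulr1.
- by move=> x; apply: ctendsM => //; exact: ctends_cst.
- have us n : square_integrable (u n) by apply: (sq_le _ fs) => //; case: (u1 n).
  apply: (cvg0_eq _ u4) => n.
  rewrite /sqnorm -[RHS](Nint_shift c (sq_cL1 (sqB (bessel (u1 n) (us n)) Fs))).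
  by congr (Nint _ _); apply/funext => x; rewrite ft_mod.
Qed.

Lemma fourier_pair_opp f F : fourier_pair f F ->
  fourier_pair (fun x => f (- x)) (fun x => F (- x)).
Proof.
case=> fs Fs [u [u1 u2 u3 u4]]; split; [exact: sq_opp|exact: sq_opp|].
exists (fun n x => u n (- x)); split.
- by move=> n; apply: cL1_opp.
- by move=> n x.
- by move=> x; exact: u3.
- have us n : square_integrable (u n) by apply: (sq_le _ fs) => //; case: (u1 n).
  apply: (cvg0_eq _ u4) => n.
  rewrite -[RHS](reflect_sqnorm (sqB (bessel (u1 n) (us n)) Fs)).
  by apply: sqnorm_cmod => x; rewrite (ft_opp x (u1 n)).
Qed.

Lemma QI_fourier f F x : fourier_pair f F ->
  QI a f x = iC * isq%:C * cint mu (fun eta => F eta * (rs eta * eC (eta * x))).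
Proof.
move=> fF; have [fs _ _] := fF.
rewrite (QI_PI (okQ_sq x a0 fs)) (PI_fourier _ (fourier_pair_opp fF)); congr (_ * _).
by apply: cint_ext => eta; rewrite opprK mulrN opprK.
Qed.

(** Only g is approximated. For an integrable approximant the multiplier formula for [PI a f] and
    Fubini apply, since F (- eta) times the resolvent is a product of two L2 functions and hence
    integrable. The limit is then taken by domination in y and by L2 convergence in eta. *)
Lemma mulPI_fourier f F g G : fourier_pair f F -> fourier_pair g G ->
  cint mu (fun y => g y * PI a f y) =
  iC * cint mu (fun eta => F (- eta) * G eta * rs eta).
Proof.
move=> fF; have [fs Fs _] := fF; case=> gs Gs [u [u1 u2 u3 u4]].
have us n : square_integrable (u n) by apply: (sq_le _ gs) => //; case: (u1 n).
have mP := cmeas_PI a (proj1 fs).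
have W2 : square_integrable (fun eta => F (- eta) * rs eta).
  by apply: (sqMbd (sq_opp Fs) cmeas_rs) => eta; exact: rs_bd.
have W1 : cL1 mu (fun eta => F (- eta) * rs eta) by exact: (sqM (sq_opp Fs) rs_sq).
have gP : cL1 mu (fun y => g y * PI a f y).
  by apply: (joint_cL1P (joint_sqsq a0 gs fs)) => t; exact: okP_sq.
have L1 : ctends (fun n => cint mu (fun y => u n y * PI a f y)) (cint mu (fun y => g y * PI a f y)).
  apply: (cDCT_everywhere _ _ _ (cL1_normal gP) _).2.
  - by move=> n; apply: cmeasM => //; case: (u1 n).
  - by case: gP.
  - by move=> x; apply: ctendsM => //; exact: ctends_cst.
  - by move=> n x; rewrite !cmodM ler_wpM2r ?cmod_ge0.
apply: (ctends_unique L1).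
apply: (ctends_eq (u := fun n => iC * cint mu (fun eta => ft (u n) eta * (F (- eta) * rs eta)))).
  move=> n; pose k (z : R * R) := eC (- (z.2 * z.1)).
  have mk : cmeasurable k by apply: cmeas_eC; exact: measurable_mul21.
  have kb z : cmod (k z) <= 1 by rewrite cmod_eC.
  have [h1 h2 h3] := cint_swap_bounded W1 (u1 n) mk kb.
  transitivity (iC * (isq%:C * cint mu (fun eta => (F (- eta) * rs eta) *
      cint mu (fun x => u n x * k (eta, x))))).
    congr (_ * _); rewrite -(cintZ _ h1); apply: cint_ext => eta.
    by rewrite ftE mulrC mulrCA.
  rewrite h3 mulrA -(cintZ _ h2); apply: cint_ext => x.
  rewrite (PI_fourier _ fF) mulrCA; congr (_ * (_ * _)).
  by apply: cint_ext => eta; rewrite /k /= mulrA mulrC [x * _]mulrC mulrC.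
apply: ctendsZ.
rewrite (_ : cint mu _ = cint mu (fun eta => G eta * (F (- eta) * rs eta))); last first.
  by apply: cint_ext => eta; ring.
apply: cint_L2_ctends => //.
by move=> n; exact: bessel.
Qed.

Lemma truncation_L1 (n : nat) f : square_integrable f ->
  cL1 mu (fun x => (- n%:R <= x <= n%:R)%R%:R * f x).
Proof.
move=> fs; have mb : measurable_fun setT (fun x : R => (- n%:R <= x <= n%:R)%R).
  by apply: measurable_and; apply: measurable_fun_ler => //; exact: measurable_cst.
have mc : cmeasurable (fun x : R => (- n%:R <= x <= n%:R)%R%:R : R[i]) by exact: cmeas_bool.
have bi : cL1 mu (fun x : R => (- n%:R <= x <= n%:R)%R%:R : R[i]).
  (* On [-n, n] the function e^{-|x|} is at least e^{-n}, so e^n times the integrable function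
     [wP 1] dominates the indicator. *)
  apply: (@cL1_le _ _ _ mu _ _ mc (cL1Z (expR n%:R)%:C (wP_L1 ltr01))) => x.
  rewrite cmod_bool; case xn : (_ <= x <= _); last exact: cmod_ge0.
  rewrite /wP mul1r -rmorphM cmod_real ger0_norm ?mulr_ge0 ?expR_ge0// -expRD.
  rewrite -[leLHS]expR0 ler_expR.
  by rewrite subr_ge0 ler_norml.
apply: sqM => //; apply: (bounded_L1_sq (C := 1) bi) => x.
by rewrite cmod_bool lern1 leq_b1.
Qed.

Lemma fourier_on_ft (n : nat) f xi :
  fourier_on `[- n%:R, n%:R] f xi = ft (fun x => (- n%:R <= x <= n%:R)%R%:R * f x) xi.
Proof.
rewrite /fourier_on ftE cintegral_mkcond; congr (_ * _); apply: cint_ext => x.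
rewrite mem_setE in_itv/= eCE mulrA; congr (_ * cexp _).
by rewrite rmorphN/= mulrN mulNr.
Qed.

Lemma fourier_transform_pair f F : square_integrable f -> is_fourier_transform f F ->
  fourier_pair f F.
Proof.
move=> fs [mF h].
pose u (n : nat) x := (- n%:R <= x <= n%:R)%R%:R * f x.
have u1 n : cL1 mu (u n) by exact: truncation_L1.
have u2 n x : cmod (u n x) <= cmod (f x).
  by rewrite /u cmodM cmod_bool; case: (_ <= x <= _); rewrite ?mul1r ?mul0r ?cmod_ge0.
have us n : square_integrable (u n) by apply: (sq_le _ fs) => //; case: (u1 n).
pose w (n : nat) xi : R[i] := ft (u n) xi - F xi.
have h' : (fun n => (\int[mu]_xi ((cmod (w n xi)) ^+ 2)%:E)%E) @ \oo --> 0%E.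
  have E : (fun n => (\int[mu]_xi ((cmod (w n xi)) ^+ 2)%:E)%E) = (fun n : nat =>
     (\int[mu]_xi ((cmod (F xi - fourier_on `[- n%:R, n%:R] f xi)) ^+ 2)%:E)%E).
    apply/funext => n; apply: eq_integral => xi _.
    by rewrite /w fourier_on_ft cmodBC.
  by rewrite E.
have mw n : cmeasurable (w n).
  by apply: cmeasB => //; exact: cmeas_ft (cL1_measurable (u1 n)).
(* The transform is given as a measurable function. It is square integrable because, for large N, it
   differs by a function of finite norm from the transform of a truncation. *)
have Fs : square_integrable F.
  have [N _ HN] : \forall n \near \oo, (\int[mu]_xi ((cmod (w n xi)) ^+ 2)%:E < 1%:E)%E.
    move: h' => /fine_cvgP[hf hc].
    have hl := @cvgr_lt _ _ _ _ _ _ hc _ ltr01; near=> n.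
    have fn : (\int[mu]_xi ((cmod (w n xi)) ^+ 2)%:E)%E \is a fin_num by near: n.
    rewrite -(fineK fn) lte_fin; near: n; exact: hl.
  have ws : square_integrable (w N).
    by split=> //; apply: (lt_trans (HN N (leqnn N))); exact: ltry.
  apply: sq_ext (sqB (bessel (u1 N) (us N)) ws) => x.
  by rewrite /w opprB addrC subrK.
split => //; exists u; split => //.
  move=> x; have [N hN] := nat_above `|x|.
  apply: (ctends_eventually (N := N)) => n Nn.
  by rewrite /u -ler_norml ltW ?mul1r// hN.
move: h' => /fine_cvgP[_ hc]; apply: cvg0_eq hc => n.
rewrite sqnormE /Rintegral; congr fine; apply: eq_integral => xi _.
by congr EFin; rewrite cmod_real ger0_norm// sqr_ge0.
Unshelve. all: by end_near.
Qed.

(** A norm bound is returned along with the value, so that the result can serve as the kernel for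
    the next weight and a multiple integral can be peeled off one variable at a time. *)
Lemma cint_weight1 d1 d2 (T1 : measurableType d1) (T2 : measurableType d2)
    (m1 : {sigma_finite_measure set T1 -> \bar R})
    (m2 : {sigma_finite_measure set T2 -> \bar R})
    (W : T1 -> R[i]) (K : T1 * T2 -> R[i]) (C : R) :
  cL1 m1 W -> cmeasurable K -> (forall x, cL1 m2 (fun y => K (x, y))) ->
  (forall x, Nint m2 (fun y => K (x, y)) <= C) ->
  [/\ cL1 (pmeas m1 m2) (fun z => W z.1 * K z),
      Nint (pmeas m1 m2) (fun z => W z.1 * K z) <= C * Nint m1 W &
      cint (pmeas m1 m2) (fun z => W z.1 * K z) =
      cint m1 (fun x => W x * cint m2 (fun y => K (x, y)))].
Proof.
move=> Wi mK Ki KC.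
have NE x : Nint m2 (fun y => W (x, y).1 * K (x, y)) = cmod (W x) * Nint m2 (fun y => K (x, y)).
  by rewrite -(NintZ (W x) (Ki x)).
have Ci : m1.-integrable setT (EFin \o (fun x => C * cmod (W x))).
  have h := integrableZl measurableT C (cL1_normal Wi).
  by apply: eq_integrable h.
have b x : Nint m2 (fun y => W (x, y).1 * K (x, y)) <= C * cmod (W x).
  by rewrite NE mulrC ler_wpM2r ?cmod_ge0.
have Fi : cL1 (pmeas m1 m2) (fun z => W z.1 * K z).
  apply: (@tonelli1 _ _ _ _ _ m1 m2 _ (fun x => C * cmod (W x))) => //.
    by apply: cmeasM => //; apply: (cmeas_comp (cL1_measurable Wi)).
  by move=> x; exact: (cL1Z (W x) (Ki x)).
have [Ni NEq] := Rintegral_fubini1 (cL1_normal Fi).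
split => //.
  rewrite NintE NEq [in leRHS]NintE -RintegralZl//; last exact: cL1_normal.
  by apply: le_Rintegral => // x _; move: (b x); rewrite NintE.
by rewrite (fubini1 Fi).2; apply: cint_ext => x; rewrite (cintZ (W x) (Ki x)).
Qed.

Lemma cint_weight2 d1 d2 (T1 : measurableType d1) (T2 : measurableType d2)
    (m1 : {sigma_finite_measure set T1 -> \bar R})
    (m2 : {sigma_finite_measure set T2 -> \bar R})
    (V : T2 -> R[i]) (K : T1 * T2 -> R[i]) (C : R) :
  cL1 m2 V -> cmeasurable K -> (forall y, cL1 m1 (fun x => K (x, y))) ->
  (forall y, Nint m1 (fun x => K (x, y)) <= C) ->
  [/\ cL1 (pmeas m1 m2) (fun z => V z.2 * K z),
      Nint (pmeas m1 m2) (fun z => V z.2 * K z) <= C * Nint m2 V &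
      cint (pmeas m1 m2) (fun z => V z.2 * K z) =
      cint m2 (fun y => V y * cint m1 (fun x => K (x, y)))].
Proof.
move=> Vi mK Ki KC.
have NE y : Nint m1 (fun x => V (x, y).2 * K (x, y)) = cmod (V y) * Nint m1 (fun x => K (x, y)).
  by rewrite -(NintZ (V y) (Ki y)).
have Ci : m2.-integrable setT (EFin \o (fun y => C * cmod (V y))).
  have h := integrableZl measurableT C (cL1_normal Vi).
  by apply: eq_integrable h.
have b y : Nint m1 (fun x => V (x, y).2 * K (x, y)) <= C * cmod (V y).
  by rewrite NE mulrC ler_wpM2r ?cmod_ge0.
have Fi : cL1 (pmeas m1 m2) (fun z => V z.2 * K z).
  apply: (@tonelli2 _ _ _ _ _ m1 m2 _ (fun y => C * cmod (V y))) => //.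
    by apply: cmeasM => //; apply: (cmeas_comp (cL1_measurable Vi)).
  by move=> y; exact: (cL1Z (V y) (Ki y)).
have [Ni NEq] := Rintegral_fubini2 (cL1_normal Fi).
split => //.
  rewrite NintE NEq [in leRHS]NintE -RintegralZl//; last exact: cL1_normal.
  by apply: le_Rintegral => // y _; move: (b y); rewrite NintE.
by rewrite (fubini2 Fi).2; apply: cint_ext => y; rewrite (cintZ (V y) (Ki y)).
Qed.

(** * The five-fold integral *)

Section FiveFold.
Variables (q F : R -> R[i]).
Hypothesis (hqF : fourier_pair q F).
Local Notation qc := (fun x => conjc (q x)).
Local Notation P := (PI a qc).
Local Notation Q := (QI a q).

Let hq : square_integrable q. Proof. by case: hqF. Qed.
Let hF : square_integrable F. Proof. by case: hqF. Qed.
Let hqc : square_integrable qc. Proof. exact: sq_conj. Qed.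
Let mF : cmeasurable F. Proof. by case: hF. Qed.

(** Products of two L2 functions, hence integrable weights. Their Fourier integrals [wh] and [vh]
    are Q and P up to the factor i / sqrt(2 pi). *)
Let w (xi : R) : R[i] := F xi * rs xi.
Let v (eta : R) : R[i] := conjc (F eta) * rs eta.

Let wi : cL1 mu w. Proof. exact: (sqM hF rs_sq). Qed.
Let vi : cL1 mu v. Proof. exact: (sqM (sq_conj hF) rs_sq). Qed.

Let wh (y : R) : R[i] := cint mu (fun xi => w xi * eC (xi * y)).
Let vh (y : R) : R[i] := cint mu (fun eta => v eta * eC (- (eta * y))).

Let isq0 : isq%:C != 0 :> R[i].
Proof. by rewrite -cmod_gt0 cmod_real normr_gt0 invr_eq0 gt_eqF// sqrtr_gt0 pi2_gt0. Qed.

Let QwE y : Q y = iC * isq%:C * wh y.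
Proof.
rewrite (QI_fourier y hqF); congr (_ * _); apply: cint_ext => xi.
by rewrite /w mulrA.
Qed.

Let PvE y : P y = iC * isq%:C * vh y.
Proof.
rewrite (PI_fourier y (fourier_pair_conj hqF)); congr (_ * _); apply: cint_ext => xi.
by rewrite /v mulrA opprK.
Qed.

Let mwh : cmeasurable wh.
Proof.
have -> : wh = fun y => (iC * isq%:C)^-1 * Q y.
  by apply/funext => y; rewrite QwE mulKf// mulf_neq0// iC_neq0.
by apply: cmeasM; [exact: cmeas_cst|exact: cmeas_QI (proj1 hq)].
Qed.

Let wh_bd y : cmod (wh y) <= Nint mu w.
Proof.
have h : cL1 mu (fun xi => w xi * eC (xi * y)).
  by apply: cL1_eC => //; exact: measurable_mulC.
apply: (cmod_cint_le h); apply: (le_Nint h wi) => x.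
by rewrite cmodM cmod_eC mulr1.
Qed.

Let vh_bd y : cmod (vh y) <= Nint mu v.
Proof.
have h : cL1 mu (fun xi => v xi * eC (- (xi * y))).
  by apply: cL1_eC => //; exact: measurable_Nmulr.
apply: (cmod_cint_le h); apply: (le_Nint h vi) => x.
by rewrite cmodM cmod_eC mulr1.
Qed.

Let mvh : cmeasurable vh.
Proof.
have -> : vh = fun y => (iC * isq%:C)^-1 * P y.
  by apply/funext => y; rewrite PvE mulKf// mulf_neq0// iC_neq0.
by apply: cmeasM; [exact: cmeas_cst|exact: cmeas_PI (proj1 hqc)].
Qed.

(* The factors of the integrand that depend on eta_1 = [eta], with
   e = xi_1 + xi_2 and d = eta_2 + eta_3. *)
Let kk (e d eta : R) : R[i] :=
  (rs eta + rs (e - eta)) * (conjc (F eta) * F (eta + (d - e))).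

Let FF_L1 e d : cL1 mu (fun eta => conjc (F eta) * F (eta + (d - e))).
Proof.
have h : square_integrable (fun eta => F (eta + (d - e))).
  by apply: sq_ext (sq_shift (e - d) hF) => eta; rewrite opprB.
exact: (sqM (sq_conj hF) h).
Qed.

Let rs2_bd e eta : cmod (rs eta + rs (e - eta)) <= 2 * (Im a)^-1.
Proof. by rewrite mulr_natl mulr2n; apply: le_trans (cmodD _ _) (lerD (rs_bd _) (rs_bd _)). Qed.

Let mrs2 e : cmeasurable (fun eta => rs eta + rs (e - eta)).
Proof.
apply: cmeasD; first exact: cmeas_rs.
exact: (cmeas_comp cmeas_rs (measurable_subr e)).
Qed.

Let kk_L1 e d : cL1 mu (kk e d).
Proof. exact: (cL1bdM (FF_L1 e d) (mrs2 e) (rs2_bd e)). Qed.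

(** Uniform in e and d because the L2 norm is translation invariant. With the integrable weights of
    the other four variables this gives absolute convergence of the five-fold integral. *)
Let kk_bd e d : Nint mu (kk e d) <= 2 * (Im a)^-1 * (2 * sqnorm F).
Proof.
apply: (@le_trans _ _ (Nint mu (fun eta => (2 * (Im a)^-1)%:C * (conjc (F eta) * F (eta + (d - e)))))).
  apply: (le_Nint (kk_L1 e d) (cL1Z _ (FF_L1 e d))) => eta.
  rewrite /kk [leLHS]cmodM [leRHS]cmodM ler_wpM2r ?cmod_ge0// cmod_real.
  by rewrite [leRHS]ger0_norm ?rs2_bd// mulr_ge0// invr_ge0 ltW.
rewrite (NintZ _ (FF_L1 e d)) cmod_real ger0_norm; last by rewrite mulr_ge0// invr_ge0 ltW.
apply: ler_wpM2l; first by rewrite mulr_ge0// invr_ge0 ltW.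
have h : square_integrable (fun eta => F (eta + (d - e))).
  by apply: sq_ext (sq_shift (e - d) hF) => eta; rewrite opprB.
apply: le_trans (Nint_sqM (sq_conj hF) h) _.
rewrite mulr_natl mulr2n lerD//.
  by rewrite (_ : Nint _ _ = sqnorm F)//; apply: sqnorm_cmod => x; rewrite cmod_conjc.
rewrite /sqnorm -[leRHS](Nint_shift (e - d) (sq_cL1 hF)).
by rewrite (_ : (fun x => _) = (fun x : R => ((cmod (F (x - (e - d)))) ^+ 2)%:C))//;
  apply/funext => x; rewrite opprB.
Qed.

(** Each summand of the bracket is an L2 pairing. For the first, q is modulated by e - d. For the
    second, the substitution eta -> e - eta exposes the pairing of conj q modulated by e with [PI a]
    of q modulated by -d. *)
Let cint_kk e d : cint mu (kk e d) = - iC *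
  (cint mu (fun y => q y * eC ((e - d) * y) * P y) +
   cint mu (fun y => qc y * eC (e * y) * PI a (fun t => q t * eC (- d * t)) y)).
Proof.
rewrite (mulPI_fourier (fourier_pair_conj hqF) (fourier_pair_mod (e - d) hqF)).
rewrite (mulPI_fourier (fourier_pair_mod (- d) hqF) (fourier_pair_mod e (fourier_pair_conj hqF))).
have i1 : cL1 mu (fun eta => rs eta * (conjc (F eta) * F (eta + (d - e)))).
  exact: (cL1bdM (FF_L1 e d) cmeas_rs rs_bd).
have mr2 : cmeasurable (fun eta : R => rs (e - eta)).
  exact: (cmeas_comp cmeas_rs (measurable_subr e)).
have i2 : cL1 mu (fun eta => rs (e - eta) * (conjc (F eta) * F (eta + (d - e)))).
  exact: (cL1bdM (FF_L1 e d) mr2 (fun eta => rs_bd (e - eta))).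
transitivity (cint mu (fun eta => rs eta * (conjc (F eta) * F (eta + (d - e)))) +
   cint mu (fun eta => rs (e - eta) * (conjc (F eta) * F (eta + (d - e))))).
  by rewrite -(cintD i1 i2); apply: cint_ext => eta; rewrite /kk mulrDl.
rewrite -mulrDr mulrA mulNr iC2 opprK mul1r; congr (_ + _).
  by apply: cint_ext => eta; rewrite !opprK opprB mulrC.
rewrite -(cint_reflect e i2); apply: cint_ext => eta.
have -> : e - (e - eta) = eta by ring.
have -> : - (eta - e) = e - eta by ring.
have -> : e - eta + (d - e) = - eta - - d by ring.
ring.
Qed.

Let phase_swap d (T : measurableType d) (m : {sigma_finite_measure set T -> \bar R})
    (W : T -> R[i]) (al : T -> R) (th : R -> R[i]) :
  cL1 m W -> measurable_fun setT al -> cL1 mu th ->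
  [/\ cL1 m (fun x => W x * cint mu (fun y => th y * eC (al x * y))),
      cL1 mu (fun y => th y * cint m (fun x => W x * eC (al x * y))) &
  cint m (fun x => W x * cint mu (fun y => th y * eC (al x * y))) =
  cint mu (fun y => th y * cint m (fun x => W x * eC (al x * y)))].
Proof.
move=> Wi mal thi; pose k (z : T * R) := eC (al z.1 * z.2).
have mk : cmeasurable k.
  by apply: cmeas_eC; apply: measurable_funM => //; exact: measurableT_comp.
have kb z : cmod (k z) <= 1 by rewrite cmod_eC.
exact: (cint_swap_bounded Wi thi mk kb).
Qed.

Let W (x : R * R) : R[i] := w x.1 * w x.2.
Let Wi : cL1 (pmeas mu mu) W. Proof. exact: cL1_tensor. Qed.

Let msum : measurable_fun setT (fun x : R * R => x.1 + x.2).
Proof. exact: measurable_funD. Qed.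

Let W_phase y : cint (pmeas mu mu) (fun x => W x * eC ((x.1 + x.2) * y)) = wh y ^+ 2.
Proof.
have h : cL1 mu (fun xi => w xi * eC (xi * y)).
  by apply: cL1_eC => //; exact: measurable_mulC.
rewrite expr2 -(cint_tensor h h); apply: cint_ext => x.
by rewrite /W mulrDl eCD mulrACA.
Qed.

Let cL1_eCl (f : R -> R[i]) c : cL1 mu f -> cL1 mu (fun x => f x * eC (c * x)).
Proof. by move=> fi; apply: cL1_eC => //; apply: measurable_funM => //; exact: measurable_cst. Qed.

Let qP_L1 : cL1 mu (fun y => q y * P y).
Proof. by apply: (joint_cL1P (joint_sqsq a0 hq hqc)) => t; exact: okP_sq. Qed.

Let mod_q c : square_integrable (fun t => q t * eC (c * t)).
Proof. by have [] := fourier_pair_mod c hqF. Qed.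

Let qcPI_L1 d : cL1 mu (fun y => qc y * PI a (fun t => q t * eC (- d * t)) y).
Proof. by apply: (joint_cL1P (joint_sqsq a0 hqc (mod_q _))) => t; exact: okP_sq. Qed.

Let wh2_bd y : cmod (wh y ^+ 2) <= Nint mu w ^+ 2.
Proof. by rewrite cmodX ler_pXn2r// nnegrE ?cmod_ge0 ?Nint_ge0. Qed.

Let vh2_bd y : cmod (vh y ^+ 2) <= Nint mu v ^+ 2.
Proof. by rewrite cmodX ler_pXn2r// nnegrE ?cmod_ge0 ?Nint_ge0. Qed.

Let qw : square_integrable (fun y => qc y * wh y ^+ 2).
Proof. exact: (sqMbd hqc (cmeasX 2 mwh) wh2_bd). Qed.

Let qv : square_integrable (fun y => q y * vh y ^+ 2).
Proof. exact: (sqMbd hq (cmeasX 2 mvh) vh2_bd). Qed.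

(** What the integrations over xi_1 and xi_2 leave. Their phases sum to [wh y ^+ 2]; in the second
    term [PI a] is transposed, so that eta_2 + eta_3 survives only in an exponential factor and can
    be integrated next. *)
Let Th (y : R) : R[i] := q y * P y * wh y ^+ 2 + QI a (fun y => qc y * wh y ^+ 2) y * q y.

Let Th1_L1 : cL1 mu (fun y => q y * P y * wh y ^+ 2).
Proof. exact: (cL1Mbd qP_L1 (cmeasX 2 mwh) wh2_bd). Qed.

Let Th2_L1 : cL1 mu (fun y => QI a (fun y => qc y * wh y ^+ 2) y * q y).
Proof. by apply: (joint_cL1Q (joint_sqsq a0 qw hq)) => t; exact: okQ_sq. Qed.

Let Th_L1 : cL1 mu Th. Proof. exact: (cL1D Th1_L1 Th2_L1). Qed.

Let xi_integral d :
  cint (pmeas mu mu) (fun x => W x * cint mu (kk (x.1 + x.2) d)) =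
  - iC * cint mu (fun y => Th y * eC (- d * y)).
Proof.
have [A1 A2 A3] := phase_swap Wi msum (cL1_eCl (- d) qP_L1).
have [B1 B2 B3] := phase_swap Wi msum (qcPI_L1 d).
have EA e : cint mu (fun y => q y * eC ((e - d) * y) * P y) =
    cint mu (fun y => q y * P y * eC (- d * y) * eC (e * y)).
  by apply: cint_ext => y; rewrite mulrDl eCD; ring.
have EB e : cint mu (fun y => qc y * eC (e * y) * PI a (fun t => q t * eC (- d * t)) y) =
    cint mu (fun y => qc y * PI a (fun t => q t * eC (- d * t)) y * eC (e * y)).
  by apply: cint_ext => y; ring.
transitivity (cint (pmeas mu mu) (fun x =>
    - iC * (W x * cint mu (fun y => q y * P y * eC (- d * y) * eC ((x.1 + x.2) * y))) +
    - iC * (W x * cint mu (fun y => qc y * PI a (fun t => q t * eC (- d * t)) y *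
      eC ((x.1 + x.2) * y))))).
  by apply: cint_ext => x; rewrite cint_kk EA EB; ring.
rewrite (cintD (cL1Z _ A1) (cL1Z _ B1)) (cintZ _ A1) (cintZ _ B1) A3 B3 -mulrDr.
congr (_ * _).
transitivity (cint mu (fun y => q y * P y * wh y ^+ 2 * eC (- d * y)) +
  cint mu (fun y => QI a (fun y => qc y * wh y ^+ 2) y * q y * eC (- d * y))).
  congr (_ + _).
    by apply: cint_ext => y; rewrite W_phase; ring.
  transitivity (cint mu (fun y => (qc y * wh y ^+ 2) * PI a (fun t => q t * eC (- d * t)) y)).
    by apply: cint_ext => y; rewrite W_phase; ring.
  rewrite (PQ_dual (joint_sqsq a0 qw (mod_q _)) (fun t => okP_sq t a0 (mod_q _)) (fun t => okQ_sq t a0 qw)).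
  by apply: cint_ext => y; rewrite mulrA.
rewrite -(cintD (cL1_eCl _ Th1_L1) (cL1_eCl _ Th2_L1)); apply: cint_ext => y.
by rewrite /Th mulrDl.
Qed.

Let eta2_integral eta3 :
  cint mu (fun eta => v eta * (- iC * cint mu (fun y => Th y * eC (- (eta + eta3) * y)))) =
  - iC * cint mu (fun y => Th y * vh y * eC (- eta3 * y)).
Proof.
have mo : measurable_fun setT (fun x : R => - x) := @oppr_measurable R setT.
have [A1 A2 A3] := phase_swap vi mo (cL1_eCl (- eta3) Th_L1).
transitivity (cint mu (fun eta => - iC * (v eta *
    cint mu (fun y => Th y * eC (- eta3 * y) * eC (- eta * y))))).
  apply: cint_ext => eta; rewrite mulrCA; congr (_ * (_ * _)).
  by apply: cint_ext => y; rewrite -mulrA -eCD -mulrDl opprD addrC.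
rewrite (cintZ _ A1) A3; congr (_ * _); apply: cint_ext => y.
rewrite mulrAC; congr (_ * _ * _).
by apply: cint_ext => eta; rewrite mulNr.
Qed.

Let eta3_integral :
  cint mu (fun eta => v eta * (- iC * cint mu (fun y => Th y * vh y * eC (- eta * y)))) =
  - iC * cint mu (fun y => Th y * vh y ^+ 2).
Proof.
have mo : measurable_fun setT (fun x : R => - x) := @oppr_measurable R setT.
have Tv := cL1Mbd Th_L1 mvh vh_bd.
have [A1 A2 A3] := phase_swap vi mo Tv.
transitivity (cint mu (fun eta => - iC * (v eta *
    cint mu (fun y => Th y * vh y * eC (- eta * y))))).
  by apply: cint_ext => eta; rewrite mulrCA.
rewrite (cintZ _ A1) A3; congr (_ * _); apply: cint_ext => y.
rewrite expr2 mulrA; congr (_ * _).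
by apply: cint_ext => eta; rewrite mulNr.
Qed.

(** Four constants turn the two factors [wh] and the two factors [vh] back into Q and P, and the
    transposition made in [Th] is undone. *)
Let Th_integral : (iC * isq%:C) ^+ 4 * cint mu (fun y => Th y * vh y ^+ 2) =
  cint mu (fun x => q x * P x ^+3 * Q x ^+ 2) +
  cint mu (fun x => qc x * Q x ^+ 2 * PI a (fun x => q x * P x * P x) x).
Proof.
have T1 := cL1Mbd Th1_L1 (cmeasX 2 mvh) vh2_bd.
have T2 := cL1Mbd Th2_L1 (cmeasX 2 mvh) vh2_bd.
have -> : cint mu (fun y => Th y * vh y ^+ 2) =
    cint mu (fun y => q y * P y * wh y ^+ 2 * vh y ^+ 2) +
    cint mu (fun y => QI a (fun y => qc y * wh y ^+ 2) y * q y * vh y ^+ 2).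
  by rewrite -(cintD T1 T2); apply: cint_ext => y; rewrite /Th mulrDl.
rewrite mulrDr; congr (_ + _).
  rewrite -(cintZ _ T1); apply: cint_ext => y.
  by rewrite QwE [in P y ^+ 3]PvE [in LHS]PvE; ring.
have J := joint_sqsq a0 qw qv.
have D := PQ_dual J (fun t => okP_sq t a0 qv) (fun t => okQ_sq t a0 qw).
transitivity ((iC * isq%:C) ^+ 4 *
    cint mu (fun t => qc t * wh t ^+ 2 * PI a (fun y => q y * vh y ^+ 2) t)).
  by congr (_ * _); rewrite D; apply: cint_ext => y; rewrite mulrA.
have JP := joint_cL1P J (fun t => okP_sq t a0 qv).
rewrite -(cintZ _ JP); apply: cint_ext => y.
have E : PI a (fun x => q x * P x * P x) y =
    (iC * isq%:C) ^+ 2 * PI a (fun y => q y * vh y ^+ 2) y.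
  rewrite -(PIZ _ (okP_sq y a0 qv)); apply: PI_ext => x; rewrite PvE; ring.
rewrite E QwE; ring.
Qed.

Let kk_meas d (T : measurableType d) (f g h : T -> R) : measurable_fun setT f ->
  measurable_fun setT g -> measurable_fun setT h -> cmeasurable (fun z => kk (f z) (g z) (h z)).
Proof.
move=> mf mg mh; apply: cmeasM.
  apply: cmeasD; first exact: (cmeas_comp cmeas_rs).
  by apply: (cmeas_comp cmeas_rs); exact: measurable_funB.
apply: cmeasM; first exact: cmeas_conj (cmeas_comp mF mh).
apply: (cmeas_comp mF); apply: measurable_funD => //; exact: measurable_funB.
Qed.

(** The integrand follows the nesting of the product space: xi_1, xi_2 and eta_1 in [K0], then
    eta_2, then eta_3. The parameter of each kernel carries the variables that are still to come. *)
Let K0 d (z : R * R * R) : R[i] := kk (z.1.1 + z.1.2) d z.2.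
Let K1 c (z : R * R * R * R) : R[i] := W z.1.1 * K0 (z.2 + c) z.1.
Let K2 (z : R * R * R * R * R) : R[i] := v z.1.2 * K1 z.2 z.1.

Let fst1 d1 d2 d3 (T1 : measurableType d1) (T2 : measurableType d2) (T3 : measurableType d3)
  (f : T1 -> T3) : measurable_fun setT f -> measurable_fun setT (fun z : T1 * T2 => f z.1).
Proof. move=> mf; exact: measurableT_comp. Qed.

Let mK0 d : cmeasurable (K0 d).
Proof.
by apply: kk_meas => //; exact: (fst1 msum).
Qed.

Let mK1 c : cmeasurable (K1 c).
Proof.
apply: cmeasM; first exact: (cmeas_comp (cL1_measurable Wi) (fst1 (@measurable_fst _ _ _ _))).
apply: kk_meas; first exact: (fst1 (fst1 msum)).
- by apply: measurable_funD => //; exact: measurable_cst.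
- exact: (fst1 (@measurable_snd _ _ _ _)).
Qed.

Let mK2 : cmeasurable K2.
Proof.
apply: cmeasM; first exact: (cmeas_comp (cL1_measurable vi) (fst1 (@measurable_snd _ _ _ _))).
apply: cmeasM; first exact: (cmeas_comp (cL1_measurable Wi) (fst1 (fst1 (@measurable_fst _ _ _ _)))).
apply: kk_meas; first exact: (fst1 (fst1 (fst1 msum))).
- apply: measurable_funD => //; exact: (fst1 (@measurable_snd _ _ _ _)).
- exact: (fst1 (fst1 (@measurable_snd _ _ _ _))).
Qed.

Let five_integral : cL1 (pmeas (pmeas (pmeas (pmeas mu mu) mu) mu) mu) (fun z => v z.2 * K2 z) /\
  cint (pmeas (pmeas (pmeas (pmeas mu mu) mu) mu) mu) (fun z => v z.2 * K2 z) =
  - iC * cint mu (fun y => Th y * vh y ^+ 2).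
Proof.
pose C0 := 2 * (Im a)^-1 * (2 * sqnorm F).
have S0 d := @cint_weight1 _ _ _ _ (pmeas mu mu) mu W (K0 d) C0 Wi (mK0 d) (fun x => kk_L1 (x.1 + x.2) d) (fun x => kk_bd (x.1 + x.2) d).
have S1 c := @cint_weight2 _ _ _ _ (pmeas (pmeas mu mu) mu) mu v (K1 c) _ vi (mK1 c)
  (fun y => let: And3 h _ _ := S0 (y + c) in h) (fun y => let: And3 _ h _ := S0 (y + c) in h).
have [? _ ->] := @cint_weight2 _ _ _ _ (pmeas (pmeas (pmeas mu mu) mu) mu) mu v K2 _ vi mK2
  (fun y => let: And3 h _ _ := S1 y in h) (fun y => let: And3 _ h _ := S1 y in h).
split => //; rewrite -eta3_integral; apply: cint_ext => e3; congr (_ * _).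
have [_ _ E1] := S1 e3; rewrite -eta2_integral; transitivity (cint mu (fun y => v y * cint (pmeas (pmeas mu mu) mu) (fun x => K1 e3 (x, y)))); first exact: E1.
apply: cint_ext => e2; congr (_ * _).
have [_ _ E0] := S0 (e2 + e3); rewrite -xi_integral; exact: E0.
Qed.

Lemma b6_fourier_position lam : a = 2 * lam ^+ 2 ->
  b6_fourier F lam = - lam ^+ 6 *
  (cint mu (fun x => q x * P x ^+ 3 * Q x ^+ 2) +
   cint mu (fun x => qc x * Q x ^+ 2 * PI a (fun x => q x * P x * P x) x)).
Proof.
have [five_L1 five_E] := five_integral; move=> aE; rewrite -Th_integral.
rewrite /b6_fourier (@eq_cintegral _ _ _ _ (pmeas (pmeas (pmeas (pmeas mu mu) mu) mu) mu)); last first.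
  by do 3 apply: prod_pmeas.
rewrite -(cintE (pmeas (pmeas (pmeas (pmeas mu mu) mu) mu) mu)).
transitivity (- (iC / (4 * pi ^+ 2)%:C) * (lam ^+ 6 *
  cint (pmeas (pmeas (pmeas (pmeas mu mu) mu) mu) mu) (fun z => v z.2 * K2 z))).
  congr (_ * _).
  rewrite -(cintZ _ five_L1); apply: cint_ext => -[[[[x1 x2] e1] e2] e3] /=.
  rewrite /K2 /K1 /K0 /W /v /w /kk /= -aE.
  have -> : e1 + e2 + e3 - x1 - x2 = e1 + (e2 + e3 - (x1 + x2)) by ring.
  rewrite /rs !invfM; ring.
rewrite five_E.
(* Each of the two factors Q and two factors P contributes i / sqrt(2 pi); this is the origin of 1 /
   (4 pi^2). The remaining factor -i comes from the pairing in eta_1. *)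
have -> : (iC * isq%:C) ^+ 4 = ((4 * pi ^+ 2)%:C)^-1 :> R[i].
  have -> : (iC * isq%:C) ^+ 4 = (iC * iC) ^+ 2 * (isq%:C * isq%:C) ^+ 2 :> R[i] by ring.
  rewrite iC2 isq2 sqrrN expr1n mul1r -rmorphXn -fmorphV; congr (_%:C).
  by rewrite exprVn exprMn -natrX.
have E : forall c X : R[i], - (iC * c) * (lam ^+ 6 * (- iC * X)) =
  (iC * iC) * (lam ^+ 6 * (c * X)) by move=> c X; ring.
by rewrite E iC2 mulN1r mulNr.
Qed.

End FiveFold.
End Resolvent.
End Poisson.

Lemma b6_fourierE (R : realType) (q qhat : R -> R[i]) (lam : R[i]) :
  square_integrable q -> is_fourier_transform q qhat -> 0 < Im (lam ^+ 2) ->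
  b6 q lam = b6_fourier qhat lam.
Proof.
move=> hq hqhat hlam; have a0 : 0 < Im (2 * lam ^+ 2) by exact: Im_a.
rewrite (b6_position hq hlam).
by rewrite (b6_fourier_position a0 (fourier_transform_pair hq hqhat) erefl).
Qed.

(** * Expansion for Schwartz functions *)

Section Schwartz.
Variable R : realType.
Local Notation mu := (@lebesgue_measure R).
Implicit Types (f g h q : R -> R[i]) (a c : R[i]).

Lemma cder_unique f g : cder f g -> cderiv 1 f = g.
Proof.
move=> [h1 h2]; apply/funext => x; apply: complex_eqP; rewrite /= derive1E.
  exact: (@derive_val _ _ _ _ _ _ _ (h1 x)).
exact: (@derive_val _ _ _ _ _ _ _ (h2 x)).
Qed.

Lemma cderiv0 f : cderiv 0 f = f.
Proof. by apply/funext => x; exact: complex_eqP. Qed.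

Lemma cderivS n f : cderiv n.+1 f = cderiv 1 (cderiv n f).
Proof. by []. Qed.

Lemma cderivSr n f : cderiv n.+1 f = cderiv n (cderiv 1 f).
Proof.
elim: n => [|n IH]; first by rewrite cderiv0.
by rewrite cderivS IH -cderivS.
Qed.

Lemma csmooth_cder q n : csmooth q -> cder (cderiv n q) (cderiv n.+1 q).
Proof.
move=> sq; split => x; have [h1 h2] := sq n x.
  by rewrite /= derive1E; exact: (DeriveDef h1).
by rewrite /= derive1E; exact: (DeriveDef h2).
Qed.

Lemma cder_opp f g : cder f g -> cder (fun x => f (- x)) (fun x => - g (- x)).
Proof.
move=> [h1 h2].
have o (x : R) : is_derive x (1 : R) (fun t : R => - t) (-1) by exact: is_deriveN.
split => x.
  have := @is_derive1_comp _ _ _ x _ _ (h1 (- x)) (o x).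
  by move=> h; apply: (is_derive_eq h); rewrite ReN /GRing.scale/= mulrN1.
have := @is_derive1_comp _ _ _ x _ _ (h2 (- x)) (o x).
by move=> h; apply: (is_derive_eq h); rewrite ImN /GRing.scale/= mulrN1.
Qed.

(* Stability under differentiation and rapid decay follow by induction on the
   constructors, which suffice to build every integrand of the expansion. *)
Inductive alg q : (R -> R[i]) -> Prop :=
| alg_base n : alg q (cderiv n q)
| alg_conj f : alg q f -> alg q (fun x => conjc (f x))
| alg_add f g : alg q f -> alg q g -> alg q (fun x => f x + g x)
| alg_mul f g : alg q f -> alg q g -> alg q (fun x => f x * g x)
| alg_scale c f : alg q f -> alg q (fun x => c * f x)
| alg_opp f : alg q f -> alg q (fun x => f (- x)).

Section Alg.
Variable q : R -> R[i].
Hypothesis hq : schwartz q.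

Lemma alg_decay f (m : nat) : alg q f -> exists2 C, 0 <= C & forall x : R, `|x| ^+ m * cmod (f x) <= C.
Proof.
suff H : alg q f -> forall m, exists2 C, 0 <= C & forall x : R, `|x| ^+ m * cmod (f x) <= C.
  by move=> /H.
elim=> [n|{}f _ IH|{}f g _ IHf _ IHg|{}f g _ IHf _ IHg|c {}f _ IH|{}f _ IH] k.
- case: hq => _ h; have [C hC] := h k n; exists C => //.
  apply: le_trans (hC 0); exact: mulr_ge0 (exprn_ge0 _ (normr_ge0 _)) (cmod_ge0 _).
- by have [C C0 hC] := IH k; exists C => // x; rewrite cmod_conjc.
- have [C C0 hC] := IHf k; have [D D0 hD] := IHg k; exists (C + D); first exact: addr_ge0.
  move=> x; apply: le_trans (lerD (hC x) (hD x)); rewrite -mulrDr.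
  by apply: ler_wpM2l; [exact: exprn_ge0|exact: cmodD].
- have [C C0 hC] := IHf k; have [D D0 hD] := IHg 0%N; exists (C * D); first exact: mulr_ge0.
  move=> x; rewrite cmodM mulrA; apply: ler_pM => //; rewrite ?mulr_ge0 ?exprn_ge0 ?cmod_ge0//.
  by move: (hD x); rewrite expr0 mul1r.
- have [C C0 hC] := IH k; exists (cmod c * C); first by rewrite mulr_ge0 ?cmod_ge0.
  by move=> x; rewrite cmodM mulrCA; apply: ler_wpM2l; [exact: cmod_ge0|exact: hC].
- by have [C C0 hC] := IH k; exists C => // x; rewrite -(normrN x).
Qed.

Lemma alg_bounded f : alg q f -> exists2 C, 0 <= C & forall x, cmod (f x) <= C.
Proof.
by move=> /(alg_decay 0)[C C0 hC]; exists C => // x; move: (hC x); rewrite expr0 mul1r.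
Qed.

Lemma alg_cder_ex f : alg q f -> exists2 g, alg q g & cder f g.
Proof.
elim=> [n|{}f _ [g ag dg]|f1 f2 a1 [g1 b1 d1] a2 [g2 b2 d2]|f1 f2 a1 [g1 b1 d1] a2 [g2 b2 d2]|c {}f _ [g ag dg]|{}f _ [g ag dg]].
- exists (cderiv n.+1 q); [exact: alg_base|]; apply: csmooth_cder; exact: (proj1 hq).
- by exists (fun x => conjc (g x)); [exact: alg_conj|exact: cder_conj].
- by exists (fun x => g1 x + g2 x); [exact: alg_add|exact: cderD].
- by exists (fun x => g1 x * f2 x + f1 x * g2 x); [apply: alg_add; exact: alg_mul|exact: cderM].
- by exists (fun x => c * g x); [exact: alg_scale|exact: cderZ].
- exists (fun x => - g (- x)); last exact: cder_opp.
  have -> : (fun x => - g (- x)) = (fun x => -1 * g (- x)) by apply/funext => x; rewrite mulN1r.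
  exact: (alg_scale (-1) (alg_opp ag)).
Qed.

Lemma alg_cder f : alg q f -> cder f (cderiv 1 f).
Proof. by move=> /alg_cder_ex[g _ dg]; rewrite (cder_unique dg). Qed.

Lemma alg_cderiv n f : alg q f -> alg q (cderiv n f).
Proof.
elim: n f => [|n IH] f fa; first by rewrite cderiv0.
by rewrite cderivSr; apply: IH; have [g ga dg] := alg_cder_ex fa; rewrite (cder_unique dg).
Qed.

Lemma alg_ccont f : alg q f -> ccont f.
Proof. by move=> /alg_cder /cder_ccont. Qed.

Lemma alg_q : alg q q. Proof. by have := alg_base q 0; rewrite cderiv0. Qed.

Lemma cderivnD n f g : alg q f -> alg q g ->
  cderiv n (fun x => f x + g x) = (fun x => cderiv n f x + cderiv n g x).
Proof.
elim: n f g => [|n IH] f g fa ga; first by rewrite !cderiv0.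
rewrite !(cderivSr n) (cder_unique (cderD (alg_cder fa) (alg_cder ga))).
by apply: IH; exact: alg_cderiv.
Qed.

Lemma cderivnZ n c f : alg q f -> cderiv n (fun x => c * f x) = (fun x => c * cderiv n f x).
Proof.
elim: n f => [|n IH] f fa; first by rewrite !cderiv0.
rewrite !(cderivSr n) (cder_unique (cderZ c (alg_cder fa))).
by apply: IH; exact: alg_cderiv.
Qed.

Lemma cderivn_conj n f : alg q f ->
  cderiv n (fun x => conjc (f x)) = (fun x => conjc (cderiv n f x)).
Proof.
elim: n f => [|n IH] f fa; first by rewrite !cderiv0.
rewrite !(cderivSr n) (cder_unique (cder_conj (alg_cder fa))).
by apply: IH; exact: alg_cderiv.
Qed.

Lemma cderiv1M f g : alg q f -> alg q g ->
  cderiv 1 (fun x => f x * g x) = (fun x => cderiv 1 f x * g x + f x * cderiv 1 g x).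
Proof. by move=> fa ga; rewrite (cder_unique (cderM (alg_cder fa) (alg_cder ga))). Qed.

Lemma cderiv1_opp f : alg q f -> cderiv 1 (fun x => f (- x)) = (fun x => - cderiv 1 f (- x)).
Proof. by move=> fa; rewrite (cder_unique (cder_opp (alg_cder fa))). Qed.

Lemma alg0 : alg q (fun _ => 0).
Proof.
have -> : (fun _ : R => 0 : R[i]) = (fun x => 0 * q x) by apply/funext => x; rewrite mul0r.
exact: alg_scale alg_q.
Qed.

Lemma alg_sum (I : Type) (r : seq I) (F : I -> R -> R[i]) : (forall i, alg q (F i)) ->
  alg q (fun x => \sum_(i <- r) F i x).
Proof.
move=> Fa; elim: r => [|i r IH].
  by under eq_fun do rewrite big_nil; exact: alg0.
by under eq_fun do rewrite big_cons; exact: alg_add.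
Qed.

Lemma cderivn_sum n (I : Type) (r : seq I) (F : I -> R -> R[i]) : (forall i, alg q (F i)) ->
  cderiv n (fun x => \sum_(i <- r) F i x) = (fun x => \sum_(i <- r) cderiv n (F i) x).
Proof.
move=> Fa; elim: r => [|i r IH].
  under [in RHS]eq_fun do rewrite big_nil.
  have -> : (fun x : R => \sum_(i <- [::]) F i x) = (fun x => 0 * q x).
    by apply/funext => x; rewrite big_nil mul0r.
  by rewrite (cderivnZ _ _ alg_q); apply/funext => x; rewrite mul0r.
under [in RHS]eq_fun do rewrite big_cons.
under eq_fun do rewrite big_cons.
by rewrite (cderivnD _ (Fa i) (alg_sum _ Fa)) IH.
Qed.

Lemma alg_sqr_decay f : alg q f -> exists2 C, 0 <= C & forall x : R, cmod (f x) <= C * (1 + x ^+ 2)^-1.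
Proof.
move=> fa; have [C C0 hC] := alg_decay 0 fa; have [D D0 hD] := alg_decay 2 fa.
exists (C + D); first exact: addr_ge0.
move=> x; have p0 : 0 < 1 + x ^+ 2 by rewrite ltr_pwDl// sqr_ge0.
rewrite ler_pdivlMr// mulrDr mulr1.
have := hC x; have := hD x; rewrite real_normK ?num_real// expr0 mul1r [cmod _ * _]mulrC.
lra.
Qed.

Lemma alg_L1 f : alg q f -> cL1 mu f.
Proof.
move=> fa; have [C C0 hC] := alg_sqr_decay fa.
have mf := ccont_meas (alg_ccont fa).
have h := cL1Z C%:C (oneDsqr_L1 R).1.
apply: (@cL1_le _ _ _ mu _ _ mf h) => x; rewrite -rmorphM cmod_real ger0_norm//.
by rewrite mulr_ge0// invr_ge0 addr_ge0// sqr_ge0.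
Qed.

Lemma alg_ctends0 f (u : nat -> R) : alg q f -> (forall n, `|u n| = n%:R) ->
  ctends (fun n => f (u n)) 0.
Proof.
move=> fa un; have [C C0 hC] := alg_decay 0 fa; have [D D0 hD] := alg_decay 1 fa.
apply: (ctends_le (v := fun n => (C + D) * n.+1%:R^-1)); last first.
  rewrite -[X in _ --> X](mulr0 (C + D)); apply: cvgM; first exact: cvg_cst.
  exact: cvg_harmonic.
move=> n; rewrite subr0 ler_pdivlMr ?ltr0n// -natr1 mulrDr mulr1.
have := hC (u n); have := hD (u n); rewrite un expr0 expr1 mul1r [cmod _ * _]mulrC; lra.
Qed.

Lemma alg_cint_cderiv1 f : alg q f -> cint mu (cderiv 1 f) = 0.
Proof.
move=> fa; have da := alg_cderiv 1 fa.
apply: (cint_FTC_full (alg_cder fa) (alg_ccont da) (alg_L1 da)).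
  by apply: alg_ctends0 fa _ => n; rewrite normrN normr_nat.
by apply: alg_ctends0 fa _ => n; rewrite normr_nat.
Qed.

Lemma cint_by_parts n f g : alg q f -> alg q g ->
  cint mu (fun x => f x * cderiv n g x) = (-1) ^+ n * cint mu (fun x => cderiv n f x * g x).
Proof.
elim: n f g => [|n IH] f g fa ga; first by rewrite !cderiv0 mul1r.
have dfa := alg_cderiv 1 fa; have dga := alg_cderiv n ga.
have h := alg_cint_cderiv1 (alg_mul fa dga).
rewrite (cderiv1M fa dga) in h.
have i1 := alg_L1 (alg_mul dfa dga); have i2 := alg_L1 (alg_mul fa (alg_cderiv 1 dga)).
rewrite (cintD i1 i2) in h.
rewrite exprS -mulrA [cderiv n.+1 f]cderivSr -(IH _ _ dfa ga) mulN1r.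
by apply/eqP; rewrite -addr_eq0 addrC; apply/eqP.
Qed.

Lemma PI_step a f t : 0 < Im a -> alg q f ->
  PI a f t = iC / a * f t - iC / a * PI a (cderiv 1 f) t.
Proof.
move=> a0 fa; have a0w := ltW a0; have da := alg_cderiv 1 fa.
have aN0 : a != 0 by apply: contraTneq a0 => ->; rewrite ltxx.
(* The exponential without its cut-off, so that E f is differentiable on the whole line. *)
pose E (x : R) := cexp (- (iC * a) * x%:C + iC * a * t%:C).
have dE : cder E (fun x => - (iC * a) * E x) := cder_cexp _ _.
have dF := cderM dE (alg_cder fa).
have cE := cder_ccont dE; have cF := cder_ccont (cderM dE (alg_cder da)).
have KE (x : R) : Kexp a (t - x) = (x < t)%R%:R * E x.
  rewrite KexpE subr_gt0 /E; congr (_ * cexp _); rewrite rmorphB/=; ring.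
have i1 := okP_L1 t a0w (alg_L1 fa); have i2 := okP_L1 t a0w (alg_L1 da).
have EF x : (x < t)%R%:R * (- (iC * a) * E x * f x + E x * cderiv 1 f x) =
    - (iC * a) * (Kexp a (t - x) * f x) + 1 * (Kexp a (t - x) * cderiv 1 f x).
  by rewrite KE; ring.
have Fi : cL1 mu (fun x => (x < t)%R%:R * (- (iC * a) * E x * f x + E x * cderiv 1 f x)).
  by apply: cL1_ext (cL1D (cL1Z _ i1) (cL1Z _ i2)) => x; exact: esym (EF x).
(* To the left of t the function E coincides with the cut-off kernel, which is bounded by 1, so E f
   inherits the decay of f. *)
have F0 : ctends (fun n => E (- n%:R) * f (- n%:R)) 0.
  have [N hN] := nat_above (- t).
  have h : ctends (fun n => f (- n%:R)) 0.
    by apply: alg_ctends0 fa _ => n; rewrite normrN normr_nat.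
  apply: (ctends_near (u := fun n => Kexp a (t + n%:R) * f (- n%:R)) (N := N)).
    move=> n Nn; have := KE (- n%:R); rewrite opprK => ->.
    by rewrite ltrNl (hN _ Nn) mul1r.
  apply: (le_cvg0 _ h) => n; rewrite !subr0 cmod_ge0 cmodM ler_piMl ?cmod_ge0//.
  exact: Kexp_le1.
have cG : ccont (fun x => - (iC * a) * E x * f x + E x * cderiv 1 f x).
  have := cder_ccont (cderD (cderM (cderZ (- (iC * a)) dE) (alg_cder fa)) (cderM dE (alg_cder da))).
  by [].
have H := cint_FTC_half dF cG Fi F0.
rewrite (_ : cint mu _ = - (iC * a) * PI a f t + 1 * PI a (cderiv 1 f) t) in H; last first.
  by rewrite -(cint_lin2 _ _ i1 i2); apply: cint_ext => x; exact: EF.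
have Et : E t = 1 by rewrite /E mulNr addNr cexp0.
rewrite Et !mul1r in H.
have E2 : iC / a * - (iC * a) = 1.
  rewrite (_ : _ * _ = - (iC * iC) * (a^-1 * a)); last by ring.
  by rewrite iC2 opprK mul1r mulVf.
by rewrite -H mulrDr addrK mulrA E2 mul1r.
Qed.

(** Reflection reverses the sign of the derivative; this is why [QI] expands in k and [PI] in -k. *)
Lemma QI_step a f t : 0 < Im a -> alg q f ->
  QI a f t = iC / a * f t + iC / a * QI a (cderiv 1 f) t.
Proof.
move=> a0 fa; have a0w := ltW a0; have da := alg_cderiv 1 fa.
rewrite (QI_PI (okQ_L1 t a0w (alg_L1 fa))) (QI_PI (okQ_L1 t a0w (alg_L1 da))).
rewrite (PI_step _ a0 (alg_opp fa)) opprK (cderiv1_opp fa).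
have -> : PI a (fun x => - cderiv 1 f (- x)) (- t) = - 1 * PI a (fun x => cderiv 1 f (- x)) (- t).
  rewrite -(PIZ _ (okP_L1 (- t) a0w (alg_L1 (alg_opp da)))).
  by apply: PI_ext => x; rewrite mulN1r.
by rewrite mulN1r mulrN opprK.
Qed.

(* With k = i/a, integration by parts expands [PI a f] in [k * jet (- k) M f] and
   [QI a f] in [k * jet k M f]. *)
Definition jet (k : R[i]) (M : nat) f (x : R) : R[i] := \sum_(i < M) k ^+ i * cderiv i f x.

Lemma jetS k M f x : jet k M.+1 f x = jet k M f x + k ^+ M * cderiv M f x.
Proof. by rewrite /jet big_ord_recr. Qed.

Lemma PI_jet a f M t : 0 < Im a -> alg q f ->
  PI a f t = iC / a * jet (- (iC / a)) M f t + (- (iC / a)) ^+ M * PI a (cderiv M f) t.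
Proof.
move=> a0 fa; elim: M => [|M IH].
  by rewrite /jet big_ord0 mulr0 add0r expr0 mul1r cderiv0.
rewrite IH jetS (PI_step _ a0 (alg_cderiv M fa)) -cderivS exprSr; ring.
Qed.

Lemma QI_jet a f M t : 0 < Im a -> alg q f ->
  QI a f t = iC / a * jet (iC / a) M f t + (iC / a) ^+ M * QI a (cderiv M f) t.
Proof.
move=> a0 fa; elim: M => [|M IH].
  by rewrite /jet big_ord0 mulr0 add0r expr0 mul1r cderiv0.
rewrite IH jetS (QI_step _ a0 (alg_cderiv M fa)) -cderivS exprSr; ring.
Qed.

Lemma alg_jet k M f : alg q f -> alg q (jet k M f).
Proof. by move=> fa; apply: alg_sum => i; apply: alg_scale; exact: alg_cderiv. Qed.

Lemma cmod_mulB (x u y v : R[i]) :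
  cmod (x * u - y * v) <= cmod (x - y) * cmod u + cmod y * cmod (u - v).
Proof.
rewrite (_ : x * u - y * v = (x - y) * u + y * (u - v)); last by ring.
by apply: le_trans (cmodD _ _) _; rewrite !cmodM.
Qed.

Lemma cmod_mulB_le (x u y v : R[i]) (A B D E : R) : cmod u <= B -> cmod y <= A ->
  cmod (x - y) <= D -> cmod (u - v) <= E -> cmod (x * u - y * v) <= D * B + A * E.
Proof.
move=> uB yA xy uv; apply: le_trans (cmod_mulB _ _ _ _) _.
by apply: lerD; apply: ler_pM => //; exact: cmod_ge0.
Qed.

Lemma cint_mulB_le f (Z Z' : R -> R[i]) (K D : R) : cL1 mu f -> cmeasurable Z -> cmeasurable Z' ->
  (forall x, cmod (Z x) <= K) -> (forall x, cmod (Z x - Z' x) <= D) ->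
  cmod (cint mu (fun x => f x * Z x) - cint mu (fun x => f x * Z' x)) <= D * Nint mu f.
Proof.
move=> fi mZ mZ' bZ bD.
have bZ' x : cmod (Z' x) <= D + K.
  rewrite (_ : Z' x = (Z' x - Z x) + Z x); last by ring.
  by apply: le_trans (cmodD _ _) _; rewrite cmodBC lerD.
have D0 : 0 <= D by apply: le_trans (bD 0); exact: cmod_ge0.
have i1 := cL1Mbd fi mZ bZ; have i2 := cL1Mbd fi mZ' bZ'.
have i3 := cL1Mbd fi (cmeasB mZ mZ') bD.
rewrite -(cintB i1 i2) (_ : cint mu _ = cint mu (fun x => f x * (Z x - Z' x))); last first.
  by apply: cint_ext => x; rewrite mulrBr.
apply: (cmod_cint_le i3).
have -> : D * Nint mu f = Nint mu (fun x => D%:C * f x).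
  by rewrite (NintZ _ fi) cmod_real ger0_norm.
apply: (le_Nint i3 (cL1Z _ fi)) => x.
by rewrite mulrC !cmodM ler_wpM2r ?cmod_ge0// cmod_real [leRHS]ger0_norm.
Qed.

Lemma Nint_mul_le f (Z : R -> R[i]) (D : R) : cL1 mu f -> cmeasurable Z ->
  (forall x, cmod (Z x) <= D) -> Nint mu (fun x => f x * Z x) <= D * Nint mu f.
Proof.
move=> fi mZ bD; have D0 : 0 <= D by apply: le_trans (bD 0); exact: cmod_ge0.
have -> : D * Nint mu f = Nint mu (fun x => D%:C * f x).
  by rewrite (NintZ _ fi) cmod_real ger0_norm.
apply: (le_Nint (cL1Mbd fi mZ bD) (cL1Z _ fi)) => x.
by rewrite mulrC !cmodM ler_wpM2r ?cmod_ge0// cmod_real [leRHS]ger0_norm.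
Qed.

Lemma jetZ k M c f x : alg q f -> jet k M (fun x => c * f x) x = c * jet k M f x.
Proof.
move=> fa; rewrite /jet mulr_sumr; apply: eq_bigr => i _.
by rewrite (cderivnZ _ c fa) mulrCA.
Qed.

(** * The truncation error, uniform in a *)

Section Truncation.
(** One constant C bounds all the data, so that every estimate is a polynomial in C times |k|^M. In
    [b6_expansion] it is chosen before lambda. *)
Variables (a : R[i]) (M : nat) (C : R).
Hypothesis a0 : 0 < Im a.
Local Notation k := (iC / a).
Local Notation qc := (fun x => conjc (q x)).
Local Notation P := (PI a qc).
Local Notation Q := (QI a q).
Local Notation p := (jet (- k) M qc).
Local Notation s := (jet k M q).
Hypothesis k1 : cmod k <= 1.
Hypothesis hN : Nint mu q <= C.
Hypothesis hp : forall x, cmod (p x) <= C.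
Hypothesis hs : forall x, cmod (s x) <= C.
Hypothesis hM : Nint mu (cderiv M q) <= C.
Hypothesis hG : Nint mu (cderiv M (fun x => q x * (p x * p x))) <= C.

Let dl := cmod k ^+ M.
Let P' x := k * p x.
Let Q' x := k * s x.
Let X' x := k * jet (- k) M (fun x => q x * (P' x * P' x)) x.
Let X := PI a (fun x => q x * P x * P x).

Let qa := alg_q.
Let qca : alg q qc. Proof. exact: alg_conj qa. Qed.
Let a0w := ltW a0.
Let C0 : 0 <= C. Proof. exact: le_trans (Nint_ge0 _ _) hN. Qed.
Let dl0 : 0 <= dl. Proof. exact: exprn_ge0 (cmod_ge0 _). Qed.
Let dl1 : dl <= 1. Proof. by apply: exprn_ile1 => //; exact: cmod_ge0. Qed.

Let Nqc (f : R -> R[i]) : Nint mu (fun x => conjc (f x)) = Nint mu f.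
Proof.
by rewrite !NintE; apply: eq_Rintegral => x _; rewrite cmod_conjc.
Qed.

Let bP x : cmod (P x) <= C.
Proof. by apply: le_trans (PI_bd_L1 x a0w (alg_L1 qca)) _; rewrite Nqc. Qed.
Let bQ x : cmod (Q x) <= C.
Proof. by apply: le_trans (QI_bd_L1 x a0w (alg_L1 qa)) _. Qed.
Let bP' x : cmod (P' x) <= C.
Proof. by rewrite cmodM -[leRHS]mul1r ler_pM ?cmod_ge0. Qed.
Let bQ' x : cmod (Q' x) <= C.
Proof. by rewrite cmodM -[leRHS]mul1r ler_pM ?cmod_ge0. Qed.

Let dP x : cmod (P x - P' x) <= C * dl.
Proof.
rewrite (PI_jet M x a0 qca) addrC addKr cmodM cmodX cmodN mulrC ler_wpM2r//.
have := PI_bd_L1 x a0w (alg_L1 (alg_cderiv M qca)).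
by rewrite (cderivn_conj _ qa) Nqc => h; exact: le_trans h hM.
Qed.

Let dQ x : cmod (Q x - Q' x) <= C * dl.
Proof.
rewrite (QI_jet M x a0 qa) addrC addKr cmodM cmodX mulrC ler_wpM2r//.
exact: le_trans (QI_bd_L1 x a0w (alg_L1 (alg_cderiv M qa))) hM.
Qed.

Let mP : cmeasurable P. Proof. exact: cmeas_PI (cL1_measurable (alg_L1 qca)). Qed.
Let mQ : cmeasurable Q. Proof. exact: cmeas_QI (cL1_measurable (alg_L1 qa)). Qed.
Let P'a : alg q P'. Proof. exact: alg_scale (alg_jet _ _ qca). Qed.
Let Q'a : alg q Q'. Proof. exact: alg_scale (alg_jet _ _ qa). Qed.
Let mP' : cmeasurable P'. Proof. exact: cL1_measurable (alg_L1 P'a). Qed.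
Let mQ' : cmeasurable Q'. Proof. exact: cL1_measurable (alg_L1 Q'a). Qed.

Let P2_bd x : cmod (P x * P x) <= C * C.
Proof. by rewrite cmodM ler_pM ?cmod_ge0. Qed.

Let dP2 x : cmod (P x * P x - P' x * P' x) <= 2 * C ^+ 2 * dl.
Proof.
apply: le_trans (cmod_mulB_le (bP x) (bP' x) (dP x) (dP x)) _.
by rewrite le_eqVlt; apply/orP; left; apply/eqP; ring.
Qed.

Let dQ2 x : cmod (Q x * Q x - Q' x * Q' x) <= 2 * C ^+ 2 * dl.
Proof.
apply: le_trans (cmod_mulB_le (bQ x) (bQ' x) (dQ x) (dQ x)) _.
by rewrite le_eqVlt; apply/orP; left; apply/eqP; ring.
Qed.

Let X_bd x : cmod (X x) <= C ^+ 3.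
Proof.
have qi := alg_L1 qa; have i := cL1Mbd qi (cmeasM mP mP) P2_bd.
have -> : X x = PI a (fun x => q x * (P x * P x)) x by apply: PI_ext => y; ring.
apply: le_trans (PI_bd_L1 x a0w i) _.
apply: le_trans (Nint_mul_le qi (cmeasM mP mP) P2_bd) _.
by rewrite (_ : C ^+ 3 = C * C * C); [apply: ler_wpM2l => //; exact: mulr_ge0|ring].
Qed.

(** Two errors add up: the replacement of P by P' under the outer [PI], and the jet remainder of
    that [PI]. The M-th derivative in the remainder is k^2 times the one bounded by [hG]. *)
Let dX x : cmod (X x - X' x) <= (2 * C ^+ 3 + C) * dl.
Proof.
have qi := alg_L1 qa; have i := cL1Mbd qi (cmeasM mP mP) P2_bd.
have Ga := alg_mul qa (alg_mul P'a P'a); have j := alg_L1 Ga.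
have E1 : X x - X' x = PI a (fun x => q x * (P x * P x - P' x * P' x)) x +
    (- k) ^+ M * (k ^+ 2 * PI a (cderiv M (fun x => q x * (p x * p x))) x).
  have -> : X x = PI a (fun x => q x * (P x * P x - P' x * P' x)) x +
      PI a (fun x => q x * (P' x * P' x)) x.
    rewrite -PID; first by apply: PI_ext => y; ring.
      apply: okP_L1 => //; apply: cL1_ext (cL1B i j) => y; ring.
    exact: okP_L1.
  rewrite (PI_jet M x a0 Ga) -/(X' x) addrA addrAC addrK; congr (_ + _ * _).
  have ga := alg_mul qa (alg_mul (alg_jet (- k) M qca) (alg_jet (- k) M qca)).
  rewrite -(PIZ _ (okP_L1 x a0w (alg_L1 (alg_cderiv M ga)))); apply: PI_ext => y.
  rewrite -[RHS]/((fun x => k ^+ 2 * cderiv M (fun x => q x * (p x * p x)) x) y).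
  rewrite -(cderivnZ M (k ^+ 2) ga); congr (cderiv M _ y); apply/funext => z.
  rewrite /P'; ring.
have b1 : cmod (PI a (fun x => q x * (P x * P x - P' x * P' x)) x) <= 2 * C ^+ 3 * dl.
  have md := cmeasB (cmeasM mP mP) (cmeasM mP' mP').
  apply: le_trans (PI_bd_L1 x a0w (cL1Mbd qi md dP2)) _.
  apply: le_trans (Nint_mul_le qi md dP2) _.
  rewrite (_ : 2 * C ^+ 3 * dl = 2 * C ^+ 2 * dl * C); last by ring.
  by apply: ler_wpM2l => //; rewrite !mulr_ge0// exprn_ge0.
rewrite E1; apply: le_trans (cmodD _ _) _; rewrite mulrDl; apply: lerD => //.
have ga := alg_mul qa (alg_mul (alg_jet (- k) M qca) (alg_jet (- k) M qca)).
have b2 := le_trans (PI_bd_L1 x a0w (alg_L1 (alg_cderiv M ga))) hG.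
rewrite [leLHS]cmodM [cmod ((- k) ^+ M)]cmodX cmodN -/dl mulrC ler_wpM2r//.
rewrite [leLHS]cmodM [cmod (k ^+ 2)]cmodX -[leRHS]mul1r ler_pM ?exprn_ge0 ?cmod_ge0//.
exact: exprn_ile1 (cmod_ge0 _) k1.
Qed.

Let mX : cmeasurable X.
Proof. by apply: cmeas_PI; apply: cmeasM => //; apply: cmeasM => //; exact: cL1_measurable (alg_L1 qa). Qed.
Let X'a : alg q X'.
Proof. exact: alg_scale (alg_jet _ _ (alg_mul qa (alg_mul P'a P'a))). Qed.
Let mX' : cmeasurable X'. Proof. exact: cL1_measurable (alg_L1 X'a). Qed.

Let Q2_bd x : cmod (Q x * Q x) <= C ^+ 2.
Proof. by rewrite cmodM expr2 ler_pM ?cmod_ge0. Qed.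

Let P2'_bd x : cmod (P' x * P' x) <= C ^+ 2.
Proof. by rewrite cmodM expr2 ler_pM ?cmod_ge0. Qed.

Let Q2'_bd x : cmod (Q' x * Q' x) <= C ^+ 2.
Proof. by rewrite cmodM expr2 ler_pM ?cmod_ge0. Qed.

(** The first integrand has five factors, each replaced at a cost of C^5 |k|^M. The second costs 2
    C^5 for the two factors Q and C^2 (2 C^3 + C) for X. The norm of q contributes one more C. *)
Lemma truncation_error :
  cmod (cint mu (fun x => q x * P x ^+ 3 * Q x ^+ 2) +
    cint mu (fun x => qc x * Q x ^+ 2 * X x) -
    k ^+ 5 * (cint mu (fun x => q x * (p x ^+ 3 * s x ^+ 2)) +
      cint mu (fun x => qc x * (s x ^+ 2 * jet (- k) M (fun x => q x * (p x * p x)) x)))) <=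
  (9 * C ^+ 6 + C ^+ 4) * dl.
Proof.
have qi := alg_L1 qa; have qci := alg_L1 qca.
have pa := alg_jet (- k) M qca; have sa := alg_jet k M qa.
have ga := alg_mul qa (alg_mul pa pa).
pose Z1 x := P x * (P x * P x) * (Q x * Q x).
pose Z1' x := P' x * (P' x * P' x) * (Q' x * Q' x).
pose Z2 x := Q x * Q x * X x.
pose Z2' x := Q' x * Q' x * X' x.
have Z1i' : cL1 mu (fun x => q x * (p x ^+ 3 * s x ^+ 2)).
  apply: cL1_ext (alg_L1 (alg_mul qa (alg_mul (alg_mul pa (alg_mul pa pa)) (alg_mul sa sa)))) => x.
  ring.
have Z2i' : cL1 mu (fun x => qc x * (s x ^+ 2 * jet (- k) M (fun x => q x * (p x * p x)) x)).
  apply: cL1_ext (alg_L1 (alg_mul qca (alg_mul (alg_mul sa sa) (alg_jet (- k) M ga)))) => x.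
  ring.
have E1 : k ^+ 5 * cint mu (fun x => q x * (p x ^+ 3 * s x ^+ 2)) =
    cint mu (fun x => q x * Z1' x).
  rewrite -(cintZ _ Z1i'); apply: cint_ext => x; rewrite /Z1' /P' /Q'; ring.
have JX x : X' x = k ^+ 3 * jet (- k) M (fun x => q x * (p x * p x)) x.
  have -> : X' x = k * jet (- k) M (fun x => k ^+ 2 * (q x * (p x * p x))) x.
    by rewrite /X'; congr (_ * jet _ _ _ x); apply/funext => z; rewrite /P'; ring.
  by rewrite (jetZ _ _ _ _ ga) mulrA -exprS.
have E2 : k ^+ 5 * cint mu (fun x => qc x * (s x ^+ 2 * jet (- k) M (fun x => q x * (p x * p x)) x)) =
    cint mu (fun x => qc x * Z2' x).
  rewrite -(cintZ _ Z2i'); apply: cint_ext => x; rewrite /Z2' JX /Q'; ring.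
have mZ1 : cmeasurable Z1 := cmeasM (cmeasM mP (cmeasM mP mP)) (cmeasM mQ mQ).
have mZ1' : cmeasurable Z1' := cmeasM (cmeasM mP' (cmeasM mP' mP')) (cmeasM mQ' mQ').
have mZ2 : cmeasurable Z2 := cmeasM (cmeasM mQ mQ) mX.
have mZ2' : cmeasurable Z2' := cmeasM (cmeasM mQ' mQ') mX'.
have P3_bd x : cmod (P x * (P x * P x)) <= C ^+ 3.
  by rewrite cmodM exprS ler_pM ?cmod_ge0// expr2.
have P3'_bd x : cmod (P' x * (P' x * P' x)) <= C ^+ 3.
  by rewrite cmodM exprS ler_pM ?cmod_ge0// expr2 -expr2.
have dP3 x : cmod (P x * (P x * P x) - P' x * (P' x * P' x)) <= 3 * C ^+ 3 * dl.
  apply: le_trans (cmod_mulB_le (P2_bd x) (bP' x) (dP x) (dP2 x)) _.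
  by rewrite le_eqVlt; apply/orP; left; apply/eqP; ring.
have bZ1 x : cmod (Z1 x) <= C ^+ 3 * C ^+ 2 by rewrite cmodM ler_pM ?cmod_ge0.
have bZ2 x : cmod (Z2 x) <= C ^+ 2 * C ^+ 3 by rewrite cmodM ler_pM ?cmod_ge0.
have dZ1 x : cmod (Z1 x - Z1' x) <= 5 * C ^+ 5 * dl.
  apply: le_trans (cmod_mulB_le (Q2_bd x) (P3'_bd x) (dP3 x) (dQ2 x)) _.
  by rewrite le_eqVlt; apply/orP; left; apply/eqP; ring.
have dZ2 x : cmod (Z2 x - Z2' x) <= (4 * C ^+ 5 + C ^+ 3) * dl.
  apply: le_trans (cmod_mulB_le (X_bd x) (Q2'_bd x) (dQ2 x) (dX x)) _.
  by rewrite le_eqVlt; apply/orP; left; apply/eqP; ring.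
have b1 := cint_mulB_le qi mZ1 mZ1' bZ1 dZ1.
have b2 := cint_mulB_le qci mZ2 mZ2' bZ2 dZ2.
rewrite mulrDr E1 E2 opprD addrACA.
have -> : cint mu (fun x => q x * P x ^+ 3 * Q x ^+ 2) = cint mu (fun x => q x * Z1 x).
  by apply: cint_ext => x; rewrite /Z1; ring.
have -> : cint mu (fun x => qc x * Q x ^+ 2 * X x) = cint mu (fun x => qc x * Z2 x).
  by apply: cint_ext => x; rewrite /Z2; ring.
apply: le_trans (cmodD _ _) _; apply: le_trans (lerD b1 b2) _; rewrite Nqc -mulrDl.
rewrite (_ : (9 * C ^+ 6 + C ^+ 4) * dl = (5 * C ^+ 5 * dl + (4 * C ^+ 5 + C ^+ 3) * dl) * C).
  apply: ler_wpM2l => //; by rewrite addr_ge0// !mulr_ge0// ?addr_ge0 ?mulr_ge0 ?exprn_ge0.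
by ring.
Qed.

End Truncation.

(** * The expansion as a polynomial in k *)

Local Notation qc := (fun x => conjc (q x)).

(** With [B5], the two integrals of [b6_position] after P and Q are replaced by jets and the five
    factors k are taken out. *)
Definition A5 (k : R[i]) (M : nat) : R[i] :=
  cint mu (fun x => q x * (jet (- k) M qc x ^+ 3 * jet k M q x ^+ 2)).

Definition B5 (k : R[i]) (M : nat) : R[i] :=
  cint mu (fun x => qc x * (jet k M q x ^+ 2 *
    jet (- k) M (fun x => q x * (jet (- k) M qc x * jet (- k) M qc x)) x)).

Definition quintic (a1 a2 a3 a4 a5 : nat) (x : R) : R[i] :=
  cderiv a1 q x * cderiv a2 q x * q x *
    conjc (cderiv a3 q x * cderiv a4 q x * cderiv a5 q x) +
  cderiv a1 q x * cderiv a2 q x * conjc (q x) *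
    cderiv a3 (fun t => q t * conjc (cderiv a4 q t * cderiv a5 q t)) x.

Lemma alg_quintic (a1 a2 a3 a4 a5 : nat) : alg q (quintic a1 a2 a3 a4 a5).
Proof.
have d n : alg q (cderiv n q) := alg_base q n.
have qa := alg_q; have qca := alg_conj qa.
apply: alg_add.
  exact: (alg_mul (alg_mul (alg_mul (d _) (d _)) qa) (alg_conj (alg_mul (alg_mul (d _) (d _)) (d _)))).
apply: (alg_mul (alg_mul (alg_mul (d _) (d _)) qca)); apply: alg_cderiv.
exact: (alg_mul qa (alg_conj (alg_mul (d _) (d _)))).
Qed.

Lemma prod_sum5 (M : nat) (F1 F2 F3 F4 F5 : nat -> R[i]) :
  (\sum_(i < M) F1 i) * ((\sum_(i < M) F2 i) * ((\sum_(i < M) F3 i) *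
    ((\sum_(i < M) F4 i) * (\sum_(i < M) F5 i)))) =
  \sum_(a1 < M) \sum_(a2 < M) \sum_(a3 < M) \sum_(a4 < M) \sum_(a5 < M)
    F1 a1 * (F2 a2 * (F3 a3 * (F4 a4 * F5 a5))).
Proof.
rewrite mulr_suml; apply: eq_bigr => a1 _.
rewrite mulr_suml [F1 a1 * _]mulr_sumr; apply: eq_bigr => a2 _.
rewrite mulr_suml [F2 a2 * _]mulr_sumr [F1 a1 * _]mulr_sumr; apply: eq_bigr => a3 _.
rewrite mulr_suml [F3 a3 * _]mulr_sumr [F2 a2 * _]mulr_sumr [F1 a1 * _]mulr_sumr.
apply: eq_bigr => a4 _.
rewrite [F4 a4 * _]mulr_sumr [F3 a3 * _]mulr_sumr [F2 a2 * _]mulr_sumr.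
by rewrite [F1 a1 * _]mulr_sumr; apply: eq_bigr.
Qed.

Lemma jet_conj k M x : jet k M qc x = \sum_(i < M) k ^+ i * conjc (cderiv i q x).
Proof. by apply: eq_bigr => i _; rewrite (cderivn_conj _ alg_q). Qed.

Lemma alg_quadratic i j : alg q (fun t => q t * conjc (cderiv i q t * cderiv j q t)).
Proof. exact: (alg_mul alg_q (alg_conj (alg_mul (alg_base q i) (alg_base q j)))). Qed.

Lemma cderiv_qpp n k M x :
  cderiv n (fun x => q x * (jet k M qc x * jet k M qc x)) x =
  \sum_(i < M) \sum_(j < M) k ^+ (i + j) *
    cderiv n (fun t => q t * conjc (cderiv i q t * cderiv j q t)) x.
Proof.
have -> : (fun x => q x * (jet k M qc x * jet k M qc x)) =
    (fun x => \sum_(i < M) \sum_(j < M) k ^+ (i + j) *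
      (q x * conjc (cderiv i q x * cderiv j q x))).
  apply/funext => y; rewrite !jet_conj mulr_suml mulr_sumr; apply: eq_bigr => i _.
  rewrite !mulr_sumr; apply: eq_bigr => j _; rewrite conjcM exprD; ring.
have gz (i j : 'I_M) : alg q (fun x => k ^+ (i + j) * (q x * conjc (cderiv i q x * cderiv j q x))).
  exact: alg_scale (alg_quadratic i j).
have gs (i : 'I_M) : alg q (fun x => \sum_(j < M) k ^+ (i + j) *
    (q x * conjc (cderiv i q x * cderiv j q x))).
  by apply: alg_sum => j; exact: gz.
rewrite (cderivn_sum n _ gs); apply: eq_bigr => i _.
rewrite (cderivn_sum n _ (gz i)); apply: eq_bigr => j _.
by rewrite (cderivnZ n _ (alg_quadratic i j)).
Qed.

Lemma jet_qpp k M x :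
  jet k M (fun x => q x * (jet k M qc x * jet k M qc x)) x =
  \sum_(a3 < M) \sum_(a4 < M) \sum_(a5 < M) k ^+ (a3 + a4 + a5) *
    cderiv a3 (fun t => q t * conjc (cderiv a4 q t * cderiv a5 q t)) x.
Proof.
apply: eq_bigr => a3 _; rewrite cderiv_qpp mulr_sumr; apply: eq_bigr => i _.
by rewrite mulr_sumr; apply: eq_bigr => j _; rewrite mulrA -exprD addnA.
Qed.

Lemma quintic_expansion k M x :
  q x * (jet (- k) M qc x ^+ 3 * jet k M q x ^+ 2) +
  qc x * (jet k M q x ^+ 2 *
    jet (- k) M (fun x => q x * (jet (- k) M qc x * jet (- k) M qc x)) x) =
  \sum_(a1 < M) \sum_(a2 < M) \sum_(a3 < M) \sum_(a4 < M) \sum_(a5 < M)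
    k ^+ (a1 + a2 + a3 + a4 + a5) * ((-1) ^+ (a3 + a4 + a5) * quintic a1 a2 a3 a4 a5 x).
Proof.
pose s (i : nat) := k ^+ i * cderiv i q x; pose p (i : nat) := (- k) ^+ i * conjc (cderiv i q x).
have -> : q x * (jet (- k) M qc x ^+ 3 * jet k M q x ^+ 2) =
  \sum_(a1 < M) \sum_(a2 < M) \sum_(a3 < M) \sum_(a4 < M) \sum_(a5 < M)
    q x * (s a1 * (s a2 * (p a3 * (p a4 * p a5)))).
  rewrite jet_conj; transitivity (q x * ((\sum_(i < M) s i) * ((\sum_(i < M) s i) *
    ((\sum_(i < M) p i) * ((\sum_(i < M) p i) * (\sum_(i < M) p i)))))).
    by rewrite /jet; ring.
  rewrite prod_sum5 mulr_sumr; apply: eq_bigr => a1 _.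
  by rewrite mulr_sumr; apply: eq_bigr => a2 _; rewrite mulr_sumr; apply: eq_bigr => a3 _;
    rewrite mulr_sumr; apply: eq_bigr => a4 _; rewrite mulr_sumr.
have -> : qc x * (jet k M q x ^+ 2 *
    jet (- k) M (fun x => q x * (jet (- k) M qc x * jet (- k) M qc x)) x) =
  \sum_(a1 < M) \sum_(a2 < M) \sum_(a3 < M) \sum_(a4 < M) \sum_(a5 < M)
    qc x * (s a1 * (s a2 * ((- k) ^+ (a3 + a4 + a5) *
      cderiv a3 (fun t => q t * conjc (cderiv a4 q t * cderiv a5 q t)) x))).
  rewrite jet_qpp expr2 -!mulrA [jet k M q x]/jet mulr_suml mulr_sumr; apply: eq_bigr => a1 _.
  rewrite mulr_suml !mulr_sumr; apply: eq_bigr => a2 _.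
  by rewrite !mulr_sumr; apply: eq_bigr => a3 _; rewrite !mulr_sumr; apply: eq_bigr => a4 _;
    rewrite !mulr_sumr; apply: eq_bigr => a5 _.
do 5 (rewrite -big_split; apply: eq_bigr => ? _ /=).
rewrite /s /p /quintic !conjcM -[- k]mulN1r !exprMn !exprD; ring.
Qed.

Definition quintic_poly (M : nat) : {poly R[i]} :=
  \sum_(a1 < M) \sum_(a2 < M) \sum_(a3 < M) \sum_(a4 < M) \sum_(a5 < M)
    ((-1) ^+ (a3 + a4 + a5) * cint mu (quintic a1 a2 a3 a4 a5)) *: 'X^(a1 + a2 + a3 + a4 + a5).

Lemma A5_B5 k M : A5 k M + B5 k M = (quintic_poly M).[k].
Proof.
have qa := alg_q; have qca := alg_conj qa.
have pa := alg_jet (- k) M qca; have sa := alg_jet k M qa.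
have i1 : cL1 mu (fun x => q x * (jet (- k) M qc x ^+ 3 * jet k M q x ^+ 2)).
  apply: cL1_ext (alg_L1 (alg_mul qa (alg_mul (alg_mul pa (alg_mul pa pa)) (alg_mul sa sa)))) => x.
  ring.
have i2 : cL1 mu (fun x => qc x * (jet k M q x ^+ 2 *
    jet (- k) M (fun x => q x * (jet (- k) M qc x * jet (- k) M qc x)) x)).
  apply: cL1_ext (alg_L1 (alg_mul qca (alg_mul (alg_mul sa sa)
    (alg_jet (- k) M (alg_mul qa (alg_mul pa pa)))))) => x.
  ring.
rewrite /A5 /B5 -(cintD i1 i2).
transitivity (cint mu (fun x => \sum_(a1 < M) \sum_(a2 < M) \sum_(a3 < M) \sum_(a4 < M)
    \sum_(a5 < M) k ^+ (a1 + a2 + a3 + a4 + a5) *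
      ((-1) ^+ (a3 + a4 + a5) * quintic a1 a2 a3 a4 a5 x))).
  by apply: cint_ext => x; rewrite -quintic_expansion.
have ta (a1 a2 a3 a4 a5 : nat) : alg q (fun x => k ^+ (a1 + a2 + a3 + a4 + a5) *
    ((-1) ^+ (a3 + a4 + a5) * quintic a1 a2 a3 a4 a5 x)).
  exact: alg_scale (alg_scale _ (alg_quintic _ _ _ _ _)).
rewrite /quintic_poly !horner_sum cint_sum => [|a1 _]; last first.
  by apply: alg_L1; do 4 apply: alg_sum => ?; exact: ta.
apply: eq_bigr => a1 _; rewrite !horner_sum cint_sum => [|a2 _]; last first.
  by apply: alg_L1; do 3 apply: alg_sum => ?; exact: ta.
apply: eq_bigr => a2 _; rewrite !horner_sum cint_sum => [|a3 _]; last first.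
  by apply: alg_L1; do 2 apply: alg_sum => ?; exact: ta.
apply: eq_bigr => a3 _; rewrite !horner_sum cint_sum => [|a4 _]; last first.
  by apply: alg_L1; apply: alg_sum => ?; exact: ta.
apply: eq_bigr => a4 _; rewrite !horner_sum cint_sum => [|a5 _]; last first.
  by apply: alg_L1; exact: ta.
apply: eq_bigr => a5 _.
have h := alg_L1 (alg_quintic a1 a2 a3 a4 a5).
by rewrite (cintZ _ (cL1Z _ h)) (cintZ _ h) hornerZ hornerXn mulrC.
Qed.

Definition quintic_sum (j : nat) : R[i] :=
  \sum_(a1 < j.+1) \sum_(a2 < j.+1) \sum_(a3 < j.+1) \sum_(a4 < j.+1)
    \sum_(a5 < j.+1 | (a1 + a2 + a3 + a4 + a5 + 4 == j)%N)
      (-1) ^+ (a1 + a2) * cint mu (quintic a1 a2 a3 a4 a5).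

Lemma H6E j : H6 q j = Re ((- iC) ^+ j * quintic_sum j).
Proof.
rewrite /H6 /quintic_sum; congr (Re (_ * _)).
by do 5 (apply: eq_bigr => ? _); rewrite cintE.
Qed.

Lemma big_ord_extend (n M : nat) (G : nat -> R[i]) : (n <= M)%N ->
  (forall i, (n <= i)%N -> G i = 0) -> \sum_(i < n) G i = \sum_(i < M) G i.
Proof.
move=> nM G0; rewrite (big_ord_widen M G nM) big_mkcond; apply: eq_bigr => i _.
by case: ltnP => // /G0.
Qed.

(** In degree m one has (-1)^(a3 + a4 + a5) = (-1)^m (-1)^(a1 + a2), which reconciles jets in -k
    with the sign in H_j. For j = m + 4 < M the index range 0..j of H_j fits below M, and the
    additional terms have degree larger than m. *)
Lemma quintic_poly_coef M m : (m + 4 < M)%N ->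
  (quintic_poly M)`_m = (-1) ^+ m * quintic_sum (m + 4).
Proof.
move=> mM; pose j := (m + 4)%N.
pose t (a1 a2 a3 a4 a5 : nat) : R[i] := if (a1 + a2 + a3 + a4 + a5 + 4 == j)%N then
  (-1) ^+ (a1 + a2) * cint mu (quintic a1 a2 a3 a4 a5) else 0.
have t0 (a1 a2 a3 a4 a5 : nat) : (j < a1 + a2 + a3 + a4 + a5)%N -> t a1 a2 a3 a4 a5 = 0.
  rewrite /t; case: eqP => // <-; lia.
have -> : quintic_sum (m + 4) =
  \sum_(a1 < M) \sum_(a2 < M) \sum_(a3 < M) \sum_(a4 < M) \sum_(a5 < M) t a1 a2 a3 a4 a5.
  transitivity (\sum_(a1 < j.+1) \sum_(a2 < j.+1) \sum_(a3 < j.+1) \sum_(a4 < j.+1)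
      \sum_(a5 < j.+1) t a1 a2 a3 a4 a5).
    by do 4 (apply: eq_bigr => ? _); rewrite big_mkcond.
  rewrite (big_ord_extend (G := fun a1 : nat => \sum_(a2 < j.+1) \sum_(a3 < j.+1) \sum_(a4 < j.+1)
      \sum_(a5 < j.+1) t a1 a2 a3 a4 a5) mM); last first.
    by move=> a1 h; do 4 (apply: big1 => ? _); apply: t0; lia.
  apply: eq_bigr => a1 _; rewrite (big_ord_extend (G := fun a2 : nat => \sum_(a3 < j.+1) \sum_(a4 < j.+1)
      \sum_(a5 < j.+1) t a1 a2 a3 a4 a5) mM); last first.
    by move=> a2 h; do 3 (apply: big1 => ? _); apply: t0; lia.
  apply: eq_bigr => a2 _; rewrite (big_ord_extend (G := fun a3 : nat => \sum_(a4 < j.+1)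
      \sum_(a5 < j.+1) t a1 a2 a3 a4 a5) mM); last first.
    by move=> a3 h; do 2 (apply: big1 => ? _); apply: t0; lia.
  apply: eq_bigr => a3 _; rewrite (big_ord_extend (G := fun a4 : nat =>
      \sum_(a5 < j.+1) t a1 a2 a3 a4 a5) mM); last first.
    by move=> a4 h; apply: big1 => ? _; apply: t0; lia.
  apply: eq_bigr => a4 _; rewrite (big_ord_extend (G := fun a5 : nat => t a1 a2 a3 a4 a5) mM)//.
  by move=> a5 h; apply: t0; lia.
rewrite /quintic_poly coef_sum mulr_sumr; apply: eq_bigr => a1 _.
rewrite coef_sum mulr_sumr; apply: eq_bigr => a2 _.
rewrite coef_sum mulr_sumr; apply: eq_bigr => a3 _.
rewrite coef_sum mulr_sumr; apply: eq_bigr => a4 _.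
rewrite coef_sum mulr_sumr; apply: eq_bigr => a5 _.
rewrite coefZ coefXn /t /j eqn_add2r eq_sym; case: eqP => [<-|_]; last by rewrite !mulr0.
rewrite mulr1 mulrA -exprD; congr (_ * _).
rewrite -signr_odd -[RHS]signr_odd !oddD.
by case: (odd a1); case: (odd a2); case: (odd a3); case: (odd a4); case: (odd a5).
Qed.

(** * Polynomial estimates and reality of the coefficients *)

Lemma horner_le (p : {poly R[i]}) (x : R[i]) : cmod x <= 1 ->
  cmod p.[x] <= \sum_(i < size p) cmod p`_i.
Proof.
move=> x1; rewrite horner_coef; apply: le_trans (cmod_sum _ _ _) _.
apply: ler_sum => i _; rewrite cmodM cmodX ler_piMr ?cmod_ge0//.
exact: exprn_ile1 (cmod_ge0 _) x1.
Qed.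

(** The constant term vanishes in the limit t -> 0; removing it and dividing by t lowers M by
    one. *)
Lemma poly_small_coef (p : {poly R}) (M : nat) (K : R) :
  (forall t, 0 < t <= 1 -> `|p.[t]| <= K * t ^+ M) -> forall m, (m < M)%N -> p`_m = 0.
Proof.
elim: M p => [//|M IH] p hp.
pose d := drop_poly 1 p; pose L := \sum_(i < size d) `|d`_i|.
have pE t : p.[t] = p`_0 + t * d.[t].
  rewrite -[in LHS](poly_take_drop 1 p) hornerD hornerM hornerXn mulrC; congr (_ + _).
  have -> : take_poly 1 p = (p`_0)%:P; last by rewrite hornerC.
  by apply/polyP => -[|i]; rewrite coef_take_poly coefC.
have dL t : 0 < t <= 1 -> `|d.[t]| <= L.
  case/andP => t0 t1; rewrite horner_coef; apply: le_trans (ler_norm_sum _ _ _) _.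
  apply: ler_sum => i _; rewrite normrM ler_piMr// normrX ger0_norm ?(ltW t0)//.
  by apply: exprn_ile1 => //; exact: ltW.
have t1 : 0 < (1 : R) <= 1 by rewrite ltr01 lexx.
have K0 : 0 <= K by have := le_trans (normr_ge0 _) (hp 1 t1); rewrite expr1n mulr1.
have L0 : 0 <= L := le_trans (normr_ge0 _) (dL 1 t1).
have p0 : p`_0 = 0.
  apply/eqP; rewrite -normr_le0 leNgt; apply/negP => c0.
  (* For this t the bound t (K + L) on the constant term is at most half of that term; the added 1
     keeps the denominator positive. *)
  pose t := Num.min 1 (`|p`_0| / (2 * (K + L + 1))).
  have KL1 : 0 < K + L + 1 by lra.
  have t0 : 0 < t by rewrite lt_min ltr01 divr_gt0// mulr_gt0.
  have tt : 0 < t <= 1 by rewrite t0 ge_min lexx.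
  have h1 : `|p`_0| <= t * (K + L).
    have -> : p`_0 = p.[t] - t * d.[t] by rewrite pE addrK.
    apply: le_trans (ler_normB _ _) _; rewrite mulrDr; apply: lerD.
      apply: le_trans (hp t tt) _; rewrite exprS mulrCA ler_pM2l// ler_piMr//.
      by apply: exprn_ile1; [exact: ltW|case/andP: tt].
    by rewrite normrM gtr0_norm// ler_pM2l// dL.
  have h2 : t * (K + L + 1) <= `|p`_0| / 2.
    have : t <= `|p`_0| / (2 * (K + L + 1)) by rewrite ge_min lexx orbT.
    rewrite -(ler_pM2r KL1) => h; apply: le_trans h _.
    rewrite le_eqVlt; apply/orP; left; apply/eqP; field; rewrite gt_eqF//.
  have h3 : t * (K + L) <= t * (K + L + 1) by rewrite ler_pM2l// lerDl.
  lra.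
have hd t : 0 < t <= 1 -> `|d.[t]| <= K * t ^+ M.
  move=> tt; have t0 : 0 < t by case/andP: tt.
  by have := hp t tt; rewrite pE p0 add0r normrM gtr0_norm// exprS mulrCA ler_pM2l.
case=> [//|m] mM; have := IH d hd m mM.
by rewrite coef_drop_poly addn1.
Qed.

Lemma jet_bounded M f : alg q f ->
  exists2 C, 0 <= C & forall k, cmod k <= 1 -> forall x, cmod (jet k M f x) <= C.
Proof.
move=> fa; elim: M => [|M [C C0 hC]].
  by exists 0 => // k _ x; rewrite /jet big_ord0 cmod0.
have [D D0 hD] := alg_bounded (alg_cderiv M fa).
exists (C + D) => [|k k1 x]; first exact: addr_ge0.
rewrite jetS; apply: le_trans (cmodD _ _) _; apply: lerD; first exact: hC.
rewrite cmodM cmodX; apply: le_trans (hD x); rewrite ler_piMl ?cmod_ge0//.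
exact: exprn_ile1 (cmod_ge0 _) k1.
Qed.

Lemma conj_jet k M f x : alg q f ->
  conjc (jet k M f x) = jet (conjc k) M (fun x => conjc (f x)) x.
Proof.
move=> fa; elim: M => [|M IH]; first by rewrite /jet !big_ord0 conjc0.
by rewrite !jetS conjcD IH conjcM conjcX (cderivn_conj _ fa).
Qed.

(** Integration by parts in every term. This is the transposition of P_a and Q_a at the level of
    jets. *)
Lemma jet_dual k M f g : alg q f -> alg q g ->
  cint mu (fun x => f x * jet k M g x) = cint mu (fun x => jet (- k) M f x * g x).
Proof.
move=> fa ga; elim: M => [|M IH].
  by congr (cint mu _); apply/funext => x; rewrite /jet !big_ord0 mulr0 mul0r.
have i1 := alg_L1 (alg_mul fa (alg_jet k M ga)).
have i2 := alg_L1 (alg_mul fa (alg_cderiv M ga)).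
have j1 := alg_L1 (alg_mul (alg_jet (- k) M fa) ga).
have j2 := alg_L1 (alg_mul (alg_cderiv M fa) ga).
transitivity (1 * cint mu (fun x => f x * jet k M g x) +
    k ^+ M * cint mu (fun x => f x * cderiv M g x)).
  by rewrite -(cint_lin2 _ _ i1 i2); apply: cint_ext => x; rewrite jetS; ring.
rewrite IH (cint_by_parts _ fa ga) mulrA -(cint_lin2 _ _ j1 j2); apply: cint_ext => x.
by rewrite jetS -[- k]mulN1r exprMn; ring.
Qed.

(** The jet is the truncated geometric series for the inverse of 1 - k d/dx applied to f, and the
    sum telescopes. *)
Lemma jet_derivative k M f x : alg q f ->
  k * cderiv 1 (jet k M f) x = jet k M f x - f x + k ^+ M * cderiv M f x.
Proof.
move=> fa; elim: M => [|M IH].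
  have -> : jet k 0 f = fun x => 0 * q x.
    by apply/funext => y; rewrite /jet big_ord0 mul0r.
  by rewrite (cderivnZ 1 0 alg_q) cderiv0; ring.
have -> : jet k M.+1 f = fun x => jet k M f x + k ^+ M * cderiv M f x.
  by apply/funext => y; rewrite jetS.
have da := alg_cderiv M fa.
rewrite (cderivnD 1 (alg_jet k M fa) (alg_scale (k ^+ M) da)) (cderivnZ 1 _ da) mulrDr IH.
by rewrite -cderivS exprS; ring.
Qed.

(** Conjugation at imaginary k exchanges the jets of q and of conj q, and transposing the outer jet
    restores the original integral. The identity is exact, in contrast to [conj_A5]. *)
Lemma conj_B5 k M : conjc k = - k -> conjc (B5 k M) = B5 k M.
Proof.
move=> kc; have qa := alg_q; have qca := alg_conj qa.
have pa := alg_jet (- k) M qca; have sa := alg_jet k M qa.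
have ga := alg_mul qa (alg_mul pa pa).
have ja := alg_mul qca (alg_mul (alg_mul sa sa) (alg_jet (- k) M ga)).
have i2 : cL1 mu (fun x => qc x * (jet k M q x ^+ 2 *
    jet (- k) M (fun x => q x * (jet (- k) M qc x * jet (- k) M qc x)) x)).
  by apply: cL1_ext (alg_L1 ja) => x; ring.
have ckN : conjc (- k) = k by rewrite conjcN kc opprK.
have cs x : conjc (jet k M q x) = jet (- k) M qc x by rewrite (conj_jet k M x qa) kc.
have cp x : conjc (jet (- k) M qc x) = jet k M q x by rewrite -cs conjcK.
have ha := alg_mul qca (alg_mul sa sa).
rewrite /B5 -(cint_conj i2).
transitivity (cint mu (fun x => (q x * (jet (- k) M qc x * jet (- k) M qc x)) *
    jet k M (fun x => qc x * (jet k M q x * jet k M q x)) x)).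
  apply: cint_ext => x; rewrite !conjcM (conj_jet _ _ x ga) conjcK !cs ckN.
  rewrite -[in RHS]mulrA; congr (_ * (_ * _)); congr (jet k M _ x); apply/funext => y.
  by rewrite !conjcM cp.
rewrite (jet_dual k M ga ha); apply: cint_ext => x; ring.
Qed.

(* For p = [jet (- k) M qc] and s = [jet k M q] with k imaginary, conjugation swaps p
   and s, and k (ps)' = q* s - q p up to O(k^M), so the difference is the integral
   of - k (ps)' (ps)^2 up to O(k^M). *)
Lemma conj_A5 M : exists2 K, 0 <= K & forall k, conjc k = - k -> cmod k <= 1 ->
  cmod (A5 k M - conjc (A5 k M)) <= K * cmod k ^+ M.
Proof.
have qa := alg_q; have qca := alg_conj qa.
have [C1 C10 hC1] := jet_bounded M qa; have [C2 C20 hC2] := jet_bounded M qca.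
have e2i := alg_L1 (alg_cderiv M qa).
pose C := C1 + C2; have C0 : 0 <= C by exact: addr_ge0.
(* The telescoping remainder is at most 2 C |k|^M times the M-th derivative of q in modulus, and it
   is multiplied by four jets bounded by C. *)
exists (2 * C ^+ 5 * Nint mu (cderiv M q)).
  by rewrite !mulr_ge0 ?exprn_ge0 ?Nint_ge0.
move=> k kc k1.
have pa := alg_jet (- k) M qca; have sa := alg_jet k M qa.
set p := jet (- k) M qc in pa *; set s := jet k M q in sa *.
have bp x : cmod (p x) <= C.
  by apply: (@le_trans _ _ C2); [apply: hC2; rewrite cmodN|rewrite lerDr].
have bs x : cmod (s x) <= C.
  by apply: (@le_trans _ _ C1); [exact: hC1|rewrite lerDl].
have cs x : conjc (s x) = p x by rewrite /s (conj_jet k M x qa) kc.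
have cp x : conjc (p x) = s x by rewrite -cs conjcK.
have i1 : cL1 mu (fun x => q x * (p x ^+ 3 * s x ^+ 2)).
  apply: cL1_ext (alg_L1 (alg_mul qa (alg_mul (alg_mul pa (alg_mul pa pa)) (alg_mul sa sa)))) => x.
  ring.
have i2 : cL1 mu (fun x => qc x * (s x ^+ 3 * p x ^+ 2)).
  apply: cL1_ext (alg_L1 (alg_mul qca (alg_mul (alg_mul sa (alg_mul sa sa)) (alg_mul pa pa)))) => x.
  ring.
pose w x := p x * s x.
have wa : alg q w := alg_mul pa sa.
have w0 : cint mu (fun x => cderiv 1 w x * (w x * w x)) = 0.
  have h := alg_cint_cderiv1 (alg_mul wa (alg_mul wa wa)).
  have j := alg_L1 (alg_mul (alg_cderiv 1 wa) (alg_mul wa wa)).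
  have E : cint mu (cderiv 1 (fun x => w x * (w x * w x))) =
      3 * cint mu (fun x => cderiv 1 w x * (w x * w x)).
    rewrite -(cintZ 3 j) (cderiv1M wa (alg_mul wa wa)) (cderiv1M wa wa).
    apply: cint_ext => x; ring.
  move: h; rewrite E => /eqP; rewrite mulf_eq0 pnatr_eq0 => /eqP; exact.
pose r x := p x * (k ^+ M * cderiv M q x) - (- k) ^+ M * cderiv M qc x * s x.
have wE x : q x * p x - qc x * s x = - (k * cderiv 1 w x) + r x.
  have h1 := jet_derivative k M x qa; have h2 := jet_derivative (- k) M x qca.
  rewrite /w (cderiv1M pa sa) /r mulrDr -/p -/s in h1 h2 *.
  have -> : k * (p x * cderiv 1 s x) = p x * (s x - q x + k ^+ M * cderiv M q x).
    by rewrite -h1; ring.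
  have -> : k * (cderiv 1 p x * s x) = - (p x - qc x + (- k) ^+ M * cderiv M qc x) * s x.
    by rewrite -h2; ring.
  ring.
have ra : alg q r.
  have h := alg_add (alg_mul pa (alg_scale (k ^+ M) (alg_cderiv M qa)))
    (alg_scale (-1) (alg_mul (alg_scale ((- k) ^+ M) (alg_cderiv M qca)) sa)).
  rewrite (_ : r = fun x => p x * (k ^+ M * cderiv M q x) +
    -1 * ((- k) ^+ M * cderiv M qc x * s x)) //.
  by apply/funext => x; rewrite mulN1r.
have j1 := alg_L1 (alg_mul (alg_cderiv 1 wa) (alg_mul wa wa)).
have j2 := alg_L1 (alg_mul ra (alg_mul wa wa)).
have E : A5 k M - conjc (A5 k M) = cint mu (fun x => r x * (w x * w x)).
  rewrite /A5 -/p -/s -(cint_conj i1).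
  transitivity (cint mu (fun x => q x * (p x ^+ 3 * s x ^+ 2)) -
      cint mu (fun x => qc x * (s x ^+ 3 * p x ^+ 2))).
    by congr (_ - _); apply: cint_ext => x; rewrite !(conjcM, conjcX) cp cs.
  rewrite -(cintB i1 i2) -[RHS]add0r -[X in X + _](mulr0 (- k)) -[X in - k * X]w0.
  rewrite -[cint mu (fun x => r x * _)]mul1r -(cint_lin2 _ _ j1 j2); apply: cint_ext => x.
  transitivity ((q x * p x - qc x * s x) * (w x * w x)); first by rewrite /w; ring.
  by rewrite wE; ring.
rewrite E; apply: (cmod_cint_le j2).
have -> : 2 * C ^+ 5 * Nint mu (cderiv M q) * cmod k ^+ M =
    Nint mu (fun x => (2 * C ^+ 5 * cmod k ^+ M)%:C * cderiv M q x).
  rewrite (NintZ _ e2i) cmod_real ger0_norm; first by ring.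
  by rewrite !mulr_ge0 ?exprn_ge0 ?cmod_ge0.
apply: (le_Nint j2 (cL1Z _ e2i)) => x.
rewrite [leRHS]cmodM cmod_real ger0_norm; last by rewrite !mulr_ge0 ?exprn_ge0 ?cmod_ge0.
have bw : cmod (w x) <= C * C by rewrite cmodM ler_pM ?cmod_ge0.
have br : cmod (r x) <= 2 * C * cmod k ^+ M * cmod (cderiv M q x).
  apply: le_trans (cmodB _ _) _; rewrite !cmodM !cmodX cmodN (cderivn_conj _ qa) cmod_conjc.
  have h : 0 <= cmod k ^+ M * cmod (cderiv M q x) by rewrite mulr_ge0 ?exprn_ge0 ?cmod_ge0.
  have := ler_wpM2r h (bp x); have := ler_wpM2r h (bs x); rewrite [_ * cmod (s x)]mulrC; lra.
rewrite cmodM [cmod (w x * w x)]cmodM.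
apply: (@le_trans _ _ (2 * C * cmod k ^+ M * cmod (cderiv M q x) * (C * C * (C * C)))).
  by rewrite ler_pM ?mulr_ge0 ?cmod_ge0// ler_pM ?cmod_ge0.
by rewrite le_eqVlt; apply/orP; left; apply/eqP; ring.
Qed.

(** At k = it the imaginary part is a real polynomial in t with coefficients Im (i^m c_m). [B5]
    contributes nothing to it and [A5] only O(t^M), so its coefficients below degree M vanish. *)
Lemma quintic_poly_real M m : (m < M)%N -> Im (iC ^+ m * (quintic_poly M)`_m) = 0.
Proof.
move=> mM; have [K K0 hK] := conj_A5 M.
pose rp : {poly R} := \poly_(i < size (quintic_poly M)) Im (iC ^+ i * (quintic_poly M)`_i).
have rpE t : rp.[t] = Im (quintic_poly M).[iC * t%:C].
  rewrite /rp horner_poly [in RHS]horner_coef.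
  have ImS (I : Type) (r : seq I) (F : I -> R[i]) : Im (\sum_(i <- r) F i) = \sum_(i <- r) Im (F i).
    by elim: r => [|i r IH]; rewrite ?big_nil ?big_cons// ImD IH.
  rewrite ImS; apply: eq_bigr => i _.
  by rewrite -ImMr rmorphXn; congr Im; rewrite exprMn; ring.
have h : forall t, 0 < t <= 1 -> `|rp.[t]| <= K * t ^+ M.
  move=> t /andP[t0 t1]; rewrite rpE -A5_B5 ImD.
  pose k : R[i] := iC * t%:C.
  have kc : conjc k = - k.
    by rewrite /k conjcM conj_iC mulNr; congr (- (_ * _)); apply: complex_eqP => //=; rewrite oppr0.
  have ck : cmod k = t by rewrite cmodM cmod_iC mul1r cmod_real gtr0_norm.
  have B0 : Im (B5 k M) = 0.
    have := congr1 (fun z => Im z) (conj_B5 M kc); rewrite Im_conjc; lra.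
  rewrite B0 addr0; have := hK k kc; rewrite ck => /(_ t1); apply: le_trans.
  apply: le_trans (Im_le_cmod _); rewrite ImD ImN Im_conjc opprK.
  rewrite -mulr2n normrMn mulr2n; have := normr_ge0 (Im (A5 k M)); lra.
have := poly_small_coef h mM; rewrite coef_poly; case: ltnP => // sm _.
by rewrite nth_default// mulr0.
Qed.

(** The real part in H_j discards nothing, as i^m c_m is real. The powers of i match because (-i)^(m
    + 4) (-1)^m = i^m. *)
Lemma H6_coef M m : (m + 4 < M)%N ->
  (H6 q (m + 4))%:C = iC ^+ m * (quintic_poly M)`_m.
Proof.
move=> mM; have m4 : (m < M)%N by lia.
have E : (- iC) ^+ (m + 4) * quintic_sum (m + 4) = iC ^+ m * (quintic_poly M)`_m.
  rewrite (quintic_poly_coef mM) mulrA -[iC in RHS]opprK -[- - iC in RHS]mulN1r exprMn.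
  have i4 : (- iC) ^+ 4 = 1 :> R[i].
    have -> : (- iC) ^+ 4 = (iC * iC) ^+ 2 :> R[i] by ring.
    by rewrite iC2 sqrrN expr1n.
  have s2 : (-1) ^+ m * (-1) ^+ m = 1 :> R[i] by rewrite -expr2 sqrr_sign.
  transitivity ((-1) ^+ m * (-1) ^+ m * ((- iC) ^+ m * quintic_sum (m + 4))); last by ring.
  by rewrite s2 mul1r exprD i4 mulr1.
rewrite H6E E; apply: complex_eqP => //=.
by rewrite (quintic_poly_real m4).
Qed.

(** * The remainder estimate and the asymptotic series *)

Lemma Nint_sum (I : Type) (r : seq I) (F : I -> R -> R[i]) : (forall i, cL1 mu (F i)) ->
  Nint mu (fun x => \sum_(i <- r) F i x) <= \sum_(i <- r) Nint mu (F i).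
Proof.
move=> Fi; elim: r => [|i r IH].
  rewrite big_nil NintE; under eq_Rintegral do rewrite big_nil cmod0.
  by rewrite /Rintegral integral0.
rewrite big_cons; apply: le_trans (lerD (lexx _) IH).
have -> : (fun x => \sum_(j <- i :: r) F j x) = (fun x => F i x + \sum_(j <- r) F j x).
  by apply/funext => x; rewrite big_cons.
by apply: NintD => //; apply: cL1_sum.
Qed.

(** Provides the hypothesis [hG] of the truncation estimate with a constant that is uniform in k. *)
Lemma Nint_qpp n M : exists2 K, 0 <= K & forall k, cmod k <= 1 ->
  Nint mu (cderiv n (fun x => q x * (jet k M qc x * jet k M qc x))) <= K.
Proof.
pose G (i j : nat) := cderiv n (fun t => q t * conjc (cderiv i q t * cderiv j q t)).
have Gi i j : cL1 mu (G i j) := alg_L1 (alg_cderiv n (alg_quadratic i j)).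
exists (\sum_(i < M) \sum_(j < M) Nint mu (G i j)).
  by do 2 (apply: sumr_ge0 => ? _); exact: Nint_ge0.
move=> k k1.
have -> : cderiv n (fun x => q x * (jet k M qc x * jet k M qc x)) =
    (fun x => \sum_(i < M) \sum_(j < M) k ^+ (i + j) * G i j x).
  by apply/funext => x; exact: cderiv_qpp.
have gz (i j : 'I_M) : cL1 mu (fun x => k ^+ (i + j) * G i j x) by exact: cL1Z.
have gs (i : 'I_M) : cL1 mu (fun x => \sum_(j < M) k ^+ (i + j) * G i j x) by exact: cL1_sum.
apply: le_trans (Nint_sum _ gs) _; apply: ler_sum => i _.
apply: le_trans (Nint_sum _ (gz i)) _; apply: ler_sum => j _.
rewrite (NintZ _ (Gi i j)) cmodX ler_piMl ?Nint_ge0//.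
exact: exprn_ile1 (cmod_ge0 _) k1.
Qed.

Lemma b6_expansion (M : nat) : exists2 K, 0 <= K & forall lam : R[i], 0 < Im (lam ^+ 2) ->
  cmod (iC / (2 * lam ^+ 2)) <= 1 ->
  cmod (b6 q lam + lam ^+ 6 * ((iC / (2 * lam ^+ 2)) ^+ 5 *
    (quintic_poly M).[iC / (2 * lam ^+ 2)])) <= K * cmod lam ^+ 6 * cmod (iC / (2 * lam ^+ 2)) ^+ M.
Proof.
have le5 (u v w x y : R) : 0 <= u -> 0 <= v -> 0 <= w -> 0 <= x -> 0 <= y ->
    let c := u + v + w + x + y in [/\ u <= c, v <= c, w <= c, x <= c & y <= c].
  by move=> u0 v0 w0 x0 y0 c; rewrite /c; split; lra.
have qa := alg_q; have qca := alg_conj qa.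
have [C1 C10 hC1] := jet_bounded M qa; have [C2 C20 hC2] := jet_bounded M qca.
have [C3 C30 hC3] := Nint_qpp M M.
pose C := C1 + C2 + C3 + Nint mu q + Nint mu (cderiv M q).
have [l1 l2 l3 hN hM] := le5 _ _ _ _ _ C10 C20 C30 (Nint_ge0 mu q) (Nint_ge0 mu (cderiv M q)).
rewrite -/C in l1 l2 l3 hN hM.
have C0 : 0 <= C := le_trans C10 l1.
exists (9 * C ^+ 6 + C ^+ 4).
  by rewrite addr_ge0// ?mulr_ge0 ?exprn_ge0.
move=> lam hlam k1; pose a : R[i] := 2 * lam ^+ 2.
have hq2 : square_integrable q.
  have [D D0 hD] := alg_bounded qa; exact: bounded_L1_sq (alg_L1 qa) hD.
have a0 : 0 < Im a by exact: Im_a.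
have kN1 : cmod (- (iC / a)) <= 1 by rewrite cmodN.
have hp x := le_trans (hC2 _ kN1 x) l2.
have hs x := le_trans (hC1 _ k1 x) l1.
have hG := le_trans (hC3 _ kN1) l3.
have T := truncation_error a0 k1 hN hp hs hM hG.
have E (L S Y : R[i]) : - L * S + L * Y = - L * (S - Y) by ring.
rewrite (b6_position hq2 hlam) -A5_B5 E [leLHS]cmodM cmodN [cmod (lam ^+ 6)]cmodX.
rewrite [(_ + _) * cmod lam ^+ 6]mulrC -[leRHS]mulrA.
apply: ler_wpM2l; first by rewrite exprn_ge0 ?cmod_ge0.
exact: T.
Qed.

Lemma quintic_poly_tail M n : exists2 L, 0 <= L & forall k, cmod k <= 1 ->
  cmod ((quintic_poly M).[k] - \sum_(m < n) (quintic_poly M)`_m * k ^+ m) <= L * cmod k ^+ n.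
Proof.
pose d := drop_poly n (quintic_poly M).
exists (\sum_(i < size d) cmod d`_i); first by apply: sumr_ge0 => i _; exact: cmod_ge0.
move=> k k1; have -> : \sum_(m < n) (quintic_poly M)`_m * k ^+ m = (take_poly n (quintic_poly M)).[k].
  by rewrite -horner_poly.
rewrite -{1}(poly_take_drop n (quintic_poly M)) hornerD hornerM hornerXn addrAC subrr add0r.
rewrite cmodM cmodX; apply: ler_wpM2r; first by rewrite exprn_ge0 ?cmod_ge0.
exact: horner_le.
Qed.

(** With k = i / (2 lam^2) one has lam^6 k^(m + 5) = i^(m + 1) 2^-(m + 5) lam^-(2m + 4), and j = m +
    4. *)
Lemma H6_term M m (lam : R[i]) : (m + 4 < M)%N -> lam != 0 ->
  - iC * (H6 q (m + 4))%:C / 2 ^+ (m + 4).+1 * lam ^ (4%:Z - (2 * (m + 4))%:Z) =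
  - lam ^+ 6 * ((iC / (2 * lam ^+ 2)) ^+ 5 *
    ((quintic_poly M)`_m * (iC / (2 * lam ^+ 2)) ^+ m)).
Proof.
move=> mM l0; rewrite (H6_coef mM).
have -> : (4%:Z - (2 * (m + 4))%:Z) = - (2 * m + 4)%N%:Z by lia.
rewrite -exprnN.
have i5 : iC ^+ 5 = iC :> R[i].
  have -> : iC ^+ 5 = (iC * iC) ^+ 2 * iC :> R[i] by ring.
  by rewrite iC2 sqrrN expr1n mul1r.
have E5 (n : nat) : (iC / (2 * lam ^+ 2)) ^+ n = iC ^+ n / (2 ^+ n * (lam ^+ 2) ^+ n).
  by rewrite expr_div_n exprMn.
have e1 : 2 ^+ (m + 4).+1 = 2 ^+ m * 2 ^+ 5 :> R[i] by rewrite -exprD -addnS.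
have e2 : lam ^+ (2 * m + 4)%N = (lam ^+ 2) ^+ m * lam ^+ 4 by rewrite exprD exprM.
have p2 : (2 ^+ m : R[i]) != 0 by rewrite expf_neq0// pnatr_eq0.
have pl : (lam ^+ 2) ^+ m != 0 by rewrite !expf_neq0.
rewrite !E5 i5 e1 e2; move: ((lam ^+ 2) ^+ m) (2 ^+ m) p2 pl => u v v0 u0.
by field; rewrite u0 v0 l0.
Qed.

Lemma b6_asymptotics :
  asymptotic_series [set lam : R[i] | 0 < Im (lam ^+ 2)] (b6 q) 4
    (fun j => - iC * (H6 q j)%:C / 2 ^+ j.+1)
    (fun j lam => lam ^ (4%:Z - (2 * j)%:Z)).
Proof.
(* With M = N + 2 the error |lam|^6 |k|^M is of the order |lam|^(2 - 2N), smaller by |lam|^-2 than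
   the last gauge function. The n = N - 3 lowest coefficients give the terms j = 4, ..., N, and the
   tail k^(5 + n) is again k^M. *)
move=> N N4 eps eps0; pose M := N.+2; pose n := (N - 3)%N.
have EN : 4%:Z - (2 * N)%:Z = - (2 * N - 4)%N%:Z by lia.
have M2 : (2 * M = 6 + 2 + (2 * N - 4))%N by rewrite /M; lia.
have M5 : M = (5 + n)%N by rewrite /M /n; lia.
have nE : N.+1 = (n + 4)%N by rewrite /n; lia.
have nM (m : nat) : (m < n)%N -> (m + 4 < M)%N by rewrite /n /M; lia.
have [K K0 hK] := b6_expansion M; have [L L0 hL] := quintic_poly_tail M n.
(* The first bound ensures |k| <= 1. The second gives (K + L) / |lam|^2 <= eps, since |lam| <=
   |lam|^2 here. *)
exists (Num.max 1 ((K + L) / eps)) => lam hlam; rewrite gt_max => /andP[l1 lKL].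
set c : R := cmod lam in l1 lKL *.
have c0 : 0 < c by exact: lt_trans ltr01 l1.
have lam0 : lam != 0 by rewrite -cmod_gt0.
pose k : R[i] := iC / (2 * lam ^+ 2).
have ck : cmod k <= (c ^+ 2)^-1.
  rewrite cmodM cmod_iC mul1r cmodV cmodM cmodX cmod_nat invfM -/c.
  by rewrite ler_piMl ?invr_ge0 ?exprn_ge0 ?(ltW c0)//; lra.
have c2 : 1 <= c ^+ 2 by rewrite expr_ge1// ltW.
have k1 : cmod k <= 1.
  by apply: le_trans ck _; rewrite invf_le1// (lt_le_trans ltr01).
have E : \sum_(4 <= j < N.+1) - iC * (H6 q j)%:C / 2 ^+ j.+1 * lam ^ (4%:Z - (2 * j)%:Z) =
    - lam ^+ 6 * (k ^+ 5 * \sum_(m < n) (quintic_poly M)`_m * k ^+ m).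
  rewrite nE -{1}[4%N]add0n big_addn addnK big_mkord !mulr_sumr; apply: eq_bigr => m _.
  by rewrite (@H6_term M)//; exact: nM (ltn_ord m).
have h1 := hK lam hlam k1; have h2 := hL k k1.
rewrite E; have -> : b6 q lam - - lam ^+ 6 * (k ^+ 5 * \sum_(m < n) (quintic_poly M)`_m * k ^+ m) =
    (b6 q lam + lam ^+ 6 * (k ^+ 5 * (quintic_poly M).[k])) -
    lam ^+ 6 * (k ^+ 5 * ((quintic_poly M).[k] - \sum_(m < n) (quintic_poly M)`_m * k ^+ m)).
  ring.
apply: le_trans (cmodB _ _) _.
have h3 : cmod (lam ^+ 6 * (k ^+ 5 * ((quintic_poly M).[k] -
    \sum_(m < n) (quintic_poly M)`_m * k ^+ m))) <= L * c ^+ 6 * cmod k ^+ M.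
  rewrite cmodM [cmod (k ^+ 5 * _)]cmodM [cmod (lam ^+ 6)]cmodX [cmod (k ^+ 5)]cmodX -/c.
  have -> : cmod k ^+ M = cmod k ^+ 5 * cmod k ^+ n.
    by rewrite -exprD -M5.
  rewrite (_ : L * c ^+ 6 * _ = c ^+ 6 * (cmod k ^+ 5 * (L * cmod k ^+ n))); last by ring.
  apply: ler_wpM2l; first by rewrite exprn_ge0// ltW.
  by apply: ler_wpM2l => //; rewrite exprn_ge0 ?cmod_ge0.
apply: le_trans (lerD h1 h3) _; rewrite -/c -/k -!mulrDl.
have -> : cmod (lam ^ (4%:Z - (2 * N)%:Z)) = (c ^+ (2 * N - 4))^-1.
  by rewrite EN -exprnN cmodV cmodX.
have kM : cmod k ^+ M <= (c ^+ 2)^-1 ^+ M.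
  by rewrite ler_pXn2r// ?nnegrE ?cmod_ge0 ?invr_ge0 ?exprn_ge0// ltW.
apply: (@le_trans _ _ ((K + L) * c ^+ 6 * (c ^+ 2)^-1 ^+ M)).
  by apply: ler_wpM2l => //; rewrite mulr_ge0 ?addr_ge0 ?exprn_ge0// ltW.
have -> : (c ^+ 2)^-1 ^+ M = (c ^+ 6)^-1 * (c ^+ 2)^-1 * (c ^+ (2 * N - 4))^-1.
  rewrite exprVn -exprM -!invfM -!exprD; by rewrite M2.
have cancel (z u v w : R) : u != 0 -> z * u * (u^-1 * v * w) = z * v * w by move=> u0; field.
rewrite cancel ?expf_neq0 ?gt_eqF//.
apply: ler_wpM2r; first by rewrite invr_ge0 exprn_ge0// ltW.
rewrite ler_pdivrMr ?exprn_gt0//; move: lKL; rewrite ltr_pdivrMr// => /ltW h.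
apply: le_trans h _; rewrite mulrC; apply: ler_wpM2l; first exact: ltW.
by rewrite expr2 ler_peMl// ltW.
Qed.

End Alg.
End Schwartz.

Theorem lemma7p2 (R : realType) (q : R -> R[i]) (hq : square_integrable q) :
  (forall qhat : R -> R[i], is_fourier_transform q qhat ->
    forall lam : R[i], 0 < Im (lam ^+ 2) -> b6 q lam = b6_fourier qhat lam)
  /\
  (schwartz q ->
    asymptotic_series [set lam : R[i] | 0 < Im (lam ^+ 2)] (b6 q) 4
      (fun j => - iC * (H6 q j)%:C / 2 ^+ j.+1)
      (fun j lam => lam ^ (4%:Z - (2 * j)%:Z))).
Proof.
split; last exact: b6_asymptotics.
by move=> qhat hqhat lam hlam; exact: b6_fourierE.
Qed.
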